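(* There exist suitably large constants $\Theta'>0$ and $c\geq 1$ such that the following holds. Let $Q$ be large and let $\{\mathbb{Y}(n)\}_{q_n\leq Q}$ be a sequence of independent random variables satisfying CRVH$(\mathbb{Y})$. Then \[ \Phi_Q(\mathbb{Y}, V)= \exp\left(-\alpha\beta e^{-\eta_{\mathbb{Y}}-1} W^{A-1}e^W \left(1+O\left(\frac{\sqrt{\log W}}{W^{1/2}}+\frac{1}{W^{(B-1)/2}}\right)\right)\right) \] for all $V$ with $c\leq W= W(V)\leq \log Q - \log\log Q - \Theta'$.
   Context: Let $\mathcal A=\{1\leq q_1\leq q_2\leq \dots\}$ be an infinite sequence of real numbers such that for $x\geq 2\beta'$, $\mathcal A(x):=\#\{n: q_n\leq x\} = \alpha \int_{\beta'}^x (\log (t/\beta))^{A-1}(1+O(1/(\log t)^B))\,dt$, where $\alpha,\beta>0$, $A\geq 0$, $B>\max\{A,1\}$ are constants and $\beta'=(2+\beta)^2$. Let $H(x)=\sum_{q_n\leq x}1/q_n$. Let $C_{\mathcal A}$ be the constant such that $H(y)=\frac{\alpha}{A}(\log (y/\beta))^A+C_{\mathcal A}+o(1)$ as $y\to\infty$ if $A>0$, and $H(y)=\alpha\log\log(y/\beta)+C_{\mathcal A}+o(1)$ if $A=0$. For $V\geq 1+C_{\mathcal A}$ define $W(V)=\big(\frac{A}{\alpha}(V-C_{\mathcal A})\big)^{1/A}$ if $A>0$ and $W(V)=\exp\big(\frac1\alpha(V-C_{\mathcal A})\big)$ if $A=0$. For random variables $\mathbb Z(n)$ put $H_{\mathbb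 Z}(Q)=\sum_{q_n\leq Q}\mathbb Z(n)/q_n$ and $\Phi_Q(\mathbb Z,V)=\mathbb P(H_{\mathbb Z}(Q)>V)$. CRVH$(\mathbb{Y})$: the independent random variables $\mathbb Y(n)$ satisfy: (i) each $\mathbb Y(n)$ is supported on $[-1,1]$ with $\mathbb E(\mathbb Y(n))=0$; (ii) there is an absolute constant $c_0>0$ with $\mathbb P(\mathbb Y(n)>1-1/t)\gg \exp(-c_0e^{\sqrt t})$ for all $t\geq 1$, with absolute implied constant; (iii) there exist independent random variables $\{\mathbb Y_n\}_{n\geq1}$, each distributed identically to a random variable $\mathbb Y$, such that $\mathbb Y(n)$ depends on $\mathbb Y_n$ and $\mathbb Y(n)=\mathbb Y_n+O(1/(\log n)^2)$. Define $f_{\mathbb Y}(t)=\log\mathbb E(e^{t\mathbb Y})$ for $0\leq t<1$, $f_{\mathbb Y}(t)=\log\mathbb E(e^{t\mathbb Y})-t$ for $t\geq1$, and $\eta_{\mathbb Y}=\int_0^\infty f_{\mathbb Y}(u)u^{-2}\,du$. *)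

(* Defs.v *)
From HB Require Import structures.
From mathcomp Require Import all_boot all_order all_algebra.
From mathcomp Require Import all_classical all_reals all_analysis.
Set Implicit Arguments.
Unset Strict Implicit.
Unset Printing Implicit Defensive.
Import Order.TTheory GRing.Theory Num.Theory.
Import numFieldNormedType.Exports.
Local Open Scope classical_set_scope.
Local Open Scope ring_scope.

(* The sequence q_1 <= q_2 <= ... is indexed from 0: the real [q n] is q_(n+1),
   and likewise for the random variables.  Hence log n becomes [ln n.+1%:R]. *)
Definition upto (R : realType) (q : nat -> R) (x : R) : set nat :=
  [set n | q n <= x].

(* The factor 1 + O(1/(log t)^B) is the function [1 + eps t]; it may depend on
   x, while the implied constant K may not.  [counting] is the cardinality,
   +oo for an infinite set, so the equation says that A(x) is finite. *)
Record is_sequenceA (R : realType) (alpha beta A B : R) (q : nat -> R) : Prop :=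
  IsSequenceA {
    seqA_ge1 : forall n, 1 <= q n;
    seqA_nondecreasing : forall m n, (m <= n)%N -> q m <= q n;
    seqA_counting : exists K : R, forall x : R,
      2 * (2 + beta) ^+ 2 <= x ->
      exists eps : R -> R,
        [/\ measurable_fun `[(2 + beta) ^+ 2, x] eps,
            forall t, (2 + beta) ^+ 2 <= t <= x ->
              `|eps t| <= K / (ln t `^ B) &
            counting (upto q x) =
              (alpha * \int[lebesgue_measure]_(t in `[(2 + beta) ^+ 2, x])
                 (ln (t / beta) `^ (A - 1) * (1 + eps t)))%:E] }.

Definition Hsum (R : realType) (q : nat -> R) (x : R) : R :=
  \sum_(n \in upto q x) (q n)^-1.

Definition is_constA (R : realType) (alpha beta A : R) (q : nat -> R)
    (C : R) : Prop :=
  (Hsum q y - (if A == 0 then alpha * ln (ln (y / beta))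
               else alpha / A * ln (y / beta) `^ A)) @[y --> +oo] --> C.

Definition Wfun (R : realType) (alpha A C V : R) : R :=
  if A == 0 then expR ((V - C) / alpha) else (A / alpha * (V - C)) `^ A^-1.

Section Random.
Context (R : realType) (d : measure_display) (T : measurableType d).
Context (P : probability T R).

Definition independent_RVs (X : nat -> {RV P >-> R}) : Prop :=
  forall (s : seq nat) (E : nat -> set R), uniq s ->
    (forall n, measurable (E n)) ->
    P (\bigcap_(n in [set` s]) (X n @^-1` E n)) =
    (\prod_(n <- s) P (X n @^-1` E n))%E.

Definition Hrandom (q : nat -> R) (Z : nat -> T -> R) (Q : R) (w : T) : R :=
  \sum_(n \in upto q Q) (Z n w / q n).

Definition Phi (q : nat -> R) (Q : R) (Z : nat -> T -> R) (V : R) : \bar R :=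
  P [set w | V < Hrandom q Z Q w].

Definition fY (Y : T -> R) (t : R) : R :=
  let L := ln (fine 'E_P[fun w => expR (t * Y w)]) in
  if t < 1 then L else L - t.

Definition etaY (Y : T -> R) : R :=
  \int[lebesgue_measure]_(u in `[0, +oo[) (fY Y u / u ^+ 2).

End Random.

Definition same_distribution (R : realType)
    (d1 : measure_display) (T1 : measurableType d1) (P1 : probability T1 R)
    (d2 : measure_display) (T2 : measurableType d2) (P2 : probability T2 R)
    (X1 : {RV P1 >-> R}) (X2 : {RV P2 >-> R}) : Prop :=
  forall E : set R, measurable E ->
    distribution P1 X1 E = distribution P2 X2 E.

(* c0, kappa and K are the absolute constants: c0 and the implied constant
   kappa of the lower tail bound, and the implied constant K of the coupling
   error.  The last clause starts at [0 < n], i.e. the second term of the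
   sequence, because 1/(log 1)^2 is no bound on the first one. *)
Record CRVH (R : realType) (c0 kappa K : R)
    (d : measure_display) (T : measurableType d) (P : probability T R)
    (d' : measure_display) (T' : measurableType d') (P' : probability T' R)
    (Ys : nat -> {RV P >-> R}) (Y : {RV P' >-> R}) : Prop := IsCRVH {
  CRVH_independent : independent_RVs Ys;
  CRVH_support : forall n, {ae P, forall w, -1 <= Ys n w <= 1};
  CRVH_mean : forall n, ('E_P[Ys n] = 0)%E;
  CRVH_tail : forall n t, 1 <= t ->
    ((kappa * expR (- (c0 * expR (Num.sqrt t))))%:E <=
       P [set w | (1 - t^-1 < Ys n w)%R])%E;
  CRVH_coupling : exists Yn : nat -> {RV P >-> R},
    [/\ independent_RVs Yn,
        forall n, same_distribution (Yn n) Y &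
        forall n, (0 < n)%N ->
          {ae P, forall w, `|Ys n w - Yn n w| <= K / ln n.+1%:R ^+ 2}] }.

(* Main.v *)
(* Exponential tilting.  Write s = beta e^w and let L(s) be the sum over
   q_n <= Q of log E exp(s Y(n) / q_n).  Cutting the q_n into cells
   beta e^(w+x) < q_n <= beta e^(w+x+h) with h of order 1/w, on which s / q_n is
   nearly constant, the counting asymptotics turn L(s) into
     s (Psi(w) + alpha eta w^(A-1)) + O(s w^(A-1) E(w)),   E(w) = log w / w + w^(1-B),
   where Psi is the expansion of H: subtracting u from log E exp(u Y) for u >= 1
   extracts H(beta e^w), and the rest is a Riemann sum for the integral eta of
   f_Y(u) / u^2.  Given V = Psi(W), the saddle point is w = W - 1 - eta, and
     L(s e^y) - s e^y V = - M e^y (1 - y) + O(M E(W)),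
   M = alpha beta e^(-eta-1) W^(A-1) e^W, for bounded y.  At y = 0, Markov's
   inequality gives the upper bound.  For the lower bound, tilt by s e^eps with
   eps^2 a large multiple of E(W): comparison with the tilts by s and s e^(2 eps)
   shows that half of the tilted mass lies in V < H <= Psi(W + 2 eps).  The loss
   in the exponent is then O(M eps), whence the square root in the error term. *)
Require Import Defs.
From HB Require Import structures.
From mathcomp Require Import all_boot all_order all_algebra.
From mathcomp Require Import all_classical all_reals all_analysis.
From mathcomp Require Import measurable_realfun.
From mathcomp Require Import ring lra.
Set Implicit Arguments.
Unset Strict Implicit.
Unset Printing Implicit Defensive.
Import Order.TTheory GRing.Theory Num.Theory.
Import numFieldNormedType.Exports.
Local Open Scope classical_set_scope.
Local Open Scope ring_scope.

(** * Log-moment generating functions *)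

(** All constants must be uniform in [Q], the probability spaces and the laws, while CRVH bounds the
    [Ys n] and reaches [Y] only through the coupling. The variables therefore enter the analysis
    only through [logmgf_like] and [coupled_family], with constants depending on [c0], [kappa], [K]
    alone, and the sequence only through [regular_count]. The definition of C_A gives H with error
    o(1); the rate w^(A-B) comes from comparing H with its main term at two points and sending the
    second to infinity. The coupling error K/(log n)^2 is small only where log n has order w, so the
    q_n below beta e^(w/2) are treated apart: there u = s/q_n >= e^(w/2), and the bound u - L(u) =
    O(u/(1 + log u)^2), which the lower tail hypothesis yields, is already small enough. The same
    bound, summed against a relative counting error (1 + x)/w at distance x to the left of w,
    produces the log w / w in E(w). On the right, stopping at Q drops an integral over [0, O(s/Q)],
    and W <= log Q - log log Q - Theta' is what makes this O(1/w). *)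

Section ExpBounds.
Context {R : realType}.
Implicit Types x y u v : R.

(** From e^(-x/2) >= 1 - x/2 one gets e^x <= (1 - x/2)^(-2). The remaining polynomial inequality
    factors with a factor 1 - x, whence the range x <= 1. *)
Lemma expR_leDxsqr x : x <= 1 -> expR x <= 1 + x + 2 * x ^+ 2.
Proof.
move=> x1.
have p0 : 0 < 1 - x / 2 by lra.
have h : (1 - x / 2) ^+ 2 <= expR (- x).
  have -> : - x = - (x / 2) + - (x / 2) by lra.
  rewrite expRD expr2.
  have : 1 - x / 2 <= expR (- (x / 2)) by apply: le_trans (expR_ge1Dx _); lra.
  by move=> h; apply: ler_pM => //; lra.
have e0 := expR_gt0 x.
have : (1 - x / 2) ^+ 2 * expR x <= 1.
  rewrite -[leRHS](expRxMexpNx_1 x) [leRHS]mulrC ler_pM2r //.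
have q : 1 <= (1 - x / 2) ^+ 2 * (1 + x + 2 * x ^+ 2).
  rewrite -subr_ge0.
  have -> : (1 - x / 2) ^+ 2 * (1 + x + 2 * x ^+ 2) - 1
    = x ^+ 2 * ((1 - x) * (5 / 4 - x / 2)) by field.
  by rewrite mulr_ge0 ?sqr_ge0 // mulr_ge0 //; lra.
move=> h2; rewrite -(ler_pM2l (x := (1 - x / 2) ^+ 2)) ?exprn_gt0 //.
exact: le_trans h2 q.
Qed.

Lemma expR_sub1_le x : expR x - 1 <= x * expR x.
Proof.
have e0 := expR_gt0 x.
have : (1 - x) * expR x <= 1.
  rewrite -[leRHS](expRxMexpNx_1 x) [leRHS]mulrC ler_pM2r //.
  by apply: le_trans (expR_ge1Dx _); lra.
lra.
Qed.

Lemma normr_expR_sub1 x : `|expR x - 1| <= `|x| * expR `|x|.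
Proof.
have h1 := expR_sub1_le x.
have h2 := expR_ge1Dx x.
have e0 := expR_gt0 x.
have [x0|x0] := leP 0 x.
  rewrite (ger0_norm x0) ger0_norm //; lra.
rewrite (ltr0_norm x0) ltr0_norm; last by rewrite subr_lt0 expR_lt1.
have : 1 <= expR (- x) by rewrite -expR0 ler_expR; lra.
nra.
Qed.

Lemma expR1_le4 : expR 1 <= 4 :> R.
Proof. by apply: le_trans (expR_leDxsqr _) _ => //; lra. Qed.

(** The term (v - u) x disappears in the mean when x is a centred variable. What is left gives
    [logmgf_lip], with the extra factor v that the cells with small argument require. *)
Lemma expR_second_order x u v : -1 <= x <= 1 -> 0 <= u <= v -> v <= 1 ->
  expR (v * x) - expR (u * x) - (v - u) * x <= 8 * v * (v - u).
Proof.
move=> /andP[x1 x2] /andP[u0 uv] v1.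
set a := u * x; set d := (v - u) * x.
have -> : v * x = a + d by rewrite /a /d; lra.
rewrite expRD.
have du : `|d| <= v - u.
  rewrite /d normrM ger0_norm; last by rewrite subr_ge0.
  by rewrite ler_piMr // ?subr_ge0 // ler_norml x1.
have au : `|a| <= u by rewrite /a normrM ger0_norm // ler_piMr // ler_norml x1.
have a4 : expR a <= 4.
  apply: le_trans expR1_le4; rewrite ler_expR.
  by move: au; rewrite ler_norml => /andP[]; lra.
have ea1 : `|expR a - 1| <= 4 * u.
  apply: le_trans (normr_expR_sub1 _) _; rewrite mulrC.
  apply: ler_pM => //.
  by apply: le_trans expR1_le4; rewrite ler_expR; lra.
have hd : expR d - 1 - d <= 2 * d ^+ 2.
  have := @expR_leDxsqr d _; move: du; rewrite ler_norml => /andP[d1 d2].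
  by move=> /(_ _); lra.
have d2 : d ^+ 2 <= (v - u) ^+ 2.
  by rewrite -(real_normK (num_real d)) lerXn2r ?nnegrE // ?subr_ge0.
have e0 := expR_gt0 a.
have -> : expR a * expR d - expR a - d = (expR a - 1) * d + expR a * (expR d - 1 - d).
  by rewrite /=; lra.
have t1 : (expR a - 1) * d <= 4 * u * (v - u).
  apply: le_trans (ler_norm _) _; rewrite normrM.
  by apply: ler_pM.
have t2 : expR a * (expR d - 1 - d) <= 4 * (2 * (v - u) ^+ 2).
  have p0 : 0 <= expR d - 1 - d by have := expR_ge1Dx d; lra.
  by apply: ler_pM => //; lra.
nra.
Qed.

(** The tangent line of t^l at t = 1, evaluated at t = e^x. Integrated, it replaces Jensen's
    inequality in [lmgf_scale_ge]. *)
Lemma expR_bernoulli (l x : R) : 1 <= l -> 1 + l * (expR x - 1) <= expR (l * x).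
Proof.
move=> l1.
have e0 := expR_gt0 x.
have h1 : expR x * (1 + (l - 1) * x) <= expR (l * x).
  have -> : l * x = x + (l - 1) * x by lra.
  by rewrite expRD ler_pM2l // expR_ge1Dx.
have := expR_sub1_le x.
nra.
Qed.

(** Lets an error of size sqrt u be absorbed into u/(1 + ln u)^2, the form of [logmgf_tail]. *)
Lemma sqr_1Dln_le u : 1 <= u -> (1 + ln u) ^+ 2 <= 16 * Num.sqrt u.
Proof.
move=> u1; have u0 : 0 < u by lra.
set y := ln u / 4.
have y0 : 0 <= y by rewrite divr_ge0 // ln_ge0.
have -> : Num.sqrt u = expR y ^+ 2.
  apply/eqP; rewrite -(@eqrXn2 _ 2) ?sqrtr_ge0 ?exprn_ge0 ?expR_ge0 //.
  rewrite sqr_sqrtr ?ltW // -exprM -expRM_natr.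
  have -> : y * (2 * 2)%N%:R = ln u by rewrite /y natrM; lra.
  by rewrite lnK.
have -> : 1 + ln u = 1 + 4 * y by rewrite /y; lra.
have h := expR_ge1Dx y.
have : 1 + 4 * y <= 4 * expR y by lra.
move=> h4.
have -> : 16 * expR y ^+ 2 = (4 * expR y) ^+ 2 by ring.
by rewrite lerXn2r ?nnegrE //; lra.
Qed.

End ExpBounds.

Section AlmostSureBounds.
Context {d : measure_display} {T : measurableType d} {R : realType}.
Variable P : probability T R.
Implicit Types F G : T -> R.

Lemma ae_bounded_integrable F (M : R) : measurable_fun setT F ->
  {ae P, forall w, `|F w| <= M} -> P.-integrable setT (EFin \o F).
Proof.
move=> mF bF; apply/integrableP; split; first exact/measurable_EFinP.
have M0 : (0 <= `|M|%:E :> \bar R)%E by rewrite lee_fin.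
apply: le_lt_trans (integral_le_bound _ measurableT _ M0 _) _.
- exact/measurable_EFinP.
- by apply: filterS bF => w h _ /=; rewrite lee_fin (le_trans h) // ler_norm.
- by rewrite [X in (_ * X)%E](_ : _ = 1%E) ?mule1 ?ltry //; exact: probability_setT.
Qed.

Lemma ae_le_Rintegral F G : P.-integrable setT (EFin \o F) ->
  P.-integrable setT (EFin \o G) -> {ae P, forall w, F w <= G w} ->
  \int[P]_w F w <= \int[P]_w G w.
Proof.
move=> iF iG FG; rewrite -subr_ge0 -RintegralB // /Rintegral fine_ge0 //.
have iGF : P.-integrable setT (EFin \o (fun w => G w - F w)).
  by have := integrableB measurableT iG iF; apply: eq_integrable.
have mGF := measurable_int _ iGF.
rewrite (@ae_eq_integral _ _ _ _ _ (fun w => `|G w - F w|%:E)) //.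
- by apply: integral_ge0 => w _; rewrite lee_fin.
- by apply: (@measurableT_comp _ _ _ _ _ _ (@abse R)) mGF.
- by apply: filterS FG => w h _; rewrite ger0_norm // subr_ge0.
Qed.

Lemma Rintegral_probability_cst (k : R) : \int[P]_w k = k.
Proof.
rewrite Rintegral_cst // [X in fine X](_ : _ = 1%E) ?mulr1 //.
exact: probability_setT.
Qed.

End AlmostSureBounds.

(** Same expression as the local [L] of [fY], so that [fcut (lmgf P Y)], defined below, is
    convertible to [fY P Y]. *)
Definition lmgf (R : realType) (d : measure_display) (T : measurableType d)
    (P : probability T R) (X : T -> R) (u : R) : R :=
  ln (fine 'E_P[fun w => expR (u * X w)]).

Section LogMgf.
Context {d : measure_display} {T : measurableType d} {R : realType}.
Variables (P : probability T R) (X : {RV P >-> R}) (b : R).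
Hypothesis Xb : {ae P, forall w, `|X w| <= b}.

Let mgf u := \int[P]_w expR (u * X w).

Lemma lmgfE u : lmgf P X u = ln (mgf u).
Proof. by rewrite /lmgf unlock. Qed.

Lemma measurable_expRM u : measurable_fun setT (fun w => expR (u * X w)).
Proof.
by apply: (measurableT_comp (@measurable_expR R)); exact: measurable_funM.
Qed.

Lemma ae_expRM_le u : {ae P, forall w, `|expR (u * X w)| <= expR (`|u| * b)}.
Proof.
apply: filterS Xb => w h; rewrite gtr0_norm ?expR_gt0 // ler_expR.
by rewrite (le_trans (ler_norm _)) // normrM ler_wpM2l.
Qed.

Lemma integrable_expRM u : P.-integrable setT (EFin \o (fun w => expR (u * X w))).
Proof. exact: ae_bounded_integrable (measurable_expRM u) (ae_expRM_le u). Qed.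

Lemma integrable_RV_bounded : P.-integrable setT (EFin \o X).
Proof. exact: ae_bounded_integrable Xb. Qed.

Lemma mgf_ge u : expR (- (`|u| * b)) <= mgf u.
Proof.
rewrite -(Rintegral_probability_cst P (expR _)).
apply: ae_le_Rintegral.
- exact: finite_measure_integrable_cst.
- exact: integrable_expRM.
- apply: filterS Xb => w h; rewrite ler_expR lerNl -mulrN.
  apply: le_trans (_ : `|u * X w| <= _); last by rewrite normrM ler_wpM2l.
  by rewrite mulrN -normrN ler_norm.
Qed.

Lemma mgf_gt0 u : 0 < mgf u.
Proof. exact: lt_le_trans (expR_gt0 _) (mgf_ge u). Qed.

Lemma expR_lmgf u : expR (lmgf P X u) = mgf u.
Proof. by rewrite lmgfE lnK // posrE mgf_gt0. Qed.

Lemma fine_expectation_expRM u :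
  ('E_P[fun w => expR (u * X w)] = (expR (lmgf P X u))%:E)%E.
Proof.
rewrite expR_lmgf /mgf /Rintegral fineK; first by rewrite unlock.
by apply: integrable_fin_num => //; exact: integrable_expRM.
Qed.

(** Jensen's inequality E(Z^l) >= (E Z)^l for Z = e^(uX), obtained by normalising Z to mean 1 and
    integrating the Bernoulli bound, whose linear part then integrates to 1. *)
Lemma lmgf_scale_ge l u : 1 <= l -> l * lmgf P X u <= lmgf P X (l * u).
Proof.
move=> l1; set L := lmgf P X u.
rewrite -ler_expR expR_lmgf.
suff : 1 <= expR (- (l * L)) * mgf (l * u).
  rewrite expRN mulrC ler_pdivlMr ?expR_gt0 //; lra.
rewrite /mgf -RintegralZl //; last exact: integrable_expRM.
have i1 : P.-integrable setT
    (EFin \o (fun w => (1 - l) + l * expR (- L) * expR (u * X w))).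
  apply: ae_bounded_integrable (`|1 - l| + `|l * expR (- L)| * expR (`|u| * b)) _ _.
    by apply: measurable_funD => //; apply: measurable_funM => //; exact: measurable_expRM.
  apply: filterS (ae_expRM_le u) => w h.
  rewrite (le_trans (ler_normD _ _)) // lerD2l normrM.
  by rewrite ler_wpM2l.
have <- : \int[P]_w ((1 - l) + l * expR (- L) * expR (u * X w)) = 1.
  rewrite RintegralD //; last 2 first.
  - exact: finite_measure_integrable_cst.
  - have := integrableZl measurableT (l * expR (- L)) (integrable_expRM u).
    by apply: eq_integrable.
  rewrite Rintegral_probability_cst RintegralZl //; last exact: integrable_expRM.
  rewrite -/(mgf u) -expR_lmgf -/L -mulrA expRN mulVf ?gt_eqF ?expR_gt0 //; lra.
apply: ae_le_Rintegral => //.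
  have := integrableZl measurableT (expR (- (l * L))) (integrable_expRM (l * u)).
  by apply: eq_integrable.
apply: aeW => w.
rewrite -expRD.
have -> : - (l * L) + l * u * X w = l * (u * X w - L) by ring.
apply: le_trans (expR_bernoulli _ l1).
by rewrite expRD [expR (u * X w) * _]mulrC; lra.
Qed.

End LogMgf.

Section LogMgfComparison.
Context {d : measure_display} {T : measurableType d} {R : realType}.
Variables (P : probability T R).

Lemma ae_le_lmgf (X Y : {RV P >-> R}) (a b u v c : R) :
  {ae P, forall w, `|X w| <= a} -> {ae P, forall w, `|Y w| <= b} ->
  {ae P, forall w, u * X w <= v * Y w + c} ->
  lmgf P X u <= lmgf P Y v + c.
Proof.
move=> Xa Yb h; rewrite -ler_expR expRD (expR_lmgf Xa) (expR_lmgf Yb).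
rewrite mulrC -RintegralZl //; last exact: (integrable_expRM Yb).
apply: ae_le_Rintegral.
- exact: (integrable_expRM Xa).
- have := integrableZl measurableT (expR c) (integrable_expRM Yb v).
  by apply: eq_integrable.
- by apply: filterS h => w h; rewrite -expRD ler_expR addrC.
Qed.

Lemma lmgf_coupling (X Y : {RV P >-> R}) (a b u k : R) : 0 <= u ->
  {ae P, forall w, `|X w| <= a} -> {ae P, forall w, `|Y w| <= b} ->
  {ae P, forall w, `|X w - Y w| <= k} ->
  `|lmgf P X u - lmgf P Y u| <= u * k.
Proof.
move=> u0 Xa Yb h; rewrite ler_distl; apply/andP; split.
  rewrite lerBlDr; apply: ae_le_lmgf Yb Xa _.
  apply: filterS h => w; rewrite ler_norml => /andP[h1 h2].
  rewrite -mulrDr ler_wpM2l //; lra.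
apply: ae_le_lmgf Xa Yb _.
apply: filterS h => w; rewrite ler_norml => /andP[h1 h2].
rewrite -mulrDr ler_wpM2l //; lra.
Qed.

End LogMgfComparison.

(* The properties of the log-moment generating function of a mean-zero variable
   on [-1,1] used in the analysis; being closed under pointwise limits, they
   pass from the Y(n) to their limit law Y. *)
Record logmgf_like (R : realType) (C0 : R) (L : R -> R) : Prop := LogmgfLike {
  logmgf_ge0 : forall u : R, 0 <= u -> 0 <= L u;
  logmgf_le : forall u : R, 0 <= u -> L u <= u;
  logmgf_le_sqr : forall u : R, 0 <= u <= 1 -> L u <= 2 * u ^+ 2;
  logmgf_tail : forall u : R, 1 <= u -> - (C0 * u / (1 + ln u) ^+ 2) <= L u - u;
  logmgf_decr : forall u v : R, 0 <= u <= v -> L v - v <= L u - u;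
  logmgf_scale : forall l u : R, 1 <= l -> 0 <= u -> l * L u <= L (l * u);
  logmgf_lip : forall u v : R, 0 <= u <= v -> v <= 1 -> L v <= L u + 8 * v * (v - u) }.

Section LogmgfLike.
Context {d : measure_display} {T : measurableType d} {R : realType}.
Variables (P : probability T R) (X : {RV P >-> R}).
Hypothesis X1 : {ae P, forall w, -1 <= X w <= 1}.
Hypothesis EX : ('E_P[X] = 0)%E.

Let X1' : {ae P, forall w, `|X w| <= 1}.
Proof. by apply: filterS X1 => w; rewrite ler_norml. Qed.

Let mgf u := \int[P]_w expR (u * X w).

Let EX0 u : \int[P]_w (u * X w) = 0.
Proof.
rewrite RintegralZl //; last exact: (integrable_RV_bounded X1').
by move: EX; rewrite unlock /Rintegral => ->; rewrite mulr0.
Qed.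

Let iX u : P.-integrable setT (EFin \o (fun w => u * X w)).
Proof.
have := integrableZl measurableT u (integrable_RV_bounded X1').
by apply: eq_integrable.
Qed.

Let mgf_ge1 u : 1 <= mgf u.
Proof.
have -> : 1 = \int[P]_w (1 + u * X w).
  rewrite RintegralD //; last exact: finite_measure_integrable_cst.
  by rewrite EX0 Rintegral_probability_cst addr0.
apply: ae_le_Rintegral; last by apply: aeW => w; exact: expR_ge1Dx.
- by have := integrableD measurableT (finite_measure_integrable_cst P 1 measurableT) (iX u);
    apply: eq_integrable.
- exact: (integrable_expRM X1').
Qed.

Let mgf_le (u v c : R) : 0 <= v -> {ae P, forall w, expR (v * X w) <= expR (u * X w) + c + (v - u) * X w} ->
  mgf v <= mgf u + c.
Proof.
move=> v0 h.
have i1 : P.-integrable setT (EFin \o (fun w => expR (u * X w) + c)).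
  have := integrableD measurableT (integrable_expRM X1' u) (finite_measure_integrable_cst P c measurableT).
  by apply: eq_integrable.
have -> : mgf u + c = \int[P]_w (expR (u * X w) + c + (v - u) * X w).
  rewrite RintegralD // EX0 addr0 RintegralD //; last 2 first.
  - exact: (integrable_expRM X1').
  - exact: finite_measure_integrable_cst.
  by rewrite Rintegral_probability_cst.
apply: ae_le_Rintegral h; first exact: (integrable_expRM X1').
by have := integrableD measurableT i1 (iX (v - u)); apply: eq_integrable.
Qed.

(** Keeps only the event X > 1 - 1/t, on which e^(uX) >= e^(u(1 - 1/t)). *)
Lemma lmgf_ge_of_tail (t p u : R) : 0 <= u -> 0 < p ->
  (p%:E <= P [set w | (1 - t^-1 < X w)%R])%E ->
  u * (1 - t^-1) + ln p <= lmgf P X u.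
Proof.
move=> u0 p0 hp; set A := [set w | 1 - t^-1 < X w].
have mA : measurable A.
  rewrite (_ : A = X @^-1` `]1 - t^-1, +oo[%classic).
    by rewrite -[X in measurable X]setTI; exact: measurable_funPT.
  by apply/seteqP; split => w /=; rewrite in_itv /= andbT.
rewrite -ler_expR (expR_lmgf X1') expRD lnK ?posrE //.
have pA : p <= \int[P]_w \1_A w.
  rewrite /Rintegral integral_indic // setIT.
  have := hp; rewrite -/A -[P A]fineK ?fin_num_measure // lee_fin.
apply: (@le_trans _ _ (\int[P]_w (expR (u * (1 - t^-1)) * \1_A w))).
  rewrite RintegralZl //; last exact: integrable_indic.
  by rewrite ler_wpM2l ?expR_ge0.
apply: ae_le_Rintegral.
- have := integrableZl measurableT (expR (u * (1 - t^-1))) (integrable_indic P mA).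
  by apply: eq_integrable.
- exact: (integrable_expRM X1').
apply: aeW => w; rewrite indicE.
have [/set_mem /= wA|_] := boolP (w \in A); last by rewrite mulr0 expR_ge0.
by rewrite mulr1 ler_expR ler_wpM2l // ltW.
Qed.

Lemma lmgf_logmgf_like (c0 kappa : R) : 0 < c0 -> 0 < kappa ->
  (forall t, 1 <= t ->
    ((kappa * expR (- (c0 * expR (Num.sqrt t))))%:E <=
       P [set w | (1 - t^-1 < X w)%R])%E) ->
  logmgf_like (4 + 64 * c0 + 16 * `|ln kappa|) (lmgf P X).
Proof.
move=> c00 k0 tail; split.
- by move=> u u0; rewrite (lmgfE X) ln_ge0 // mgf_ge1.
- move=> u u0; rewrite -ler_expR (expR_lmgf X1').
  rewrite -(Rintegral_probability_cst P (expR u)).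
  apply: ae_le_Rintegral; first exact: (integrable_expRM X1').
    exact: finite_measure_integrable_cst.
  by apply: filterS X1 => w /andP[_ w1]; rewrite ler_expR ler_piMr.
- move=> u /andP[u0 u1].
  rewrite -ler_expR (expR_lmgf X1').
  apply: (@le_trans _ _ (1 + 2 * u ^+ 2)); last exact: expR_ge1Dx.
  have m0 : mgf 0 = 1.
    rewrite /mgf -[RHS](Rintegral_probability_cst P 1).
    by apply: eq_Rintegral => w _; rewrite mul0r expR0.
  suff : mgf u <= mgf 0 + 2 * u ^+ 2 by rewrite m0.
  apply: mgf_le => //; apply: filterS X1 => w /andP[w1 w2].
  rewrite mul0r expR0 subr0.
  apply: le_trans (expR_leDxsqr _) _; first by nra.
  have : (u * X w) ^+ 2 <= u ^+ 2.
    by rewrite exprMn ler_piMr ?sqr_ge0 // -[leRHS](expr1n _ 2) -real_normK ?num_real // lerXn2r ?nnegrE // ler_norml w1.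
  lra.
- move=> u u1; have u0 : 0 < u by lra.
  have l0 : 0 <= ln u by rewrite ln_ge0.
  (* The tail bound is used at t = r^2: then c0 e^(sqrt t) is O(sqrt u), and u/t is O(u/(1 + ln
     u)^2). The three parts of the constant are the losses from u/t, from c0 e^r and from ln kappa,
     in this order. *)
  set r := 1 + ln u / 2.
  have r1 : 1 <= r by rewrite /r lerDl divr_ge0.
  have t1 : 1 <= r ^+ 2 by rewrite exprn_ege1.
  have := lmgf_ge_of_tail (ltW u0) _ (tail _ t1).
  move=> /(_ (mulr_gt0 k0 (expR_gt0 _))).
  rewrite lnM ?posrE ?expR_gt0 // expRK sqrtr_sqr ger0_norm; last by lra.
  set D := (1 + ln u) ^+ 2.
  have D1 : 1 <= D by rewrite exprn_ege1 // lerDl.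
  have su0 : 0 <= Num.sqrt u by [].
  have hs : D <= 16 * Num.sqrt u := sqr_1Dln_le u1.
  have hss : Num.sqrt u * Num.sqrt u = u by rewrite -expr2 sqr_sqrtr ?ltW.
  have hsD : Num.sqrt u <= 16 * (u / D).
    by rewrite mulrA ler_pdivlMr; [nra|lra].
  have su1 : 1 <= Num.sqrt u by rewrite -[leLHS]sqrtr1 ler_wsqrtr.
  have er : expR r <= 4 * Num.sqrt u.
    rewrite /r expRD ler_pM ?expR_ge0 ?expR1_le4 //.
    have -> : ln u / 2 = ln (Num.sqrt u).
      have su00 : 0 < Num.sqrt u by lra.
      by rewrite -[in LHS]hss lnM ?posrE //; lra.
    by rewrite lnK // posrE; lra.
  have ur : u / r ^+ 2 <= 4 * (u / D).
    rewrite mulrCA; apply: ler_wpM2l; first exact: ltW.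
    rewrite ler_pdivlMr; last by lra.
    rewrite mulrC ler_pdivrMr; last by lra.
    by rewrite /D /r; nra.
  have lk : - `|ln kappa| <= ln kappa by rewrite lerNl -normrN ler_norm.
  have uD : 0 <= u / D by rewrite divr_ge0 // ltW // (lt_le_trans _ D1).
  have e1 : c0 * expR r <= c0 * (64 * (u / D)).
    by rewrite ler_wpM2l ?(ltW c00) //; lra.
  have e2 : `|ln kappa| <= `|ln kappa| * (16 * (u / D)).
    by rewrite ler_peMr //; lra.
  rewrite mulrBr mulr1; lra.
- move=> u v /andP[u0 uv].
  suff : lmgf P X v <= lmgf P X u + (v - u) by lra.
  apply: ae_le_lmgf X1' X1' _; apply: filterS X1 => w /andP[_ w1].
  have : (v - u) * X w <= v - u by rewrite ler_piMr // subr_ge0.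
  lra.
- by move=> l u l1 u0; exact: (lmgf_scale_ge X1').
- move=> u v /andP[u0 uv] v1.
  have mu1 := mgf_ge1 u.
  have c1 : 0 <= 8 * v * (v - u) by rewrite !mulr_ge0 ?subr_ge0 //; lra.
  have : mgf v <= mgf u + 8 * v * (v - u).
    apply: mgf_le; first lra.
    apply: filterS X1 => w w1.
    by have := @expR_second_order _ _ u v w1; rewrite u0 uv v1 => /(_ isT isT); lra.
  move=> h; rewrite -ler_expR expRD !(expR_lmgf X1') (le_trans h) //.
  have he := expR_ge1Dx (8 * v * (v - u)).
  rewrite -/(mgf u); nra.
Qed.

End LogmgfLike.

Lemma logmgf_like_limit (R : realType) (C0 : R) (L : nat -> R -> R) (g : R -> R)
    (k : nat -> R) :
  (forall n, logmgf_like C0 (L n)) ->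
  (forall n (u : R), 0 <= u -> `|L n u - g u| <= u * k n) ->
  k @ \oo --> (0 : R) ->
  logmgf_like C0 g.
Proof.
move=> hL hk k0.
have lim (a b c : R) : (forall n, a <= b + c * k n) -> a <= b.
  move=> h; have cv : (fun n => b + c * k n) @ \oo --> b.
    rewrite -[X in _ --> X]addr0 -[X in _ --> _ + X](mulr0 c).
    by apply: cvgD; [exact: cvg_cst|apply: cvgM => //; exact: cvg_cst].
  by apply: (cvgr_to_ge cv); apply: nearW.
have hk' n u : 0 <= u -> L n u <= g u + u * k n /\ g u <= L n u + u * k n.
  by move=> /(hk n); rewrite ler_norml => /andP[h1 h2]; lra.
split.
- move=> u u0; apply: (lim _ _ u) => n.
  by have [h1 h2] := hk' n u u0; have := logmgf_ge0 (hL n) u0; lra.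
- move=> u u0; apply: (lim _ _ u) => n.
  by have [h1 h2] := hk' n u u0; have := logmgf_le (hL n) u0; lra.
- move=> u u01; apply: (lim _ _ u) => n; have /andP[u0 _] := u01.
  by have [h1 h2] := hk' n u u0; have := logmgf_le_sqr (hL n) u01; lra.
- move=> u u1; have u0 : 0 <= u by lra.
  apply: (lim _ _ u) => n.
  by have [h1 h2] := hk' n u u0; have := logmgf_tail (hL n) u1; lra.
- move=> u v uv; have /andP[u0 uv'] := uv; have v0 : 0 <= v by lra.
  apply: (lim _ _ (u + v)) => n.
  have [h1 h2] := hk' n u u0; have [h3 h4] := hk' n v v0.
  by have := logmgf_decr (hL n) uv; lra.
- move=> l u l1 u0; have v0 : 0 <= l * u by rewrite mulr_ge0 //; lra.
  apply: (lim _ _ (l * u + l * u)) => n.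
  have [h1 h2] := hk' n u u0; have [h3 h4] := hk' n _ v0.
  have := logmgf_scale (hL n) l1 u0.
  have : l * g u <= l * (L n u + u * k n) by rewrite ler_wpM2l //; lra.
  lra.
- move=> u v uv v1; have /andP[u0 uv'] := uv; have v0 : 0 <= v by lra.
  apply: (lim _ _ (u + v)) => n.
  have [h1 h2] := hk' n u u0; have [h3 h4] := hk' n v v0.
  by have := logmgf_lip (hL n) uv v1; lra.
Qed.

Lemma eq_lmgf_same_distribution (R : realType)
    (d1 : measure_display) (T1 : measurableType d1) (P1 : probability T1 R)
    (d2 : measure_display) (T2 : measurableType d2) (P2 : probability T2 R)
    (X1 : {RV P1 >-> R}) (X2 : {RV P2 >-> R}) (u : R) :
  same_distribution X1 X2 -> lmgf P1 X1 u = lmgf P2 X2 u.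
Proof.
move=> h; rewrite /lmgf unlock.
have me : measurable_fun setT (fun x : R => (expR (u * x))%:E).
  apply/measurable_EFinP; apply: (measurableT_comp (@measurable_expR R)).
  exact: measurable_funM.
have e0 x : (0 <= (expR (u * x))%:E)%E by rewrite lee_fin expR_ge0.
rewrite -(ge0_integral_distribution X1 me e0) -(ge0_integral_distribution X2 me e0).
congr (ln (fine _)); apply: eq_measure_integral => A mA _; exact: h.
Qed.

Section CRVHLogMgf.
Context {R : realType} {c0 kappa K : R}.
Context {d : measure_display} {T : measurableType d} {P : probability T R}.
Context {d' : measure_display} {T' : measurableType d'} {P' : probability T' R}.
Variables (Ys : nat -> {RV P >-> R}) (Y : {RV P' >-> R}).
Hypothesis (c00 : 0 < c0) (kappa0 : 0 < kappa).
Hypothesis hY : CRVH c0 kappa K Ys Y.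

Let C0 := 4 + 64 * c0 + 16 * `|ln kappa|.

Lemma CRVH_logmgf_like n : logmgf_like C0 (lmgf P (Ys n)).
Proof.
apply: lmgf_logmgf_like => //.
- exact: (CRVH_support hY).
- exact: (CRVH_mean hY).
- exact: (CRVH_tail hY).
Qed.

Lemma CRVH_lmgf_coupling n (u : R) : (0 < n)%N -> 0 <= u ->
  `|lmgf P (Ys n) u - lmgf P' Y u| <= u * (`|K| / ln n.+1%:R ^+ 2).
Proof.
move=> n0 u0; have [Yn [_ sd /(_ n n0) cpl]] := CRVH_coupling hY.
rewrite -(eq_lmgf_same_distribution u (sd n)).
have cpl' : {ae P, forall w, `|Ys n w - Yn n w| <= `|K| / ln n.+1%:R ^+ 2}.
  apply: filterS cpl => w h; apply: le_trans h _.
  by rewrite ler_wpM2r ?invr_ge0 ?sqr_ge0 // ler_norm.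
have b1 : {ae P, forall w, `|Ys n w| <= 1}.
  by apply: filterS (CRVH_support hY n) => w; rewrite ler_norml.
apply: (lmgf_coupling u0 b1 _ cpl').
(* CRVH does not bound [Yn n] directly; its almost sure bound, needed for the exponential moments to
   be finite, comes from that of [Ys n] and the coupling. *)
apply: (@filterS2 _ _ _ _ _ (fun w => `|Yn n w| <= 1 + `|K| / ln n.+1%:R ^+ 2) _ b1 cpl').
move=> w h1 h2; rewrite -[Yn n w](subKr (Ys n w)) (le_trans (ler_normB _ _)) //.
by rewrite lerD.
Qed.

(** The law of [Y] inherits the bounds of the [Ys n] because the coupling gap K/(ln n)^2 tends to 0.
    The family is shifted by one since the coupling starts at the second term. *)
Lemma CRVH_limit_logmgf_like : logmgf_like C0 (lmgf P' Y).
Proof.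
apply: (@logmgf_like_limit _ _ (fun n => lmgf P (Ys n.+1)) _
  (fun n => `|K| / ln n.+2%:R ^+ 2)).
- by move=> n; exact: CRVH_logmgf_like.
- by move=> n u u0; exact: CRVH_lmgf_coupling.
rewrite -(mulr0 `|K|); apply: cvgM; first exact: cvg_cst.
apply/cvgrPdist_le => e e0; near=> n.
rewrite sub0r normrN ger0_norm ?invr_ge0 ?sqr_ge0 //.
rewrite -[leRHS]invrK lef_pV2 ?posrE ?invr_gt0 //; last first.
  by rewrite exprn_gt0 // ln_gt0 // ltr1n.
have : expR (1 + e^-1) <= n.+2%:R :> R.
  near: n; exists (Num.truncn (expR (1 + e^-1))).+1 => // n /= hn.
  apply: le_trans (ltW (Num.Theory.truncnS_gt _)) _.
  by rewrite ler_nat (leq_trans hn) // -addn2 leq_addr.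
have ei0 : 0 < e^-1 by rewrite invr_gt0.
rewrite -[in X in X -> _](@lnK _ n.+2%:R) ?posrE // ler_expR.
by nra.
Unshelve. all: by end_near. Qed.

End CRVHLogMgf.

(** * Exponential tilting *)

Section IndependentProduct.
Context {d : measure_display} {T : measurableType d} {R : realType}.
Variable P : probability T R.
Import HBNNSimple.
Local Open Scope ereal_scope.

(** The factorisation passes from indicators to simple functions by finite sums over the fibres
    (those of negative values are empty) and to g by monotone convergence. *)
Lemma ge0_integral_comp_mul (X : {RV P >-> R}) (F : T -> R) (m : R) :
  measurable_fun setT F -> (forall w, (0 <= F w)%R) -> (0 <= m)%R ->
  (forall D : set R, measurable D ->
    \int[P]_w ((\1_D (X w) : R) * F w)%:E = P (X @^-1` D) * m%:E) ->
  forall g : R -> R, measurable_fun setT g -> (forall x, (0 <= g x)%R) ->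
  \int[P]_w (g (X w) * F w)%:E = (\int[P]_w (g (X w))%:E) * m%:E.
Proof.
move=> mF F0 m0 hD g mg g0.
have mX : measurable_fun setT X by exact: measurable_funPT.
have mXD D : measurable D -> measurable (X @^-1` D).
  by move=> mD; rewrite -[X in measurable X]setTI; exact: mX.
have mgX (h : R -> R) : measurable_fun setT h -> measurable_fun setT (fun w => h (X w)).
  by move=> mh; exact: (measurableT_comp mh mX).
have simple (h : {nnsfun R >-> R}) :
    \int[P]_w (h (X w) * F w)%:E = (\int[P]_w (h (X w))%:E) * m%:E.
  have mh k : measurable (h @^-1` [set k]) by exact: measurable_sfunP.
  have nn k w : (0 <= k * \1_(h @^-1` [set k]) (X w))%R.
    by have := nnfun_muleindic_ge0 h k (X w); rewrite -EFinM lee_fin.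
  have mi k : measurable_fun setT (fun w => \1_(h @^-1` [set k]) (X w) : R).
    by apply: mgX; exact: measurable_indic.
  have part k (G : T -> R) : (forall w, (0 <= G w)%R) -> measurable_fun setT G ->
      \int[P]_w (k * (\1_(h @^-1` [set k]) (X w) * G w))%:E =
      k%:E * \int[P]_w (\1_(h @^-1` [set k]) (X w) * G w)%:E.
    move=> G0 mG.
    have [k0|k0] := leP 0%R k.
      rewrite -ge0_integralZl_EFin //.
        by move=> w _; rewrite lee_fin mulr_ge0.
      by apply/measurable_EFinP; exact: measurable_funM.
    have e : h @^-1` [set k] = set0.
      rewrite -subset0 => x /= hx; have := nnfun_muleindic_ge0 h k x.
      by rewrite indicE mem_set // mule1 lee_fin leNgt k0.
    rewrite e; under eq_integral do rewrite indic0 mul0r mulr0.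
    by under [in RHS]eq_integral do rewrite indic0 mul0r; rewrite integral0 mule0.
  have sums (G : T -> R) : (forall w, (0 <= G w)%R) -> measurable_fun setT G ->
      \int[P]_w (h (X w) * G w)%:E =
      \sum_(k \in range h) (k%:E * \int[P]_w (\1_(h @^-1` [set k]) (X w) * G w)%:E).
    move=> G0 mG.
    transitivity (\sum_(k \in range h)
        \int[P]_w (k * (\1_(h @^-1` [set k]) (X w) * G w))%:E); last first.
      by apply: eq_fsbigr => k _; exact: part.
    rewrite -ge0_integral_fsum //; last 2 first.
    - move=> k; apply/measurable_EFinP; apply: measurable_funM => //.
      exact: measurable_funM.
    - by move=> k w _; rewrite lee_fin mulrA mulr_ge0.
    apply: eq_integral => w _.
    rewrite fsumEFin // fimfunE mulr_fsuml; congr EFin.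
    by apply: eq_fsbigr => k _; rewrite mulrA.
  rewrite sums //.
  have -> : \int[P]_w (h (X w))%:E = \sum_(k \in range h) (k%:E * P (X @^-1` (h @^-1` [set k]))).
    transitivity (\int[P]_w (h (X w) * 1)%:E).
      by apply: eq_integral => w _; rewrite mulr1.
    rewrite (sums (fun=> 1%R)) //; apply: eq_fsbigr => k _; congr (_ * _).
    transitivity (\int[P]_w (\1_(X @^-1` (h @^-1` [set k])) w)%:E).
      by apply: eq_integral => w _; rewrite mulr1 !indicE; congr (_%:R%:E); apply/idP/idP => /set_mem/mem_set.
    by rewrite integral_indic ?setIT //; exact: mXD.
  rewrite ge0_mule_fsuml; last first.
    move=> k; have [k0|k0] := leP 0%R k; first by rewrite mule_ge0 // lee_fin.
    have e : h @^-1` [set k] = set0.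
      rewrite -subset0 => x /= hx; have := nnfun_muleindic_ge0 h k x.
      by rewrite indicE mem_set // mule1 lee_fin leNgt k0.
    by rewrite e preimage_set0 measure0 mule0.
  by apply: eq_fsbigr => k _; rewrite hD // muleA.
have mgE : measurable_fun setT (EFin \o g) by exact/measurable_EFinP.
pose g_ := nnsfun_approx measurableT mgE.
have mgn n : measurable_fun setT (g_ n) by exact: measurable_funPT.
have cv x : (EFin \o (g_ ^~ x)) @ \oo --> (g x)%:E.
  by apply: cvg_nnsfun_approx => // y _; rewrite lee_fin.
have nd x : {homo g_ ^~ x : a b / (a <= b)%N >-> (a <= b)%R}.
  by move=> a b ab; exact/lefP/nd_nnsfun_approx.
have mct (G : T -> R) : (forall w, (0 <= G w)%R) -> measurable_fun setT G ->
    \int[P]_w (g_ n (X w) * G w)%:E @[n --> \oo] --> \int[P]_w (g (X w) * G w)%:E.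
  move=> G0 mG.
  have -> : \int[P]_w (g (X w) * G w)%:E =
      \int[P]_w (limn (fun n => (g_ n (X w) * G w)%:E)).
    apply: eq_integral => w _; apply/esym/cvg_lim => //.
    rewrite [X in _ --> X]EFinM; under eq_fun do rewrite EFinM.
    by apply: cvgeZr => //; exact: cv.
  apply: cvg_monotone_convergence => //.
  - move=> n; apply/measurable_EFinP; apply: measurable_funM => //.
    exact: mgX.
  - by move=> n w _; rewrite lee_fin mulr_ge0.
  - by move=> w _ a b ab; rewrite lee_fin ler_wpM2r // nd.
have := mct F F0 mF.
under eq_fun do rewrite simple.
move=> c1.
have c2 : (\int[P]_w (g_ n (X w))%:E * m%:E) @[n --> \oo] --> (\int[P]_w (g (X w))%:E * m%:E).
  apply: cvgeZr => //.
  have := mct (fun=> 1%R) (fun=> ler01) (measurable_cst _).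
  under eq_fun do under eq_integral do rewrite mulr1.
  by under [X in _ --> X -> _]eq_integral do rewrite mulr1.
exact: (cvg_unique _ c1 c2).
Qed.

Lemma ge0_integral_independent_prod (X : nat -> {RV P >-> R}) (g : nat -> R -> R)
    (s : seq nat) :
  independent_RVs X -> uniq s ->
  (forall n, measurable_fun setT (g n)) -> (forall n x, (0 <= g n x)%R) ->
  (forall n, \int[P]_w (g n (X n w))%:E \is a fin_num) ->
  \int[P]_w (\prod_(n <- s) g n (X n w))%:E =
  \prod_(n <- s) \int[P]_w (g n (X n w))%:E.
Proof.
move=> iX us mg g0 fg.
have mX n : measurable_fun setT (X n) by exact: measurable_funPT.
have mXD n D : measurable D -> measurable (X n @^-1` D).
  by move=> mD; rewrite -[X in measurable X]setTI; exact: mX.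
(* The induction needs a mixed statement: functions of the variables in [s1], indicators for those
   in [s2]. The base case is the definition of independence; in the step, the function at the head
   of [s1] is traded for an arbitrary indicator and the head moves to [s2]. *)
suff H : forall (s1 s2 : seq nat) (E : nat -> set R), uniq (s1 ++ s2) ->
    (forall n, measurable (E n)) ->
    \int[P]_w (\prod_(n <- s1) g n (X n w) * \prod_(n <- s2) \1_(E n) (X n w))%:E =
    (\prod_(n <- s1) \int[P]_w (g n (X n w))%:E) * \prod_(n <- s2) P (X n @^-1` E n).
  have := H s [::] (fun=> setT); rewrite cats0 => /(_ us (fun=> measurableT)).
  rewrite big_nil mule1 => <-; apply: eq_integral => w _.
  by rewrite big_nil mulr1.
elim=> [|a s1 IH] s2 E us12 mE.
  rewrite big_nil mul1e -iX //.
  set I := \bigcap_(n in _) _.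
  have mI : measurable I by apply: bigcap_measurableType => k _; exact: mXD.
  have -> : P I = \int[P]_w (\1_I w)%:E by rewrite integral_indic ?setIT.
  apply: eq_integral => w _; rewrite big_nil mul1r; congr EFin.
  rewrite indicE.
  have -> : (\prod_(n <- s2) \1_(E n) (X n w) = (all (fun n => X n w \in E n) s2)%:R :> R)%R.
    elim: (s2) => [|n s2' IH]; first by rewrite big_nil.
    by rewrite big_cons IH indicE /= -natrM mulnb.
  congr (nat_of_bool _)%:R; apply/allP/idP.
    by move=> h; apply/mem_set => n /= ns; exact/set_mem/h.
  by move=> /set_mem h n ns; apply/mem_set; exact: h.
have as2 : a \notin s2.
  by move: us12; rewrite /= mem_cat negb_or => /andP[/andP[]].
have us12' : uniq (s1 ++ a :: s2) by rewrite -cat1s uniq_catCA catA.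
pose F w := (\prod_(n <- s1) g n (X n w) * \prod_(n <- s2) \1_(E n) (X n w))%R.
pose m := (\prod_(n <- s1) \int[P]_w (g n (X n w))%:E) * \prod_(n <- s2) P (X n @^-1` E n).
have mfin : m \is a fin_num.
  apply: fin_numM; apply: prode_fin_num => n _ //.
  by apply: fin_num_measure; exact: mXD.
have m0 : (0 <= fine m)%R.
  rewrite fine_ge0 //; apply: mule_ge0; apply: prode_ge0 => n _ //.
  by apply: integral_ge0 => w _; rewrite lee_fin.
transitivity (\int[P]_w (g a (X a w) * F w)%:E).
  by apply: eq_integral => w _; rewrite big_cons /F mulrA.
rewrite (@ge0_integral_comp_mul (X a) F (fine m)) //.
- by rewrite fineK // /m big_cons muleA.
- rewrite /F; apply: measurable_funM; apply: measurable_prod => n _.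
    exact: (measurableT_comp (mg n) (mX n)).
  exact: (measurableT_comp (measurable_indic (mE n)) (mX n)).
- by move=> w; rewrite /F mulr_ge0 // prodr_ge0 // => n _; rewrite ?indicE ?ler0n.
(* Since a is not in [s2], redefining the event at a does not disturb the other indicators. *)
move=> D mD; pose E' n := if n == a then D else E n.
have mE' n : measurable (E' n) by rewrite /E'; case: ifP.
have eE' n : n \in s2 -> E' n = E n.
  by move=> ns; rewrite /E'; case: eqP => // na; move: as2; rewrite -na ns.
have := IH (a :: s2) E' us12' mE'.
rewrite big_cons {2}/E' eqxx.
have -> : \prod_(n <- s2) P (X n @^-1` E' n) = \prod_(n <- s2) P (X n @^-1` E n).
  by apply: eq_big_seq => n /= ns; rewrite (eE' n ns).
rewrite muleCA -/m fineK // => <-; apply: eq_integral => w _.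
rewrite big_cons {1}/E' eqxx /F mulrCA; congr (_ * (_ * _))%:E.
by apply: eq_big_seq => n /= /eE' ->.
Qed.

End IndependentProduct.

Section ExponentialTilting.
Context {d : measure_display} {T : measurableType d} {R : realType}.
Variables (P : probability T R) (H : T -> R) (L : R -> R).
Hypothesis mH : measurable_fun setT H.
Hypothesis mgfH : forall s : R, (\int[P]_w (expR (s * H w))%:E = (expR (L s))%:E)%E.

Let mexp s : measurable_fun setT (fun w => expR (s * H w)).
Proof. by apply: (measurableT_comp (@measurable_expR R)); exact: measurable_funM. Qed.

Let iexp s : P.-integrable setT (EFin \o (fun w => expR (s * H w))).
Proof.
apply/integrableP; split; first exact/measurable_EFinP.
under eq_integral do rewrite /= gtr0_norm ?expR_gt0 //.
by rewrite mgfH ltry.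
Qed.

Let Eexp s : \int[P]_w expR (s * H w) = expR (L s).
Proof. by rewrite /Rintegral mgfH. Qed.

Let mtail V : measurable [set w | V < H w].
Proof.
rewrite (_ : [set w | V < H w] = H @^-1` `]V, +oo[%classic).
  by rewrite -[X in measurable X]setTI; exact: mH.
by apply/seteqP; split => w /=; rewrite in_itv /= andbT.
Qed.

Let tailE V : \int[P]_w \1_[set w | V < H w] w = fine (P [set w | V < H w]).
Proof. by rewrite /Rintegral integral_indic ?setIT. Qed.

Lemma tail_upper_bound (s V : R) : 0 <= s ->
  fine (P [set w | V < H w]) <= expR (L s - s * V).
Proof.
move=> s0; rewrite -tailE addrC expRD -Eexp -RintegralZl //.
apply: ae_le_Rintegral.
- exact: integrable_indic.
- have := integrableZl measurableT (expR (- (s * V))) (iexp s).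
  by apply: eq_integrable.
apply: aeW => w; rewrite indicE -expRD.
have [/set_mem /= Vw|_] := boolP (w \in _); last exact: expR_ge0.
by rewrite -expR0 ler_expR addrC -mulrBr mulr_ge0 // subr_ge0 ltW.
Qed.

(* Splitting e^{sH} according to H <= V, H > V' and V < H <= V': the first two
   parts are dominated by the tilts at s0 <= s and at s2 >= s. *)
Lemma tail_lower_bound (s0 s s2 V V' : R) : 0 <= s -> s0 <= s <= s2 ->
  expR (L s) <= expR ((s - s0) * V + L s0) + expR (L s2 - (s2 - s) * V')
    + expR (s * V') * fine (P [set w | V < H w]).
Proof.
move=> s_ge0 /andP[s0s ss2].
have -> : expR (L s2 - (s2 - s) * V') = expR (- ((s2 - s) * V')) * expR (L s2).
  by rewrite -expRD addrC.
rewrite expRD -tailE -!Eexp.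
rewrite -!RintegralZl //; last exact: integrable_indic.
have iZ c x : P.-integrable setT (EFin \o (fun w => expR c * expR (x * H w))).
  have := integrableZl measurableT (expR c) (iexp x).
  by apply: eq_integrable.
have iI : P.-integrable setT
    (EFin \o (fun w => expR (s * V') * \1_[set w | V < H w] w)).
  have := integrableZl measurableT (expR (s * V')) (integrable_indic P (mtail V)).
  by apply: eq_integrable.
have iD : P.-integrable setT (EFin \o (fun w =>
    expR ((s - s0) * V) * expR (s0 * H w) + expR (- ((s2 - s) * V')) * expR (s2 * H w))).
  have := integrableD measurableT (iZ ((s - s0) * V) s0) (iZ (- ((s2 - s) * V')) s2).
  by apply: eq_integrable.
rewrite -RintegralD // -RintegralD //.
apply: ae_le_Rintegral => //.
  by have := integrableD measurableT iD iI; apply: eq_integrable.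
apply: aeW => w; rewrite -!expRD.
have e1 := expR_ge0 ((s - s0) * V + s0 * H w).
have e2 := expR_ge0 (- ((s2 - s) * V') + s2 * H w).
have e3 : 0 <= expR (s * V') * \1_[set w | V < H w] w.
  by rewrite mulr_ge0 ?expR_ge0 // indicE.
have [HV|VH] := leP (H w) V.
  have : expR (s * H w) <= expR ((s - s0) * V + s0 * H w).
    rewrite ler_expR -lerBlDr -mulrBl ler_wpM2l // subr_ge0 //.
  lra.
have [HV'|VH'] := leP (H w) V'.
  have : expR (s * H w) <= expR (s * V') * \1_[set w | V < H w] w.
    by rewrite indicE mem_set // mulr1 ler_expR ler_wpM2l.
  lra.
have : expR (s * H w) <= expR (- ((s2 - s) * V') + s2 * H w).
  rewrite ler_expR; have : (s2 - s) * V' <= (s2 - s) * H w.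
    by rewrite ler_wpM2l ?subr_ge0 // ltW.
  lra.
lra.
Qed.

End ExponentialTilting.

Section IndependentSumMgf.
Context {d : measure_display} {T : measurableType d} {R : realType}.
Variables (P : probability T R) (X : nat -> {RV P >-> R}) (b : R).
Hypothesis iX : independent_RVs X.
Hypothesis Xb : forall n, {ae P, forall w, `|X n w| <= b}.

Lemma mgf_independent_sum (c : nat -> R) (N : nat) (s : R) :
  (\int[P]_w (expR (s * \sum_(n < N) (X n w / c n)))%:E =
   (expR (\sum_(n < N) lmgf P (X n) (s / c n)))%:E)%E.
Proof.
have mgf1 n : (\int[P]_w (expR (s / c n * X n w))%:E = (expR (lmgf P (X n) (s / c n)))%:E)%E.
  by rewrite -(fine_expectation_expRM (Xb n)) unlock.
transitivity (\int[P]_w (\prod_(n <- iota 0 N) expR (s / c n * X n w))%:E)%E.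
  apply: eq_integral => w _; congr EFin.
  rewrite mulr_sumr expR_sum -(big_mkord xpredT (fun n => expR (s * (X n w / c n)))).
  by rewrite /index_iota subn0; apply: eq_bigr => n _; rewrite mulrCA mulrC.
rewrite (ge0_integral_independent_prod (g := fun n x => expR (s / c n * x))) //.
- rewrite (eq_bigr _ (fun n _ => mgf1 n)) prodEFin expR_sum.
  by rewrite -(big_mkord xpredT (fun n => expR (lmgf P (X n) (s / c n)))) /index_iota subn0.
- exact: iota_uniq.
- by move=> n; apply: (measurableT_comp (@measurable_expR R)); exact: measurable_funM.
- by move=> n; rewrite mgf1.
Qed.

End IndependentSumMgf.

(** * Counting asymptotics *)

Section IntervalIntegrals.
Context {R : realType}.
Notation mu := (@lebesgue_measure R).
Implicit Types (f : R -> R) (a b c : R).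

Lemma bounded_integrable_itv (x y : bool) f a b (M : R) :
  let D := [set` Interval (BSide x a) (BSide y b)] in
  measurable_fun D f -> (forall t, D t -> `|f t| <= M) ->
  mu.-integrable D (EFin \o f).
Proof.
move=> D mf bf.
have fin : (mu D < +oo)%E.
  by rewrite /D /= lebesgue_measure_itv /=; case: ifP => _; rewrite ?ltry // -EFinB ltry.
apply: measurable_bounded_integrable => //; first exact: measurable_itv.
exists M; split; first exact: num_real.
by move=> z Mz t Dt; apply: le_trans (bf t Dt) (ltW Mz).
Qed.

Lemma fine_lebesgue_itv (x y : bool) a b : a <= b ->
  fine (mu [set` Interval (BSide x a) (BSide y b)]) = b - a.
Proof.
rewrite le_eqVlt => /predU1P[->|ab]; rewrite lebesgue_measure_itv /= lte_fin.
  by rewrite ltxx subrr.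
by rewrite ab.
Qed.

Lemma Rintegral_itv_le (x y : bool) f a b (h : R) :
  let D := [set` Interval (BSide x a) (BSide y b)] in
  a <= b -> mu.-integrable D (EFin \o f) -> (forall t, D t -> f t <= h) ->
  \int[mu]_(t in D) f t <= h * (b - a).
Proof.
move=> D ab iF fh; rewrite -(fine_lebesgue_itv x y ab) -Rintegral_cst; last exact: measurable_itv.
apply: le_Rintegral => //; try exact: measurable_itv.
by apply: (@bounded_integrable_itv x y _ _ _ `|h|).
Qed.

Lemma Rintegral_itv_ge (x y : bool) f a b (h : R) :
  let D := [set` Interval (BSide x a) (BSide y b)] in
  a <= b -> mu.-integrable D (EFin \o f) -> (forall t, D t -> h <= f t) ->
  h * (b - a) <= \int[mu]_(t in D) f t.
Proof.
move=> D ab iF fh; rewrite -(fine_lebesgue_itv x y ab) -Rintegral_cst; last exact: measurable_itv.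
apply: le_Rintegral => //; try exact: measurable_itv.
by apply: (@bounded_integrable_itv x y _ _ _ `|h|).
Qed.

Lemma normr_Rintegral_itv_le (x y : bool) f a b (h : R) :
  let D := [set` Interval (BSide x a) (BSide y b)] in
  a <= b -> measurable_fun D f -> (forall t, D t -> `|f t| <= h) ->
  `|\int[mu]_(t in D) f t| <= h * (b - a).
Proof.
move=> D ab mf fh; have iF := bounded_integrable_itv mf fh.
rewrite ler_norml -mulNr; apply/andP; split.
  by apply: Rintegral_itv_ge => // t /fh; rewrite ler_norml => /andP[].
by apply: Rintegral_itv_le => // t /fh; rewrite ler_norml => /andP[].
Qed.

End IntervalIntegrals.

Section PowerBounds.
Context {R : realType}.
Implicit Types (a p v x : R).

Lemma powR_pos x p : 0 < x -> x `^ p = expR (p * ln x).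
Proof. by move=> x0; rewrite /powR gt_eqF. Qed.

Lemma powR_le_expR p a : 0 <= p -> 0 < a ->
  exists2 C : R, 0 < C & forall v, 0 < v -> v `^ p <= C * expR (a * v).
Proof.
rewrite le_eqVlt => /predU1P[<-|p0] a0.
  exists 1 => // v v0; rewrite powRr0 mul1r -expR0 ler_expR.
  by rewrite mulr_ge0 // ltW.
exists (expR (p * ln (p / a))); first exact: expR_gt0.
move=> v v0; rewrite powR_pos // -expRD ler_expR.
have pa : 0 < p / a by rewrite divr_gt0.
have -> : v = (p / a) * (v / (p / a)) by rewrite mulrC divfK // gt_eqF.
rewrite lnM ?posrE ?divr_gt0 // mulrDr lerD2l.
have -> : a * (p / a * (v / (p / a))) = p * (v / (p / a)).
  by rewrite mulrA (mulrC a) divfK // gt_eqF.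
by rewrite ler_pM2l // ltW // ln_sublinear // divr_gt0.
Qed.

Lemma powR_nonpos_le x y p : 0 < x -> x <= y -> p <= 0 -> y `^ p <= x `^ p.
Proof.
move=> x0 xy p0; have y0 := lt_le_trans x0 xy.
by rewrite !powR_pos // ler_expR ler_wnM2l // ler_ln.
Qed.

Lemma powR_le_max x y z p : 0 < x -> x <= y <= z ->
  Num.min (x `^ p) (z `^ p) <= y `^ p <= Num.max (x `^ p) (z `^ p).
Proof.
move=> x0 /andP[xy yz]; have y0 := lt_le_trans x0 xy; have z0 := lt_le_trans y0 yz.
rewrite ge_min le_max.
have [p0|/ltW p0] := leP 0 p.
  apply/andP; split; apply/orP; [left|right];
    by apply: ge0_ler_powR; rewrite ?nnegrE ?(ltW x0) ?(ltW y0) ?(ltW z0).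
by apply/andP; split; apply/orP; [right|left]; apply: powR_nonpos_le.
Qed.

End PowerBounds.

Section Counting.
Context {R : realType} {q : nat -> R}.
Hypothesis q_nd : forall m n, (m <= n)%N -> q m <= q n.

(** For nondecreasing [q] a finite [upto q x] is an initial segment of the indices, so sums over it
    become sums over ordinals. The default 0 is taken when it is infinite. *)
Definition qcount (x : R) : nat := xget 0%N [set n | upto q x = `I_n].

Lemma upto_qcount x : finite_set (upto q x) -> upto q x = `I_(qcount x).
Proof.
move=> fin.
have ex : exists n, x < q n.
  apply/not_existsP => h; apply: infinite_nat.
  apply: sub_finite_set fin => n _; rewrite /upto /= leNgt; apply/negP; exact: h.
pose n := ex_minn ex.
have E : upto q x = `I_n.
  rewrite /n; case: ex_minnP => k xk mink; apply/seteqP; split => m /=.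
    by rewrite /upto /= => qm; rewrite ltnNge; apply/negP => km; have := q_nd km; lra.
  by move=> mk; rewrite /upto /= leNgt; apply/negP => /mink; rewrite leqNgt mk.
by rewrite /qcount; case: xgetP => [m _ //|/(_ n)].
Qed.

Lemma counting_qcount x : finite_set (upto q x) ->
  counting (upto q x) = (qcount x)%:R%:E :> \bar R.
Proof.
move=> fin; rewrite /counting asboolT //; congr (_%:R%:E).
by apply: card_fset_set; rewrite upto_qcount.
Qed.

End Counting.
Arguments qcount {R} q x.

Section CountingAsymptotics.
Context {R : realType} {alpha beta A B : R} {q : nat -> R}.
Hypotheses (alpha_gt0 : 0 < alpha) (beta_gt0 : 0 < beta) (A_ge0 : 0 <= A).
Hypothesis B_gt : Num.max A 1 < B.
Hypothesis q_seq : is_sequenceA alpha beta A B q.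
Notation mu := (@lebesgue_measure R).

Let beta' := (2 + beta) ^+ 2.
Let v0 := ln (2 * beta' / beta).

Let beta'_ge : 4 <= beta'. Proof. by have := beta_gt0; rewrite /beta'; nra. Qed.
Let beta'_div : 8 <= beta' / beta.
Proof.
rewrite ler_pdivlMr // /beta' -subr_ge0.
have -> : (2 + beta) ^+ 2 - 8 * beta = (2 - beta) ^+ 2 by ring.
exact: sqr_ge0.
Qed.

Let ln4 : 1 <= ln 4 :> R.
Proof. by rewrite -[leLHS]expRK ler_ln ?posrE ?expR_gt0 ?expR1_le4. Qed.

(** Logarithmic scale v = ln (x / beta): the density ln(t/beta)^(A-1) at t = beta e^y becomes the
    power y^(A-1). *)
Definition ncount (v : R) : R := (qcount q (beta * expR v))%:R.

Definition gcount (v : R) : R :=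
  alpha * \int[mu]_(t in `[beta', beta * expR v]) ln (t / beta) `^ (A - 1).

Let expv0 v : v0 <= v -> 2 * beta' <= beta * expR v.
Proof.
have b4 := beta'_ge; move=> h; rewrite [leRHS]mulrC -ler_pdivrMr // -ler_ln ?posrE ?expR_gt0 ?divr_gt0 //; last by lra.
by rewrite expRK.
Qed.

Lemma upto_finite x : 2 * beta' <= x -> finite_set (upto q x).
Proof.
move=> hx; have [K0 /(_ x hx) [eps [_ _ e]]] := seqA_counting q_seq.
move: e; rewrite /counting; case: ifPn => // /asboolP //.
Qed.

Let powln a b : beta' <= a ->
  mu.-integrable `[a, b] (EFin \o (fun t => ln (t / beta) `^ (A - 1))).
Proof.
have b4 := beta'_div; have l4 := ln4; move=> ha; have [C C0 hC] : exists2 C : R, 0 < C & forall t, a <= t <= b -> ln (t / beta) `^ (A - 1) <= C.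
  exists (Num.max (ln (a / beta) `^ (A - 1)) (ln (b / beta) `^ (A - 1)) + 1).
    rewrite ltr_wpDl // le_max powR_ge0 //.
  move=> t /andP[at_ tb].
  have h8 : 8 <= a / beta by apply: le_trans beta'_div _; rewrite ler_pM2r ?invr_gt0.
  have /andP[_ h] : Num.min (ln (a / beta) `^ (A - 1)) (ln (b / beta) `^ (A - 1)) <=
    ln (t / beta) `^ (A - 1) <= Num.max (ln (a / beta) `^ (A - 1)) (ln (b / beta) `^ (A - 1)).
    apply: powR_le_max; first by rewrite ln_gt0 //; lra.
    have ta : 0 < t / beta by apply: (@lt_le_trans _ _ (a / beta)); [lra|rewrite ler_pM2r ?invr_gt0].
    have tb' : t / beta <= b / beta by rewrite ler_pM2r ?invr_gt0.
    have at' : a / beta <= t / beta by rewrite ler_pM2r ?invr_gt0.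
    by rewrite !ler_ln ?posrE //; lra.
  by apply: le_trans h _; rewrite lerDl.
apply: (@bounded_integrable_itv _ true false _ a b C).
  apply: measurable_funTS.
  apply: (measurableT_comp (@measurable_powR R (A - 1))).
  apply: (measurableT_comp (@measurable_ln R)).
  exact: measurable_funM.
move=> t /=; rewrite in_itv /= => h; rewrite ger0_norm ?powR_ge0 //; exact: hC.
Qed.

(** The bounds [lo] and [hi] are left abstract because y^(A-1) increases or decreases according to
    the sign of A - 1. *)
Lemma gcount_cell (v v' lo hi : R) : v0 <= v -> v <= v' ->
  (forall y, v <= y <= v' -> lo <= y `^ (A - 1) <= hi) ->
  alpha * beta * (expR v' - expR v) * lo <= gcount v' - gcount v
    <= alpha * beta * (expR v' - expR v) * hi.
Proof.
move=> hv vv' hy; have b4 := beta'_ge.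
have e0 := expv0 hv; set a := beta * expR v in e0; set b := beta * expR v'.
have ab : a <= b by rewrite /a /b ler_pM2l // ler_expR.
have ib : mu.-integrable `[beta', b] (EFin \o (fun t => ln (t / beta) `^ (A - 1))).
  exact: powln.
have -> : gcount v' - gcount v =
    alpha * \int[mu]_(t in `]a, b]) ln (t / beta) `^ (A - 1).
  rewrite /gcount -mulrBr -/a -/b Rintegral_itvB //.
  - by rewrite bnd_simp; lra.
have iab : mu.-integrable `]a, b] (EFin \o (fun t => ln (t / beta) `^ (A - 1))).
  apply: (integrableS _ _ _ ib) => //.
  by apply: subset_itvr; rewrite bnd_simp; lra.
have hl t : `]a, b]%classic t -> lo <= ln (t / beta) `^ (A - 1) <= hi.
  rewrite /= in_itv /= => /andP[at_ tb].
  have t0 : 0 < t by rewrite (lt_trans _ at_) // /a mulr_gt0 ?expR_gt0.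
  apply: hy; rewrite -[v]expRK -[v']expRK !ler_ln ?posrE ?expR_gt0 ?divr_gt0 //.
  by rewrite ler_pdivlMr // ler_pdivrMr // ![_ * beta]mulrC -/a -/b tb ltW.
have e : alpha * beta * (expR v' - expR v) = alpha * (b - a) by rewrite /a /b; ring.
rewrite e -!mulrA !ler_pM2l // ![(b - a) * _]mulrC; apply/andP; split.
  by apply: Rintegral_itv_ge => // t /hl /andP[].
by apply: Rintegral_itv_le => // t /hl /andP[].
Qed.

Let measurable_w (D : set R) : measurable_fun D (fun t => ln (t / beta) `^ (A - 1)).
Proof.
apply: measurable_funTS.
apply: (measurableT_comp (@measurable_powR R (A - 1))).
apply: (measurableT_comp (@measurable_ln R)).
exact: measurable_funM.
Qed.

(** The error integral is cut at beta e^(v/2). Below, a bounded integrand gives O(e^(v/2)), which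
    e^v times any power of v absorbs; above, ln(t/beta) >= v/2 gives the power v^(A-1-B). The
    threshold makes v/2 admissible as well. *)
Lemma ncount_gcount : exists2 C : R, 0 < C & forall v, 2 * Num.max v0 1 <= v ->
  `|ncount v - gcount v| <= C * expR v * v `^ (A - 1 - B).
Proof.
have a0 := alpha_gt0; have b0 := beta_gt0; have A0 := A_ge0.
have b4 := beta'_ge; have b8 := beta'_div; have l4 := ln4.
have [AB B1] : A < B /\ 1 < B by move: B_gt; rewrite gt_max => /andP.
set p := A - 1 - B.
have p0 : p <= 0 by rewrite /p; lra.
have [K0 hK] := seqA_counting q_seq.
(* Converts the ln t of the error hypothesis into ln(t/beta): on the range, ln t >= 1, hence
   ln(t/beta) <= (1 + |ln beta|) ln t. *)
set c := (1 + `|ln beta|)^-1.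
have c0 : 0 < c by rewrite invr_gt0 ltr_pwDl.
have [K1 K1E] : exists K1 : R, K1 = `|K0| / c `^ B by exists (`|K0| / c `^ B).
have K10 : 0 <= K1 by rewrite K1E divr_ge0 ?powR_ge0.
have [C2 C20 hC2] : exists2 C : R, 0 < C & forall v, 0 < v -> v `^ (- p) <= C * expR (2^-1 * v).
  by apply: powR_le_expR; lra.
exists (1 + alpha * K1 * beta * (C2 + 2^-1 `^ p)) => [|v].
  apply: ltr_pwDl => //; apply: mulr_ge0.
    by apply: mulr_ge0; [apply: mulr_ge0|]; rewrite // ltW.
  by apply: addr_ge0; [exact: ltW|exact: powR_ge0].
have M1 : v0 <= Num.max v0 1 by rewrite le_max lexx.
have M2 : 1 <= Num.max v0 1 by rewrite le_max lexx orbT.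
move=> hv; have vv0 : v0 <= v / 2 by lra.
have v2 : 2 <= v by lra.
have v_gt0 : 0 < v by lra.
have vhalf : expR v = expR (v / 2) * expR (2^-1 * v) by rewrite -expRD; congr expR; field.
have vv0' : v0 <= v by lra.
have hX := expv0 vv0'; have hY := expv0 vv0.
set X := beta * expR v in hX; set Y := beta * expR (v / 2) in hY.
have YX : Y <= X by rewrite /Y /X ler_pM2l // ler_expR; lra.
have bY : beta' <= Y by lra.
have Y_gt0 : 0 < Y by rewrite mulr_gt0 ?expR_gt0.
have [eps [meps heps hcount]] := hK X hX.
set w := fun t => ln (t / beta) `^ (A - 1) in hcount.
have mw D : measurable_fun D w by exact: measurable_w.
have hn : ncount v = alpha * \int[mu]_(t in `[beta', X]) (w t * (1 + eps t)).
  move: hcount; rewrite counting_qcount; [by move=> []|exact: (seqA_nondecreasing q_seq)|].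
  exact: upto_finite.
have ell t : beta' <= t -> 1 <= ln (t / beta) /\ c * ln (t / beta) <= ln t.
  move=> ht; have h8 : 8 <= t / beta by apply: le_trans b8 _; rewrite ler_pM2r ?invr_gt0.
  have t4 : 4 <= t / beta by apply: le_trans h8; rewrite ler_nat.
  have t0 : 0 < t / beta by exact: lt_le_trans t4.
  split; first by apply: le_trans l4 _; rewrite ler_ln ?posrE.
  have t1 : 1 <= ln t by apply: le_trans l4 _; rewrite ler_ln ?posrE //; lra.
  rewrite ln_div ?posrE //; last by lra.
  rewrite /c mulrC ler_pdivrMr; last by rewrite ltr_pwDl.
  have h1 : - ln beta <= `|ln beta| by rewrite -normrN ler_norm.
  have h2 := normr_ge0 (ln beta); nra.
have bnd t : beta' <= t <= X -> `|w t * eps t| <= K1 * ln (t / beta) `^ p.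
  move=> ht; have /andP[ht1 ht2] := ht; have [l1 l2] := ell t ht1.
  rewrite normrM (ger0_norm (powR_ge0 _ _)) /w.
  have l0 : 0 < ln (t / beta) by exact: lt_le_trans l1.
  have cl0 : 0 < c * ln (t / beta) by rewrite mulr_gt0.
  have -> : ln (t / beta) `^ p = ln (t / beta) `^ (A - 1) / ln (t / beta) `^ B.
    by rewrite /p powRB //; apply/implyP => _; rewrite gt_eqF.
  rewrite mulrCA ler_wpM2l ?powR_ge0 //.
  apply: (@le_trans _ _ (`|K0| / ln t `^ B)).
    by apply: le_trans (heps t ht) _; rewrite ler_wpM2r ?invr_ge0 ?powR_ge0 // ler_norm.
  rewrite K1E -mulrA -invfM ler_wpM2l // lef_pV2 ?posrE ?mulr_gt0 ?powR_gt0 //; last exact: lt_le_trans l2.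
  rewrite -powRM ?(ltW c0) ?(ltW l0) //.
  apply: ge0_ler_powR; rewrite ?nnegrE ?(ltW cl0) //; first exact: ltW (lt_trans ltr01 B1).
  exact: le_trans (ltW cl0) l2.
have bnd1 t : beta' <= t <= X -> `|w t * eps t| <= K1.
  move=> ht; apply: le_trans (bnd t ht) _; rewrite ler_piMr //.
  have /andP[ht1 ht2] := ht; have [l1 l2] := ell t ht1.
  by rewrite -(powRr0 (ln (t / beta))); apply: ler_powR.
have mwe D : D `<=` `[beta', X]%classic -> measurable D -> measurable_fun D (fun t => w t * eps t).
  move=> sD mD; apply: measurable_funM => //.
  by apply: (measurable_funS _ sD meps).
have iw : mu.-integrable `[beta', X] (EFin \o w) by exact: powln.
have iwe : mu.-integrable `[beta', X] (EFin \o (fun t => w t * eps t)).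
  apply: (@bounded_integrable_itv _ true false _ beta' X K1).
    by apply: mwe => //; exact: measurable_itv.
  by move=> t /=; rewrite in_itv /= => ht; exact: bnd1.
have -> : ncount v - gcount v = alpha * \int[mu]_(t in `[beta', X]) (w t * eps t).
  rewrite hn /gcount -/X -mulrBr; congr (_ * _).
  have -> : \int[mu]_(t in `[beta', X]) (w t * (1 + eps t)) =
      \int[mu]_(t in `[beta', X]) (w t + w t * eps t).
    by apply: eq_Rintegral => t _; rewrite mulrDr mulr1.
  by rewrite RintegralD // addrC addrA addNr add0r.
have := @Rintegral_itvB R (fun t => w t * eps t) (BLeft beta') (BRight X) Y iwe.
rewrite !bnd_simp => /(_ _ YX); move=> /(_ _)/(canRL (subrK _)) ->; last exact: bY.
rewrite normrM gtr0_norm //.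
have h1 : `|\int[mu]_(t in `[beta', Y]) (w t * eps t)| <= K1 * (Y - beta').
  apply: normr_Rintegral_itv_le => //.
    by apply: mwe; [apply: subset_itvl; rewrite bnd_simp|exact: measurable_itv].
  by move=> t /=; rewrite in_itv /= => /andP[t1 t2]; apply: bnd1; rewrite t1 (le_trans t2 YX).
have h2 : `|\int[mu]_(t in `]Y, X]) (w t * eps t)| <= K1 * (v / 2) `^ p * (X - Y).
  apply: normr_Rintegral_itv_le => //.
    by apply: mwe; [apply: subset_itvr; rewrite bnd_simp|exact: measurable_itv].
  move=> t /=; rewrite in_itv /= => /andP[t1 t2].
  apply: le_trans (bnd t _) _; first by rewrite t2 (le_trans bY (ltW t1)).
  rewrite ler_wpM2l //; apply: powR_nonpos_le => //; first by rewrite divr_gt0.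
  rewrite -[leLHS]expRK ler_ln ?posrE ?expR_gt0 ?divr_gt0 //; last exact: lt_trans t1.
  by rewrite ler_pdivlMr // mulrC -/Y ltW.
have h3 : K1 * (Y - beta') <= K1 * beta * C2 * expR v * v `^ p.
  apply: (@le_trans _ _ (K1 * Y)).
    by rewrite ler_wpM2l // lerBlDr lerDl exprn_ge0 // addr_ge0 // ltW.
  rewrite -!mulrA ler_wpM2l // /Y.
  have vp : 0 < v `^ p by rewrite powR_gt0.
  have h := hC2 v v_gt0; rewrite powRN in h; rewrite vhalf.
  move: h; rewrite -div1r ler_pdivrMr // => h.
  set E := expR (v / 2); set F := expR _ in h *.
  have -> : beta * (C2 * (E * F * v `^ p)) = (beta * E) * (C2 * F * v `^ p) by ring.
  by rewrite ler_peMr // mulr_ge0 ?expR_ge0 ?(ltW b0).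
have h4 : K1 * (v / 2) `^ p * (X - Y) <= K1 * beta * 2^-1 `^ p * expR v * v `^ p.
  apply: (@le_trans _ _ (K1 * (v / 2) `^ p * X)).
    rewrite ler_wpM2l ?mulr_ge0 ?powR_ge0 //.
    by rewrite lerBlDr lerDl /Y mulr_ge0 ?expR_ge0 // ltW.
  rewrite powRM /X ?(ltW v_gt0) ?invr_ge0 //.
  by rewrite le_eqVlt; apply/orP; left; apply/eqP; ring.
apply: (@le_trans _ _ (alpha * (K1 * beta * C2 * expR v * v `^ p + K1 * beta * 2^-1 `^ p * expR v * v `^ p))).
  rewrite ler_pM2l //; apply: le_trans (ler_normD _ _) _.
  by rewrite addrC; apply: lerD; [exact: le_trans h1 h3|exact: le_trans h2 h4].
have e0 : 0 <= expR v * v `^ p by rewrite mulr_ge0 ?expR_ge0 ?powR_ge0.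
rewrite -subr_ge0; set r := (X in 0 <= X).
have -> : r = expR v * v `^ p by rewrite /r; ring.
exact: e0.
Qed.

End CountingAsymptotics.

Section PowerRatio.
Context {R : realType}.
Implicit Types (a h p r v w x y : R).

Lemma ln_le_subr1 r : 0 < r -> ln r <= r - 1.
Proof.
move=> r0; have := expR_ge1Dx (ln r); rewrite lnK ?posrE //; lra.
Qed.

Lemma normr_ln_le r : 2^-1 <= r -> `|ln r| <= 2 * `|r - 1|.
Proof.
move=> r2; have r0 : 0 < r by lra.
have lr := ln_le_subr1 r0.
have [r1|r1] := leP 1 r.
  rewrite ger0_norm ?ln_ge0 // ger0_norm; lra.
rewrite ler0_norm ?ln_le0 ?(ltW r1) // ltr0_norm; last by lra.
rewrite -lnV ?posrE //.
have ri : r^-1 - 1 = (1 - r) / r by rewrite mulrBl mul1r divff ?gt_eqF.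
have h : ln r^-1 <= r^-1 - 1 by rewrite ln_le_subr1 // invr_gt0.
apply: le_trans h _; rewrite ri ler_pdivrMr //; nra.
Qed.

Lemma normr_ln_ratio_le w x y : 0 < w -> - (w / 2) <= y -> y <= x + 1 ->
  `|ln ((w + y) / w)| <= 1 + (Num.max x 0 + 1) / w.
Proof.
move=> w0 hy yx.
have r2 : 2^-1 <= (w + y) / w by rewrite ler_pdivlMr //; lra.
have m0 : 0 <= Num.max x 0 by rewrite le_max lexx orbT.
have mx : x <= Num.max x 0 by rewrite le_max lexx.
have e : (w + y) / w - 1 = y / w by rewrite mulrDl divff ?gt_eqF // addrC addKr.
have z0 : 0 <= (Num.max x 0 + 1) / w by rewrite divr_ge0 ?(ltW w0) //; lra.
have [y0|y0] := leP 0 y.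
  rewrite ger0_norm; last first.
    by rewrite ln_ge0 // ler_pdivlMr //; lra.
  apply: le_trans (ln_le_subr1 _) _; first by lra.
  rewrite e.
  by apply: (@le_trans _ _ ((Num.max x 0 + 1) / w)); rewrite ?ler_pM2r ?invr_gt0 //; lra.
apply: le_trans (normr_ln_le r2) _; rewrite e ltr0_norm; last by rewrite pmulr_llt0 ?invr_gt0.
have : - (w / 2) / w <= y / w by rewrite ler_pM2r ?invr_gt0.
have -> : - (w / 2) / w = - 2^-1 by rewrite mulNr mulrAC divff ?mul1r ?gt_eqF.
lra.
Qed.

(* For y within 1 above x in the range y >= -w/2, the powers (w+y)^a and w^a
   differ by a factor growing at most like e^{x/4}. *)
Lemma powR_ratio_bounds a : exists2 C : R, 0 < C &
  forall w x y, 1 <= w -> 4 * `|a| <= w -> - (w / 2) <= y -> y <= x + 1 ->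
  (w + y) `^ a <= C * w `^ a * expR (Num.max x 0 / 4) /\
  `|(w + y) `^ a - w `^ a| <= C * w `^ a * (`|y| / w) * expR (Num.max x 0 / 4).
Proof.
set D := expR (`|a| + 4^-1).
have D0 : 0 < D by exact: expR_gt0.
exists ((1 + 2 * `|a|) * D); first by rewrite mulr_gt0 // ltr_pwDl // mulr_ge0.
move=> w x y w1 wa hy yx; have w0 : 0 < w by lra.
set r := (w + y) / w.
have r2 : 2^-1 <= r by rewrite /r ler_pdivlMr //; lra.
have r0 : 0 < r by lra.
have -> : (w + y) `^ a = w `^ a * r `^ a.
  rewrite -powRM ?(ltW w0) ?(ltW r0) //; congr (_ `^ _).
  by rewrite /r mulrC divfK // gt_eqF.
have m0 : 0 <= Num.max x 0 by rewrite le_max lexx orbT.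
set m := Num.max x 0.
have z1 : `|a * ln r| <= `|a| + 4^-1 + m / 4.
  rewrite normrM; apply: le_trans (ler_wpM2l (normr_ge0 a) (normr_ln_ratio_le w0 hy yx)) _.
  rewrite -/m mulrDr mulr1 -addrA lerD2l.
  have : `|a| * ((m + 1) / w) <= (m + 1) / 4.
    rewrite mulrA ler_pdivrMr // -[leRHS]mulrA [`|a| * _]mulrC ler_wpM2l //; last by lra.
    by rewrite /m; lra.
  lra.
have e1 : expR `|a * ln r| <= D * expR (m / 4).
  by rewrite /D -expRD ler_expR.
have ra : r `^ a = expR (a * ln r) by exact: powR_pos.
have wa0 : 0 <= w `^ a by exact: powR_ge0.
have a0 := normr_ge0 a.
have E0 := expR_gt0 (m / 4).
have DE : 0 < D * expR (m / 4) by rewrite mulr_gt0.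
split.
  have -> : (1 + 2 * `|a|) * D * w `^ a * expR (m / 4) =
     w `^ a * ((1 + 2 * `|a|) * (D * expR (m / 4))) by ring.
  apply: ler_wpM2l => //; rewrite ra.
  apply: (@le_trans _ _ (D * expR (m / 4))).
    by apply: le_trans e1; rewrite ler_expR ler_norm.
  by rewrite ler_peMl ?(ltW DE) //; lra.
have -> : w `^ a * r `^ a - w `^ a = w `^ a * (r `^ a - 1) by ring.
rewrite normrM (ger0_norm wa0).
have -> : (1 + 2 * `|a|) * D * w `^ a * (`|y| / w) * expR (m / 4) =
   w `^ a * ((1 + 2 * `|a|) * (`|y| / w) * (D * expR (m / 4))) by ring.
apply: ler_wpM2l => //; rewrite ra.
apply: le_trans (normr_expR_sub1 _) _; apply: ler_pM => //; try exact: expR_ge0.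
have e : r - 1 = y / w by rewrite /r mulrDl divff ?gt_eqF // addrC addKr.
rewrite normrM; apply: le_trans (ler_wpM2l a0 (normr_ln_le r2)) _.
rewrite e normrM (gtr0_norm (_ : 0 < w^-1)) ?invr_gt0 //.
have yw : 0 <= `|y| / w by rewrite divr_ge0 // ltW.
set z := `|y| / w in yw *.
have -> : (1 + 2 * `|a|) * z = `|a| * (2 * z) + z by ring.
by rewrite lerDl.
Qed.

End PowerRatio.

(** The error h^2 comes from e^h - 1 - h, h|x|/w from replacing y^(A-1) by w^(A-1) on the cell, and
    w^(-B) from the counting error at both ends. The factor e^(max(x,0)/4) pays for x not small
    compared with w; it is harmless against the decay of g(e^(-x)). *)
Lemma count_cell (R : realType) (alpha beta A B : R) (n G : R -> R) (V1 C1 : R) :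
  0 < alpha -> 0 < beta -> 1 <= V1 -> 0 < C1 ->
  (forall v v' lo hi : R, V1 <= v -> v <= v' ->
    (forall y, v <= y <= v' -> lo <= y `^ (A - 1) <= hi) ->
    alpha * beta * (expR v' - expR v) * lo <= G v' - G v
      <= alpha * beta * (expR v' - expR v) * hi) ->
  (forall v, V1 <= v -> `|n v - G v| <= C1 * expR v * v `^ (A - 1 - B)) ->
  exists2 C : R, 0 < C & exists2 w1 : R, 1 <= w1 &
  forall w x h : R, w1 <= w -> - (w / 2) <= x -> 0 < h <= 1 ->
  `|n (w + x + h) - n (w + x) - alpha * beta * (expR (w + x) * w `^ (A - 1) * h)|
   <= C * (expR (w + x) * w `^ (A - 1) * expR (Num.max x 0 / 4)
       * (h ^+ 2 + h * `|x| / w + (w `^ B)^-1)).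
Proof.
move=> a0 b0 V11 C10 G_cell n_G.
have [Ca Ca0 hCa] := @powR_ratio_bounds R (A - 1).
have [Cp Cp0 hCp] := @powR_ratio_bounds R (A - 1 - B).
have ab0 : 0 < alpha * beta by rewrite mulr_gt0.
have Ca2 : 0 <= 2 + 4 * Ca by lra.
exists (5 * C1 * Cp + alpha * beta * (2 + 4 * Ca)).
  by rewrite ltr_pwDl ?mulr_gt0 // !mulr_ge0 ?addr_ge0 ?mulr_ge0 // ltW.
(* Half of w must exceed [V1], as x may go down to -w/2; the other two terms are what
   [powR_ratio_bounds] requires for the exponents A - 1 and A - 1 - B. *)
exists (2 * V1 + 4 * `|A - 1| + 4 * `|A - 1 - B|).
  by have := normr_ge0 (A - 1); have := normr_ge0 (A - 1 - B); lra.
move=> w x h hw hx /andP[h0 h1].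
have na := normr_ge0 (A - 1); have np := normr_ge0 (A - 1 - B).
have w1 : 1 <= w by lra.
have w0 : 0 < w by lra.
have wa : 4 * `|A - 1| <= w by lra.
have wp : 4 * `|A - 1 - B| <= w by lra.
have wx : V1 <= w + x by lra.
have wxh : V1 <= w + x + h by lra.
clear hw na np.
set m := Num.max x 0; set E := expR (m / 4); set e := expR (w + x); set W := w `^ (A - 1).
have E1 : 1 <= E by rewrite -expR0 ler_expR divr_ge0 // /m le_max lexx orbT.
have e0 : 0 < e by exact: expR_gt0.
have E0 : 0 < E by exact: expR_gt0.
have W0 : 0 < W by rewrite powR_gt0.
have Wp : w `^ (A - 1 - B) = W / w `^ B by rewrite powRB //; apply/implyP => _; rewrite gt_eqF.
have WB0 : 0 < (w `^ B)^-1 by rewrite invr_gt0 powR_gt0.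
set b := (w `^ B)^-1 in WB0 *.
have hh : expR h - 1 <= h + 2 * h ^+ 2 by have := @expR_leDxsqr _ h h1; clear; lra.
have hh' : h <= expR h - 1 by have := expR_ge1Dx h; clear; lra.
have eh : expR (w + x + h) = e * expR h by rewrite expRD.
have er y : y <= x + 1 -> - (w / 2) <= y -> (w + y) `^ (A - 1 - B) <= Cp * (W * b) * E.
  by move=> y1 y2; have [hp _] := hCp w x y w1 wp y2 y1; rewrite Wp in hp.
have s1 : `|n (w + x + h) - G (w + x + h)| <= 4 * (C1 * Cp * (e * W * E * b)).
  apply: le_trans (n_G _ wxh) _; rewrite eh.
  have h4 : expR h <= 4 by apply: le_trans expR1_le4; rewrite ler_expR.
  have := er (x + h) _ _; rewrite addrA => /(_ _ _)h5.
  have {}h5 : (w + x + h) `^ (A - 1 - B) <= Cp * (W * b) * E by apply: h5; clear -hx h0 h1; lra.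
  have -> : 4 * (C1 * Cp * (e * W * E * b)) = C1 * (e * 4) * (Cp * (W * b) * E) by ring.
  apply: ler_pM => //; first by rewrite !mulr_ge0 ?expR_ge0 // ltW.
    exact: powR_ge0.
  by rewrite !ler_pM2l.
have s2 : `|n (w + x) - G (w + x)| <= C1 * Cp * (e * W * E * b).
  apply: le_trans (n_G _ wx) _.
  have -> : C1 * Cp * (e * W * E * b) = C1 * e * (Cp * (W * b) * E) by ring.
  rewrite ler_wpM2l //; first by rewrite mulr_ge0 // ltW.
  by apply: er => //; rewrite lerDl.
set del := Ca * W * ((`|x| + h) / w) * E.
have del0 : 0 <= del by rewrite /del !mulr_ge0 ?expR_ge0 ?addr_ge0 ?invr_ge0 // ltW.
have hG : alpha * beta * (expR (w + x + h) - e) * (W - del) <= G (w + x + h) - G (w + x)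
    <= alpha * beta * (expR (w + x + h) - e) * (W + del).
  apply: G_cell => //; first by rewrite lerDl ltW.
  move=> y /andP[y1 y2].
  have yE : y = w + (y - w) by ring.
  have yl : - (w / 2) <= y - w by clear -y1 hx; lra.
  have yu : y - w <= x + 1 by clear -y2 h1; lra.
  have h5 : `|y `^ (A - 1) - W| <= Ca * W * (`|y - w| / w) * E.
    by have [_] := hCa w x (y - w) w1 wa yl yu; rewrite -yE.
  have h6 : `|y - w| <= `|x| + h.
    have -> : y - w = x + (y - w - x) by ring.
    apply: le_trans (ler_normD _ _) _; rewrite lerD2l ger0_norm; clear -y1 y2; lra.
  have h7 : `|y `^ (A - 1) - W| <= del.
    apply: le_trans h5 _; rewrite /del.
    apply: ler_wpM2r; first exact: expR_ge0.
    apply: ler_wpM2l; first by rewrite mulr_ge0 // ltW.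
    by rewrite ler_pM2r ?invr_gt0.
  by move: h7; rewrite ler_distl => /andP[-> ->].
have s3 : `|G (w + x + h) - G (w + x) - alpha * beta * (e * W * h)| <=
    alpha * beta * ((2 + 4 * Ca) * (e * W * E * (h ^+ 2 + h * `|x| / w))).
  have h4 : expR h - 1 <= 4 * h by clear -hh h0 h1; nra.
  have t1 : e * (expR h - 1) * (W + del) - e * W * h <=
     (2 + 4 * Ca) * (e * W * E * (h ^+ 2 + h * `|x| / w)).
    have u1 : e * (expR h - 1) * W - e * W * h <= e * W * E * (2 * h ^+ 2).
      have -> : e * (expR h - 1) * W - e * W * h = e * W * (expR h - 1 - h) by ring.
      rewrite -[leRHS]mulrA ler_pM2l ?mulr_gt0 //.
      apply: (@le_trans _ _ (2 * h ^+ 2)); first by clear -hh; lra.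
      by rewrite ler_peMl // mulr_ge0 // exprn_ge0 // ltW.
    have u2 : e * (expR h - 1) * del <= e * (4 * h) * del.
      by rewrite ler_wpM2r // ler_pM2l.
    have u3 : e * (4 * h) * del = 4 * Ca * (e * W * E * (h ^+ 2 / w + h * `|x| / w)).
      by rewrite /del; field; rewrite gt_eqF.
    have u4 : 4 * Ca * (e * W * E * (h ^+ 2 / w + h * `|x| / w)) <=
       4 * Ca * (e * W * E * (h ^+ 2 + h * `|x| / w)).
      rewrite !ler_pM2l ?mulr_gt0 //.
      by rewrite lerD2r ler_pdivrMr // ler_peMr // exprn_ge0 // ltW.
    have u5 : 0 <= e * W * E * (h * `|x| / w).
      by rewrite mulr_ge0 ?mulr_ge0 ?invr_ge0 ?normr_ge0 ?expR_ge0 ?powR_ge0 // ltW.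
    have -> : e * (expR h - 1) * (W + del) - e * W * h =
      (e * (expR h - 1) * W - e * W * h) + e * (expR h - 1) * del by ring.
    have -> : (2 + 4 * Ca) * (e * W * E * (h ^+ 2 + h * `|x| / w)) =
       e * W * E * (2 * h ^+ 2) + 2 * (e * W * E * (h * `|x| / w)) +
       4 * Ca * (e * W * E * (h ^+ 2 + h * `|x| / w)) by ring.
    by clear -u1 u2 u3 u4 u5; lra.
  have t2 : - ((2 + 4 * Ca) * (e * W * E * (h ^+ 2 + h * `|x| / w))) <=
     e * (expR h - 1) * (W - del) - e * W * h.
    have u1 : e * W * h <= e * (expR h - 1) * W.
      by rewrite -!mulrA ler_pM2l // mulrC ler_pM2r.
    have -> : e * (expR h - 1) * (W - del) - e * W * h =
      (e * (expR h - 1) * W - e * W * h) - (e * (expR h - 1) * (W + del) - e * (expR h - 1) * W) by ring.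
    by clear -u1 t1; lra.
  move: hG; rewrite eh.
  have -> : alpha * beta * (e * expR h - e) * (W - del) = alpha * beta * (e * (expR h - 1) * (W - del)) by ring.
  have -> : alpha * beta * (e * expR h - e) * (W + del) = alpha * beta * (e * (expR h - 1) * (W + del)) by ring.
  move=> /andP[g1 g2].
  have v1 := ler_wpM2l (ltW ab0) t1; have v2 := ler_wpM2l (ltW ab0) t2.
  by rewrite ler_norml; apply/andP; clear -g1 g2 v1 v2; split; lra.
have T1 : 0 <= e * W * E * (h ^+ 2 + h * `|x| / w).
  by rewrite !mulr_ge0 ?addr_ge0 ?exprn_ge0 ?mulr_ge0 ?invr_ge0 ?expR_ge0 ?(ltW W0) ?(ltW h0) ?(ltW w0).
have T2 : 0 <= e * W * E * b by rewrite !mulr_ge0 ?expR_ge0 ?(ltW W0) ?(ltW WB0).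
have -> : n (w + x + h) - n (w + x) - alpha * beta * (e * W * h) =
  (n (w + x + h) - G (w + x + h)) - (n (w + x) - G (w + x)) +
  (G (w + x + h) - G (w + x) - alpha * beta * (e * W * h)) by ring.
apply: le_trans (ler_normD _ _) _; apply: le_trans (lerD (ler_normB _ _) s3) _.
apply: le_trans (lerD (lerD s1 s2) (lexx _)) _.
have k1 : 0 <= C1 * Cp * (e * W * E * (h ^+ 2 + h * `|x| / w)).
  by rewrite mulr_ge0 // mulr_ge0 // ltW.
have k2 : 0 <= alpha * beta * ((2 + 4 * Ca) * (e * W * E * b)).
  by apply: mulr_ge0; [exact: ltW|exact: mulr_ge0].
rewrite -subr_ge0; set z := (X in 0 <= X).
have -> : z = 5 * (C1 * Cp * (e * W * E * (h ^+ 2 + h * `|x| / w))) +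
   alpha * beta * ((2 + 4 * Ca) * (e * W * E * b)) by rewrite /z; ring.
by rewrite addr_ge0 // mulr_ge0.
Qed.

(** With N equal steps of length h, the Theta terms sum to h (Theta v' - Theta v), which vanishes as
    N grows, while the psi terms telescope independently of N. This stands in for Stieltjes
    integration: local errors that are O(h) times an increment cost nothing. *)
Lemma telescoping_bound (R : realType) (Phi Theta psi : R -> R) (V1 : R) :
  (forall v h, V1 <= v -> 0 < h <= 1 ->
    `|Phi (v + h) - Phi v| <= h * (Theta (v + h) - Theta v) + (psi v - psi (v + h))) ->
  forall v v', V1 <= v -> v <= v' -> `|Phi v' - Phi v| <= psi v - psi v'.
Proof.
move=> H v v' hv; rewrite le_eqVlt => /predU1P[<-|vv']; first by rewrite !subrr normr0.
have sum h (k : nat) : 0 < h <= 1 -> `|Phi (v + k%:R * h) - Phi v| <=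
    h * (Theta (v + k%:R * h) - Theta v) + (psi v - psi (v + k%:R * h)).
  move=> h01; have /andP[h0 _] := h01.
  elim: k => [|k IH]; first by rewrite mul0r addr0 !subrr normr0 mulr0 addr0.
  have kh : V1 <= v + k%:R * h by rewrite (le_trans hv) // lerDl mulr_ge0 // ltW.
  have := H (v + k%:R * h) h kh h01.
  have -> : v + k%:R * h + h = v + k.+1%:R * h by rewrite -natr1 mulrDl mul1r addrA.
  move: (v + k.+1%:R * h) (v + k%:R * h) IH {kh} => x y IH h1.
  have -> : Phi x - Phi v = (Phi x - Phi y) + (Phi y - Phi v) by ring.
  apply: le_trans (ler_normD _ _) _; apply: le_trans (lerD h1 IH) _.
  by rewrite le_eqVlt; apply/orP; left; apply/eqP; ring.
apply/ler_addgt0Pr => e e0.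
set D := `|Theta v' - Theta v|.
(* Large enough for the step to be at most 1 and for step times D to be at most e. *)
set N := (Num.truncn ((v' - v) * (D / e + 1))).+1.
have N0 : 0 < N%:R :> R by rewrite ltr0n.
have hN : (v' - v) * (D / e + 1) <= N%:R by exact: ltW (Num.Theory.truncnS_gt _).
have D0 : 0 <= D := normr_ge0 _.
have De : 0 <= D / e by rewrite divr_ge0 // ltW.
have d0 : 0 < v' - v by rewrite subr_gt0.
have h01 : 0 < (v' - v) / N%:R <= 1.
  rewrite divr_gt0 //= ler_pdivrMr // mul1r; apply: le_trans hN.
  by rewrite ler_peMr ?(ltW d0) // lerDr.
have := sum _ N h01.
have -> : v + N%:R * ((v' - v) / N%:R) = v' by rewrite mulrC divfK ?gt_eqF // addrC subrK.
move=> h; apply: le_trans h _; rewrite addrC lerD2l.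
apply: (@le_trans _ _ ((v' - v) / N%:R * D)).
  by apply: ler_wpM2l; [case/andP: h01 => /ltW|exact: ler_norm].
rewrite mulrAC ler_pdivrMr //.
have : (v' - v) * (D / e) <= N%:R.
  by apply: le_trans hN; rewrite ler_pM2l // lerDl.
by rewrite mulrA ler_pdivrMr // [e * _]mulrC.
Qed.

(** * Partial summation: the harmonic sum with an error term *)

Section HarmonicSum.
Context {R : realType}.
Variables (alpha beta A B : R) (n G H M : R -> R) (V1 C1 : R).
Hypotheses (alpha_gt0 : 0 < alpha) (beta_gt0 : 0 < beta) (AB : A < B).
Hypotheses (V1_ge1 : 1 <= V1) (C1_gt0 : 0 < C1).
Hypothesis G_cell : forall v v' lo hi : R, V1 <= v -> v <= v' ->
  (forall y, v <= y <= v' -> lo <= y `^ (A - 1) <= hi) ->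
  alpha * beta * (expR v' - expR v) * lo <= G v' - G v
    <= alpha * beta * (expR v' - expR v) * hi.
Hypothesis n_G : forall v, V1 <= v ->
  `|n v - G v| <= C1 * expR v * v `^ (A - 1 - B).
Hypothesis n_nd : forall v v', V1 <= v -> v <= v' -> n v <= n v'.
Hypothesis H_cell : forall v v', V1 <= v -> v <= v' ->
  (n v' - n v) / (beta * expR v') <= H v' - H v <= (n v' - n v) / (beta * expR v).
Hypothesis M_cell : forall v v' lo hi : R, V1 <= v -> v <= v' ->
  (forall y, v <= y <= v' -> lo <= y `^ (A - 1) <= hi) ->
  alpha * (v' - v) * lo <= M v' - M v <= alpha * (v' - v) * hi.

Let a := A - 1.
Let p := A - 1 - B.
Let s := B - A.
Let c := `|a| * expR `|a|.
(** The last quotient is the boundary term in the partial summation of d(n - G)/(beta e^v). Once it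
    is removed, what remains is the integral of (n - G)/(beta e^v), which is dominated by that of
    v^p. *)
Let Phi v := H v - M v - (n v - G v) / (beta * expR v).

Let power_cell v h : 1 <= v -> 0 < h <= 1 ->
  Num.max (v `^ a) ((v + h) `^ a) <= (1 + c * h) * Num.min (v `^ a) ((v + h) `^ a).
Proof.
move=> v1 /andP[h0 h1]; have v0 : 0 < v by lra.
have vh0 : 0 < v + h by lra.
have key x y : 0 < x -> 0 < y -> `|ln y - ln x| <= h -> y `^ a <= (1 + c * h) * x `^ a.
  move=> x0 y0 hl; rewrite !powR_pos // -ler_pdivrMr ?expR_gt0 // -expRB -mulrBr.
  have z : `|a * (ln y - ln x)| <= `|a| * h by rewrite normrM ler_wpM2l.
  have zz : `|a * (ln y - ln x)| <= `|a|.
    by apply: le_trans z _; rewrite ler_piMr.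
  have := le_trans (ler_norm _) (normr_expR_sub1 (a * (ln y - ln x))).
  have : `|a * (ln y - ln x)| * expR `|a * (ln y - ln x)| <= c * h.
    rewrite /c mulrAC; apply: ler_pM => //.
    by rewrite ler_expR.
  lra.
have l1 : `|ln (v + h) - ln v| <= h.
  rewrite ger0_norm; last by rewrite subr_ge0 ler_ln ?posrE //; lra.
  rewrite -ln_div ?posrE //.
  apply: le_trans (ln_le_subr1 _) _; first by rewrite divr_gt0.
  rewrite mulrDl divff ?gt_eqF // addrAC subrr add0r ler_pdivrMr //.
  by rewrite ler_peMr // ltW.
have l2 : `|ln v - ln (v + h)| <= h by rewrite distrC.
have c0 : 0 <= c * h by rewrite !mulr_ge0 ?expR_ge0 ?(ltW h0).
have f x : 0 <= x -> x <= (1 + c * h) * x by move=> x0; rewrite ler_peMl // lerDl.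
by rewrite ge_max !minEle; case: ifP => _; rewrite ?f ?powR_ge0 ?key.
Qed.

(** Discrete form of the fact that v^(-s)/s is a primitive of -v^(-s-1), with p = -s - 1; it
    supplies the psi of [telescoping_bound]. *)
Let potential_drop v h : 1 <= v -> 0 < h ->
  s * (h * (v + h) `^ p) <= v `^ (- s) - (v + h) `^ (- s).
Proof.
move=> v1 h0; have v0 : 0 < v by lra.
set y := v + h; have y0 : 0 < y by rewrite /y; lra.
have s0 : 0 < s by rewrite /s subr_gt0.
have -> : y `^ p = y `^ (- s) / y.
  have -> : p = - s - 1 by rewrite /p /s; ring.
  by rewrite powRB ?powRr1 ?(ltW y0) //; apply/implyP => _; rewrite gt_eqF.
suff : y `^ (- s) * (1 + s * (h / y)) <= v `^ (- s).
  have -> : s * (h * (y `^ (- s) / y)) = y `^ (- s) * (1 + s * (h / y)) - y `^ (- s) by ring.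
  by rewrite lerD2r.
rewrite !powR_pos //.
apply: (@le_trans _ _ (expR (- s * ln y) * expR (s * (h / y)))).
  by rewrite ler_pM2l ?expR_gt0 // expR_ge1Dx.
rewrite -expRD ler_expR.
have key : ln v - ln y <= - (h / y).
  rewrite -ln_div ?posrE //.
  apply: le_trans (ln_le_subr1 _) _; first by rewrite divr_gt0.
  have -> : v = y - h by rewrite /y addrK.
  by rewrite mulrBl divff ?gt_eqF // addrAC subrr add0r.
have := ler_wpM2l (ltW s0) key; rewrite mulrBr mulrN => k2.
rewrite !mulNr; lra.
Qed.

(** Three comparisons: H against n (weights 1/q vary by a factor e^h on the cell), G against M (the
    density varies by a factor 1 + O(h)), and the change of weight in the boundary term. The first
    two are O(h) times an increment of H or M and form the Theta of [telescoping_bound]; the third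
    is paid for by [potential_drop]. *)
Let Phi_step v h : V1 <= v -> 0 < h <= 1 ->
  `|Phi (v + h) - Phi v| <= h * (((4 * H (v + h)) + (2 + 3 * c) * M (v + h))
      - ((4 * H v) + (2 + 3 * c) * M v))
    + (4 * C1 / (beta * s) * v `^ (- s) - 4 * C1 / (beta * s) * (v + h) `^ (- s)).
Proof.
have a0 := alpha_gt0; have b0 := beta_gt0; have V11 := V1_ge1; have C10 := C1_gt0.
move=> hv h01; have /andP[h0 h1] := h01.
have v1 : 1 <= v by lra.
have v0 : 0 < v by lra.
have vh : V1 <= v + h by lra.
have vvh : v <= v + h by lra.
have s0 : 0 < s by rewrite /s subr_gt0.
have c0 : 0 <= c by rewrite /c mulr_ge0 ?expR_ge0.
set bv := beta * expR v.
have bv0 : 0 < bv by rewrite mulr_gt0 ?expR_gt0.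
have bvh : beta * expR (v + h) = bv * expR h by rewrite expRD mulrA.
have eh1 : h <= expR h - 1 by have := expR_ge1Dx h; lra.
have eh2 : expR h - 1 <= h + 2 * h ^+ 2 by have := @expR_leDxsqr _ h h1; lra.
have eh3 : expR h - 1 <= 4 * h by nra.
have eh0 := expR_gt0 h.
set dn := n (v + h) - n v; set dG := G (v + h) - G v.
set dH := H (v + h) - H v; set dM := M (v + h) - M v.
set e1 := n (v + h) - G (v + h); set e0 := n v - G v.
have T1 : `|dH - dn / bv| <= 4 * h * dH.
  have /andP[h2 h3] := H_cell hv vvh; rewrite -/dn -/dH -/bv bvh in h2 h3.
  have dH0 : 0 <= dH.
    apply: le_trans h2; rewrite divr_ge0 ?subr_ge0 ?n_nd //.
    by rewrite mulr_ge0 ?(ltW eh0) // ltW.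
  have h4 : dn / bv <= expR h * dH.
    rewrite invfM mulrA ler_pdivrMr // in h2; by rewrite [expR h * _]mulrC.
  rewrite ler0_norm; last by rewrite subr_le0.
  have := ler_wpM2r dH0 eh3; lra.
have T2 : `|dG / bv - dM| <= (2 + 3 * c) * h * dM.
  set lo := Num.min (v `^ a) ((v + h) `^ a); set hi := Num.max (v `^ a) ((v + h) `^ a).
  have lohi y : v <= y <= v + h -> lo <= y `^ (A - 1) <= hi by exact: powR_le_max.
  have hilo : hi <= (1 + c * h) * lo := power_cell v1 h01.
  have lo0 : 0 <= lo by rewrite le_min !powR_ge0.
  have := G_cell hv vvh lohi; rewrite -/dG.
  have -> : alpha * beta * (expR (v + h) - expR v) = alpha * (expR h - 1) * bv.
    by rewrite /bv expRD; ring.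
  rewrite ![_ * bv * _]mulrAC => /andP[g1 g2].
  have {}g1 : alpha * (expR h - 1) * lo <= dG / bv by rewrite ler_pdivlMr.
  have {}g2 : dG / bv <= alpha * (expR h - 1) * hi by rewrite ler_pdivrMr.
  have := M_cell hv vvh lohi; rewrite -/dM addrAC subrr add0r => /andP[m1 m2].
  have al0 : 0 <= alpha * lo by rewrite mulr_ge0 // ltW.
  have q1 : dG / bv - dM <= (2 + 3 * c) * h * (alpha * h * lo).
    have k1 : alpha * (expR h - 1) * hi <= alpha * lo * ((h + 2 * h ^+ 2) * (1 + c * h)).
      have -> : alpha * lo * ((h + 2 * h ^+ 2) * (1 + c * h)) =
        alpha * (h + 2 * h ^+ 2) * ((1 + c * h) * lo) by ring.
      apply: ler_pM => //; first by rewrite mulr_ge0 //; lra.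
        by rewrite le_max powR_ge0.
      by rewrite ler_pM2l.
    have k2 : (h + 2 * h ^+ 2) * (1 + c * h) <= h + (2 + 3 * c) * h ^+ 2.
      have : 0 <= c * h ^+ 2 * (1 - h) by rewrite !mulr_ge0 ?exprn_ge0 ?(ltW h0) ?subr_ge0.
      by nra.
    have := ler_wpM2l al0 k2; lra.
  have q2 : dM - dG / bv <= (2 + 3 * c) * h * (alpha * h * lo).
    have k1 : alpha * h * hi <= alpha * h * ((1 + c * h) * lo).
      by rewrite ler_pM2l // mulr_gt0.
    have k2 : alpha * h * lo <= alpha * (expR h - 1) * lo.
      by rewrite ler_wpM2r // ler_pM2l.
    have k3 : 0 <= (2 + 2 * c) * h * (alpha * h * lo).
      by rewrite !mulr_ge0 ?(ltW a0) ?(ltW h0) //; lra.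
    lra.
  have q3 : (2 + 3 * c) * h * (alpha * h * lo) <= (2 + 3 * c) * h * dM.
    by rewrite ler_wpM2l // mulr_ge0 ?(ltW h0) //; lra.
  rewrite ler_norml; apply/andP; split; lra.
have T3 : `|(e1 - e0) / bv - (e1 / (bv * expR h) - e0 / bv)| <=
    4 * C1 / (beta * s) * v `^ (- s) - 4 * C1 / (beta * s) * (v + h) `^ (- s).
  have -> : (e1 - e0) / bv - (e1 / (bv * expR h) - e0 / bv) =
     (e1 / (bv * expR h)) * (expR h - 1).
    by field; rewrite !gt_eqF.
  have := n_G vh; rewrite -/e1 => he.
  rewrite normrM (ger0_norm (_ : 0 <= expR h - 1)); last by lra.
  have k1 : `|e1 / (bv * expR h)| <= C1 / beta * (v + h) `^ p.
    rewrite normrM (gtr0_norm (_ : 0 < (bv * expR h)^-1)); last by rewrite invr_gt0 mulr_gt0.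
    have bh0 : 0 < bv * expR h by rewrite mulr_gt0.
    rewrite ler_pdivrMr //; apply: (le_trans he).
    rewrite -bvh le_eqVlt; apply/orP; left; apply/eqP; rewrite -/p; field.
    by rewrite gt_eqF.
  have k2 := potential_drop v1 h0.
  rewrite -mulrBr.
  apply: (@le_trans _ _ (C1 / beta * (v + h) `^ p * (4 * h))).
    by apply: ler_pM => //; lra.
  have -> : C1 / beta * (v + h) `^ p * (4 * h) =
    4 * C1 / (beta * s) * (s * (h * (v + h) `^ p)) by field; rewrite !gt_eqF.
  rewrite ler_wpM2l // divr_ge0 ?mulr_ge0 ?(ltW C10) ?(ltW b0) ?(ltW s0) //.
have -> : Phi (v + h) - Phi v = (dH - dn / bv) + (dG / bv - dM) +
   ((e1 - e0) / bv - (e1 / (bv * expR h) - e0 / bv)).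
  by rewrite /Phi bvh -/bv -/e1 -/e0 /dn /dG /dH /dM /e1 /e0; ring.
apply: le_trans (ler_normD _ _) _; apply: (lerD _ T3).
apply: le_trans (ler_normD _ _) _; apply: le_trans (lerD T1 T2) _.
by rewrite le_eqVlt; apply/orP; left; apply/eqP; rewrite /dH /dM; ring.
Qed.

Lemma harmonic_increment : exists2 C : R, 0 < C & forall v v', V1 <= v -> v <= v' ->
  `|(H v' - M v') - (H v - M v)| <= C * v `^ (A - B).
Proof.
have b0 := beta_gt0; have V11 := V1_ge1; have C10 := C1_gt0.
have s0 : 0 < s by rewrite /s subr_gt0.
have As : A - B = - s by rewrite /s; ring.
have ps : p = - s - 1 by rewrite /p /s; ring.
have Cb : 0 < C1 / beta by rewrite divr_gt0.
have Cs : 0 < 4 * C1 / (beta * s) by rewrite divr_gt0 ?mulr_gt0.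
exists (4 * C1 / (beta * s) + 2 * (C1 / beta)); first by lra.
move=> v v' hv vv'; have hv' : V1 <= v' by lra.
have T := telescoping_bound (psi := fun v => 4 * C1 / (beta * s) * v `^ (- s))
  (Theta := fun v => 4 * H v + (2 + 3 * c) * M v) Phi_step hv vv'.
have e x : v <= x -> `|(n x - G x) / (beta * expR x)| <= C1 / beta * v `^ (- s).
  move=> vx; have hx : V1 <= x by lra.
  have bx : 0 < beta * expR x by rewrite mulr_gt0 ?expR_gt0.
  rewrite normrM (gtr0_norm (_ : 0 < (beta * expR x)^-1)) ?invr_gt0 //.
  rewrite ler_pdivrMr //; apply: le_trans (n_G hx) _.
  have -> : C1 / beta * v `^ (- s) * (beta * expR x) = C1 * expR x * v `^ (- s).
    by field; rewrite gt_eqF.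
  rewrite ler_wpM2l ?mulr_ge0 ?expR_ge0 ?(ltW C10) //.
  apply: (@le_trans _ _ (v `^ p)); first by apply: powR_nonpos_le; lra.
  by apply: ler_powR; lra.
have -> : (H v' - M v') - (H v - M v) = (Phi v' - Phi v) +
   ((n v' - G v') / (beta * expR v') - (n v - G v) / (beta * expR v)).
  by rewrite /Phi; ring.
have pv' : 0 <= v' `^ (- s) by exact: powR_ge0.
rewrite As; apply: le_trans (ler_normD _ _) _.
have := e v' vv'; have := e v (lexx v).
have := ler_normB ((n v' - G v') / (beta * expR v')) ((n v - G v) / (beta * expR v)).
have := mulr_ge0 (ltW Cs) pv'.
move: T => /=; lra.
Qed.

End HarmonicSum.

(** * The tail integral of f_Y *)

Section EtaIntegral.
Context {R : realType}.
Notation mu := (@lebesgue_measure R).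
Implicit Types (a b t x : R).

(** Majorant of f_Y(x)/x^2 up to a constant, with the explicit primitive [anti]. The shift by 1
    makes it regular on [0, +oo[ while keeping the decay 1/(x (ln x)^2) that [logmgf_tail] gives. *)
Let maj x : R := ((1 + x) * (1 + ln (1 + x)) ^+ 2)^-1.
Let anti x : R := - (1 + ln (1 + x))^-1.

Let ln1x_ge0 x : 0 <= x -> 0 <= ln (1 + x).
Proof. by move=> x0; rewrite ln_ge0 // lerDl. Qed.

Let is_derive_anti x : 0 <= x -> is_derive x (1 : R) anti (maj x).
Proof.
move=> x0; have l0 := ln1x_ge0 x0.
have x1 : 0 < 1 + x by lra.
have d0 : is_derive x (1 : R) (fun y : R => 1 + y) 1.
  have := is_deriveD (is_derive_cst (1 : R) x 1) (is_derive_id x (1 : R)).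
  by rewrite add0r.
have d1 : is_derive x (1 : R) (fun y => ln (1 + y)) ((1 + x)^-1).
  have := @is_derive1_comp _ (@ln R) (fun y => 1 + y) x _ _ (is_derive1_ln x1) d0.
  by rewrite mulr1.
have d2 : is_derive x (1 : R) (fun y => 1 + ln (1 + y)) ((1 + x)^-1).
  by have := is_deriveD (is_derive_cst (1 : R) x 1) d1; rewrite add0r.
have nz : 1 + ln (1 + x) != 0 by rewrite gt_eqF //; lra.
have := is_deriveN (@is_deriveV R (fun y => 1 + ln (1 + y)) x _ _ nz d2).
have -> // : - (- (1 + ln (1 + x)) ^- 2 *: (1 + x)^-1) = maj x.
by rewrite /maj scaleNr opprK [RHS]invfM [RHS]mulrC.
Qed.

Let cvg_anti : anti x @[x --> +oo] --> (0 : R).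
Proof.
rewrite -oppr0; apply: cvgN.
apply/cvgrPdist_le => e e0; near=> x.
rewrite sub0r normrN.
have x0 : 0 <= x by near: x; apply: nbhs_pinfty_ge; rewrite num_real.
have l0 := ln1x_ge0 x0.
rewrite gtr0_norm; last by rewrite invr_gt0; lra.
rewrite -[leRHS]invrK lef_pV2 ?posrE ?invr_gt0 //; last by lra.
have : expR e^-1 <= 1 + x.
  rewrite -lerBlDl; near: x; apply: nbhs_pinfty_ge; exact: num_real.
move=> h; have : e^-1 <= ln (1 + x).
  by rewrite -[leLHS]expRK ler_ln ?posrE ?expR_gt0 //; lra.
lra.
Unshelve. all: by end_near. Qed.

Let maj_ge0 x : 0 <= x -> 0 <= maj x.
Proof. by move=> x0; rewrite /maj invr_ge0 mulr_ge0 ?exprn_ge0 ?addr_ge0 ?ln1x_ge0. Qed.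

Let continuous_maj x : 0 <= x -> {for x, continuous maj}.
Proof.
move=> x0; have l0 := ln1x_ge0 x0.
rewrite /maj; apply: cvgV; first by rewrite gt_eqF // mulr_gt0 ?exprn_gt0; lra.
have c1 : {for x, continuous (fun y : R => 1 + y)}.
  by apply: cvgD; [exact: cvg_cst|exact: cvg_id].
have c2 : {for x, continuous (fun y : R => ln (1 + y))}.
  have x1 : 0 < 1 + x by lra.
  exact: (@continuous_comp R R R (fun y => 1 + y) (@ln R) x c1 (continuous_ln x1)).
apply: cvgM => //; rewrite expr2; under eq_fun do rewrite expr2.
by apply: cvgM; apply: cvgD => //; exact: cvg_cst.
Qed.

Let integral_maj a : 0 <= a ->
  (\int[mu]_(x in `[a, +oo[) (maj x)%:E = ((1 + ln (1 + a))^-1)%:E)%E.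
Proof.
move=> a0; rewrite (@ge0_continuous_FTC2y _ maj anti a 0).
- by rewrite /anti sub0e -EFinN opprK.
- by move=> x ax; apply: maj_ge0; lra.
- apply: continuous_in_subspaceT => x; rewrite inE /= in_itv /= andbT => ax.
  by apply: continuous_maj; lra.
- exact: cvg_anti.
- move=> x ax; have x0 : 0 <= x by lra.
  by have [] := is_derive_anti x0.
- have [d _] := @is_derive_anti a a0.
  apply: cvg_at_right_filter.
  by move: d => /derivable1_diffP/differentiable_continuous.
- move=> x; rewrite in_itv /= andbT => ax.
  have x0 : 0 <= x by lra.
  by rewrite derive1E; have [] := is_derive_anti x0.
Qed.

Let integrable_maj a : 0 <= a -> mu.-integrable `[a, +oo[ (EFin \o maj).
Proof.
move=> a0; apply/integrableP; split.
  apply/measurable_EFinP; apply: subspace_continuous_measurable_fun => //.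
  apply: continuous_in_subspaceT => x; rewrite inE /= in_itv /= andbT => ax.
  by apply: continuous_maj; lra.
suff -> : (\int[mu]_(x in `[a, +oo[) `|(EFin \o maj) x| = ((1 + ln (1 + a))^-1)%:E)%E.
  exact: ltry.
rewrite -integral_maj //; apply: eq_integral => x; rewrite inE /= in_itv /= andbT => ax /=.
by rewrite ger0_norm // maj_ge0 //; lra.
Qed.

Variables (C0 : R) (g : R -> R).
Hypotheses (C0_ge0 : 0 <= C0) (hg : logmgf_like C0 g).

Definition fcut t : R := if t < 1 then g t else g t - t.

Let Cm := 16 + 8 * C0.

Let ln_maj t : 0 <= t -> 0 < (1 + t) * (1 + ln (1 + t)) ^+ 2.
Proof. by move=> t0; rewrite mulr_gt0 ?exprn_gt0 // ltr_pwDl ?ln1x_ge0. Qed.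

Lemma fcut_div_le2 t : 0 <= t < 1 -> `|fcut t / t ^+ 2| <= 2.
Proof.
move=> /andP[t0 t1]; rewrite /fcut t1.
move: t0; rewrite le_eqVlt => /predU1P[<-|t0].
  by rewrite expr0n /= invr0 mulr0 normr0.
have h : 0 <= t <= 1 by rewrite !ltW.
have t2 : 0 < t ^+ 2 by rewrite exprn_gt0.
rewrite ger0_norm; last by rewrite divr_ge0 ?(ltW t2) // (logmgf_ge0 hg) // ltW.
by rewrite ler_pdivrMr // (logmgf_le_sqr hg).
Qed.

Lemma normr_fcut_le t : 1 <= t -> `|fcut t| <= C0 * t / (1 + ln t) ^+ 2.
Proof.
move=> t1; rewrite /fcut ltNge t1 /= ler0_norm.
  by rewrite lerNl (logmgf_tail hg).
by have := logmgf_le hg (le_trans ler01 t1); lra.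
Qed.

Let fcut_maj t : 0 <= t -> `|fcut t / t ^+ 2| <= Cm * maj t.
Proof.
have C00 := C0_ge0; move=> t0; have l0 := ln1x_ge0 t0; have m0 := ln_maj t0.
have [t1|t1] := ltP t 1.
  apply: (@le_trans _ _ 2); first by rewrite fcut_div_le2 // t0.
  rewrite /maj ler_pdivlMr // /Cm.
  have lt : ln (1 + t) <= t by apply: le_trans (ln_le_subr1 _) _; lra.
  have k1 : (1 + ln (1 + t)) ^+ 2 <= 2 ^+ 2 by rewrite lerXn2r ?nnegrE; lra.
  have k2 : (1 + t) * (1 + ln (1 + t)) ^+ 2 <= 2 * 2 ^+ 2.
    by apply: ler_pM; rewrite ?exprn_ge0; lra.
  lra.
have tp : 0 < t by lra.
have lt0 : 0 <= ln t by rewrite ln_ge0.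
have D0 : 0 < (1 + ln t) ^+ 2 by rewrite exprn_gt0 //; lra.
have h1 : `|fcut t / t ^+ 2| <= C0 / (t * (1 + ln t) ^+ 2).
  rewrite normrM (gtr0_norm (_ : 0 < (t ^+ 2)^-1)) ?invr_gt0 ?exprn_gt0 //.
  rewrite ler_pdivrMr ?exprn_gt0 //; apply: le_trans (normr_fcut_le t1) _.
  by rewrite le_eqVlt; apply/orP; left; apply/eqP; field; rewrite !gt_eqF //; lra.
apply: le_trans h1 _.
have k1 : 1 + ln (1 + t) <= 2 * (1 + ln t).
  have : ln (1 + t) <= ln (2 * t) by rewrite ler_ln ?posrE //; lra.
  rewrite lnM ?posrE // => h; have : ln 2 <= 1 :> R by apply: le_trans (ln_le_subr1 _) _; lra.
  lra.
have k2 : (1 + ln (1 + t)) ^+ 2 <= (2 * (1 + ln t)) ^+ 2 by rewrite lerXn2r ?nnegrE //; lra.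
have k3 : (1 + t) * (1 + ln (1 + t)) ^+ 2 <= 2 * t * (2 * (1 + ln t)) ^+ 2.
  by apply: ler_pM; rewrite ?exprn_ge0; lra.
have k4 : C0 / (t * (1 + ln t) ^+ 2) = 8 * C0 / (2 * t * (2 * (1 + ln t)) ^+ 2).
  by field; rewrite !gt_eqF //; lra.
rewrite k4 /maj; apply: ler_pM.
- by lra.
- by rewrite invr_ge0 mulr_ge0 ?exprn_ge0 //; lra.
- by rewrite /Cm; lra.
by rewrite lef_pV2 ?posrE // mulr_gt0 ?exprn_gt0 //; lra.
Qed.

(** Scaling by y/x >= 1 together with nonnegativity. Monotonicity is the source of measurability
    here, since [logmgf_like] states only inequalities. *)
Let g_homo x y : 0 <= x -> x <= y -> g x <= g y.
Proof.
move=> x0 xy; move: (x0); rewrite le_eqVlt => /predU1P[x00|xp].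
  have g0 : g 0 <= 0 by have := logmgf_le hg (lexx 0).
  by rewrite -x00 in xy *; apply: le_trans g0 _; exact: (logmgf_ge0 hg).
have l1 : 1 <= y / x by rewrite ler_pdivlMr // mul1r.
have := logmgf_scale hg l1 x0; rewrite divfK ?gt_eqF // => h.
by apply: le_trans h; rewrite ler_peMl // (logmgf_ge0 hg).
Qed.

Let measurable_fcut : measurable_fun `[(0 : R), +oo[ (fun t => fcut t / t ^+ 2).
Proof.
(* Freezing g at its value in 0 for negative arguments makes it nondecreasing on the whole line. *)
pose gm t := g (Num.max t 0).
have mg : measurable_fun setT gm.
  apply: nondecreasing_measurable => // x y xy; apply: g_homo.
    by rewrite le_max lexx orbT.
  by rewrite ge_max !le_max xy lexx orbT.
apply: (eq_measurable_fun (fun t => (if t < 1 then gm t else gm t - t) * t `^ (- 2%:R))).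
  move=> t; rewrite inE /= in_itv /= andbT => t0.
  by rewrite /fcut /gm max_l // powR_invn.
apply: measurable_funTS; apply: measurable_funM.
  apply: measurable_fun_ifT => //; first exact: measurable_fun_ltr.
  exact: measurable_funB.
exact: measurable_powR.
Qed.

Lemma integrable_fcut : mu.-integrable `[0, +oo[ (EFin \o (fun t => fcut t / t ^+ 2)).
Proof.
have im := integrable_maj (lexx 0).
have imC : mu.-integrable `[0, +oo[ (EFin \o (fun x => Cm * maj x)).
  have : mu.-integrable `[0, +oo[ (fun y => (Cm%:E * (EFin \o maj) y)%E).
    by apply: integrableZl im; exact: measurable_itv.
  by apply: eq_integrable => //; exact: measurable_itv.
apply: le_integrable imC => //; first exact/measurable_EFinP.
move=> x /=; rewrite in_itv /= andbT => x0; rewrite lee_fin.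
by apply: le_trans (fcut_maj x0) _; exact: ler_norm.
Qed.

(** At 0 and for [g = lmgf P' Y] this is convertible to [etaY P' Y]. *)
Definition eta_tail x : R := \int[mu]_(t in `[x, +oo[) (fcut t / t ^+ 2).

Let integrable_fcutS (D : set R) : measurable D -> D `<=` `[(0 : R), +oo[%classic ->
  mu.-integrable D (EFin \o (fun t => fcut t / t ^+ 2)).
Proof.
by move=> mD sD; apply: (integrableS _ _ _ integrable_fcut) => //; exact: measurable_itv.
Qed.

Lemma eta_tail_le x : 0 <= x -> `|eta_tail x| <= Cm / (1 + ln (1 + x)).
Proof.
move=> x0.
have ix : mu.-integrable `[x, +oo[ (EFin \o (fun t => fcut t / t ^+ 2)).
  by apply: integrable_fcutS => //; apply: subset_itvr; rewrite bnd_simp.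
have iM : mu.-integrable `[x, +oo[ (EFin \o (fun y => Cm * maj y)).
  have im := integrable_maj x0.
  have : mu.-integrable `[x, +oo[ (fun y => (Cm%:E * (EFin \o maj) y)%E).
    by apply: integrableZl im; exact: measurable_itv.
  by apply: eq_integrable => //; exact: measurable_itv.
apply: le_trans (le_normr_Rintegral _ ix) _; first exact: measurable_itv.
have -> : Cm / (1 + ln (1 + x)) = \int[mu]_(t in `[x, +oo[) (Cm * maj t).
  have im := integral_maj x0.
  rewrite RintegralZl //; last exact: integrable_maj.
  by rewrite /Rintegral im.
apply: le_Rintegral => //; first by have := integrable_norm ix.
move=> t /=; rewrite in_itv /= andbT => xt; apply: fcut_maj; lra.
Qed.

Lemma eta_tailB a b : 0 <= a -> a <= b ->
  eta_tail a - eta_tail b = \int[mu]_(t in `[a, b[) (fcut t / t ^+ 2).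
Proof.
move=> a0 ab; rewrite /eta_tail.
have -> : `[a, +oo[%classic = `[a, b[%classic `|` `[b, +oo[%classic :> set R.
  by apply: itv_bndbnd_setU; rewrite bnd_simp.
have ia : mu.-integrable (`[a, b[%classic `|` `[b, +oo[%classic)
    (EFin \o (fun t => fcut t / t ^+ 2)).
  apply: integrable_fcutS; first by apply: measurableU; exact: measurable_itv.
  move=> t /= []; rewrite !in_itv /= ?andbT; first by move=> /andP[at_ _]; lra.
  by move=> bt; lra.
rewrite Rintegral_setU // ?addrK //.
apply/disj_set2P; rewrite -subset0 => t /= []; rewrite !in_itv /= andbT.
by move=> /andP[_ tb] bt; lra.
Qed.

Lemma eta_tail0B x : 0 <= x <= 1 -> `|eta_tail 0 - eta_tail x| <= 2 * x.
Proof.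
move=> /andP[x0 x1]; rewrite eta_tailB // -[X in 2 * X]subr0.
apply: (@normr_Rintegral_itv_le _ true true) => //.
  apply: measurable_funS measurable_fcut; first exact: measurable_itv.
  by apply: subset_itvl.
move=> t /=; rewrite in_itv /= => /andP[t0 tx]; rewrite fcut_div_le2 // t0 /=; lra.
Qed.

End EtaIntegral.

(** * Riemann sums for eta on logarithmic cells *)

Section EtaCells.
Context {R : realType}.
Variables (C0 : R) (g : R -> R).
Hypotheses (C0_ge0 : 0 <= C0) (hg : logmgf_like C0 g).

(** Right of w means q_n > beta e^w, that is arguments b = e^(-x) <= 1. On the cell f/t^2 stays
    within O(h) of g(b)/b^2, by [logmgf_lip] from below and monotonicity from above, and the length
    is b h up to O(b h^2). *)
Lemma eta_cell_right (b h : R) : 0 < b <= 1 -> 0 < h <= 1 ->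
  `|eta_tail g (b * expR (- h)) - eta_tail g b - h * (g b / b)| <= 68 * h ^+ 2 * b.
Proof.
have C00 := C0_ge0.
move=> /andP[b0 b1] /andP[h0 h1].
have eh0 := expR_gt0 (- h).
have eh1 : expR (- h) <= 1 by rewrite expR_le1; lra.
have eh2 : 1 - h <= expR (- h) by have := expR_ge1Dx (- h); lra.
have eh3 : expR (- h) <= 1 - h + 2 * h ^+ 2.
  by have := @expR_leDxsqr _ (- h); rewrite sqrrN; lra.
have e2h : expR (2 * h) - 1 <= 32 * h.
  have := expR_sub1_le (2 * h).
  have : expR (2 * h) <= 16.
    have -> : 2 * h = h + h by lra.
    rewrite expRD; have -> : 16 = 4 * 4 :> R by lra.
    have h4 : expR h <= 4 by apply: le_trans expR1_le4; rewrite ler_expR.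
    by apply: ler_pM; rewrite ?expR_ge0.
  by nra.
set b' := b * expR (- h).
have b'0 : 0 < b' by rewrite mulr_gt0.
have b'b : b' <= b by rewrite /b' ler_piMr // ltW.
rewrite (eta_tailB C0_ge0 hg (ltW b'0) b'b).
have gb0 : 0 <= g b by rewrite (logmgf_ge0 hg) // ltW.
have gb2 : g b <= 2 * b ^+ 2 by rewrite (logmgf_le_sqr hg) // ltW.
have b20 : 0 < b ^+ 2 by rewrite exprn_gt0.
set G := g b / b ^+ 2.
have G0 : 0 <= G by rewrite divr_ge0 // ltW.
have G2 : G <= 2 by rewrite ler_pdivrMr.
have pt t : b' <= t < b -> G - 8 * h <= fcut g t / t ^+ 2 <= G + 64 * h.
  move=> /andP[bt tb]; have t0 : 0 < t by lra.
  have t1 : t < 1 by lra.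
  have t20 : 0 < t ^+ 2 by rewrite exprn_gt0.
  rewrite /fcut t1.
  have gt0 : 0 <= g t by rewrite (logmgf_ge0 hg) // ltW.
  have tb2 : t ^+ 2 <= b ^+ 2 by rewrite lerXn2r ?nnegrE // ltW.
  have lip : g b <= g t + 8 * b * (b - t) by apply: (logmgf_lip hg) => //; lra.
  have bth : b - t <= b * h.
    have : b * (1 - h) <= b' by rewrite /b' ler_pM2l.
    lra.
  apply/andP; split.
    rewrite ler_pdivlMr //.
    have k1 : g b - 8 * h * b ^+ 2 <= g t.
      have : 8 * b * (b - t) <= 8 * b * (b * h) by rewrite ler_pM2l //; lra.
      by lra.
    have [k2|k2] := leP (G - 8 * h) 0.
      by apply: le_trans gt0; rewrite mulr_le0_ge0 // ltW.
    apply: (@le_trans _ _ ((G - 8 * h) * b ^+ 2)); first by rewrite ler_pM2l.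
    by rewrite mulrBl /G divfK ?gt_eqF.
  rewrite ler_pdivrMr //.
  have gtb : g t <= g b.
    have l1 : 1 <= b / t by rewrite ler_pdivlMr // mul1r ltW.
    have := logmgf_scale hg l1 (ltW t0); rewrite divfK ?gt_eqF // => k.
    by apply: le_trans k; rewrite ler_peMl.
  have bt2 : b ^+ 2 <= t ^+ 2 * expR (2 * h).
    have -> : 2 * h = h + h by lra.
    rewrite expRD -expr2 -exprMn lerXn2r ?nnegrE ?mulr_ge0 ?expR_ge0 ?(ltW t0) ?(ltW b0) //.
    rewrite -[b]mulr1 -(expRxMexpNx_1 h) [expR h * _]mulrC mulrA.
    by rewrite ler_pM2r ?expR_gt0.
  have gbG : g b = G * b ^+ 2 by rewrite /G divfK // gt_eqF.
  apply: (le_trans gtb); rewrite gbG.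
  apply: (@le_trans _ _ (G * (t ^+ 2 * expR (2 * h)))); first by rewrite ler_wpM2l.
  rewrite mulrCA [leRHS]mulrC ler_pM2l //.
  have : G * (expR (2 * h) - 1) <= 2 * (32 * h) by apply: ler_pM => //; have := expR_ge1Dx (2 * h); lra.
  lra.
have len : b - b' <= b * h.
  have : b * (1 - h) <= b' by rewrite /b' ler_pM2l.
  lra.
have len0 : 0 <= b - b' by lra.
have len2 : b * h - 2 * b * h ^+ 2 <= b - b'.
  have : b' <= b * (1 - h + 2 * h ^+ 2) by rewrite /b' ler_pM2l.
  lra.
have int : (@lebesgue_measure R).-integrable `[b', b[ (EFin \o (fun t => fcut g t / t ^+ 2)).
  apply: (integrableS _ _ _ (integrable_fcut C0_ge0 hg)) => //; try exact: measurable_itv.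
  by move=> t /=; rewrite !in_itv /= andbT => /andP[bt _]; lra.
have up : \int[lebesgue_measure]_(t in `[b', b[) (fcut g t / t ^+ 2) <= (G + 64 * h) * (b - b').
  by apply: Rintegral_itv_le => // t /=; rewrite in_itv /= => /pt /andP[].
have lo : (G - 8 * h) * (b - b') <= \int[lebesgue_measure]_(t in `[b', b[) (fcut g t / t ^+ 2).
  by apply: Rintegral_itv_ge => // t /=; rewrite in_itv /= => /pt /andP[].
move: up lo; set I := \int[_]_(_ in _) _ => up lo.
have -> : h * (g b / b) = G * (b * h) by rewrite /G; field; rewrite gt_eqF.
have hb : 0 <= b * h ^+ 2 by rewrite mulr_ge0 ?exprn_ge0 // ltW.
have u1 : (G + 64 * h) * (b - b') <= (G + 64 * h) * (b * h) by rewrite ler_wpM2l //; lra.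
have l1 : G * (b * h - 2 * b * h ^+ 2) <= G * (b - b') by rewrite ler_wpM2l.
have l2 : 8 * h * (b - b') <= 8 * h * (b * h) by rewrite ler_wpM2l //; lra.
have l3 : G * (b * h ^+ 2) <= 2 * (b * h ^+ 2) by rewrite ler_wpM2r.
by rewrite ler_norml; apply/andP; split; lra.
Qed.

(** Scaling below, [logmgf_decr] above. The two bounds differ by the factor t/b, so no regularity of
    g beyond these is required for arguments at least 1. *)
Lemma fcut_le_of_ge (t b : R) : 1 <= b -> b <= t ->
  t / b * (g b - b) <= g t - t <= g b - b.
Proof.
move=> b1 bt; have b0 : 0 < b by lra.
apply/andP; split; last by apply: (logmgf_decr hg); lra.
have l1 : 1 <= t / b by rewrite ler_pdivlMr // mul1r.
have := logmgf_scale hg l1 (ltW b0); rewrite mulrBr divfK ?gt_eqF //; lra.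
Qed.

(** Counterpart for b >= 1. The error is kept proportional to |g b - b|/b, because only this
    quantity, of size 1/(1 + ln b)^2, is summable over the cells. *)
Lemma eta_cell_left (b h : R) : 1 <= b -> 0 < h <= 1 ->
  `|eta_tail g b - eta_tail g (b * expR h) - h * ((g b - b) / b)|
    <= 10 * h ^+ 2 * (`|g b - b| / b).
Proof.
have C00 := C0_ge0.
move=> b1 /andP[h0 h1].
have b0 : 0 < b by lra.
have eh0 := expR_gt0 h.
have eh1 : h <= expR h - 1 by have := expR_ge1Dx h; lra.
have eh2 : expR h - 1 <= h + 2 * h ^+ 2 by have := @expR_leDxsqr _ h h1; lra.
have eh3 : expR h - 1 <= 4 * h by nra.
have eh4 : 1 <= expR h by lra.
set b' := b * expR h.
have bb' : b <= b' by rewrite /b' ler_peMr // ltW.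
rewrite (eta_tailB C0_ge0 hg (ltW b0) bb').
set f := g b - b.
have f0 : f <= 0 by have := logmgf_le hg (ltW b0); rewrite /f; lra.
rewrite (ler0_norm f0).
have b20 : 0 < b ^+ 2 by rewrite exprn_gt0.
set F := - f / b ^+ 2.
have F0 : 0 <= F by rewrite divr_ge0 ?(ltW b20) //; lra.
have pt t : b <= t < b' -> - F <= fcut g t / t ^+ 2 <= - F * (1 - 2 * h).
  move=> /andP[bt tb]; have t0 : 0 < t by lra.
  have t1 : (t < 1) = false by apply/negbTE; rewrite -leNgt; lra.
  rewrite /fcut t1; have t20 : 0 < t ^+ 2 by rewrite exprn_gt0.
  have /andP[k1 k2] := fcut_le_of_ge b1 bt; rewrite -/f in k1 k2.
  have fF : f = - F * b ^+ 2 by rewrite /F mulNr divfK ?gt_eqF // opprK.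
  apply/andP; split.
    rewrite ler_pdivlMr //; apply: le_trans k1; rewrite fF.
    have -> : t / b * (- F * b ^+ 2) = - F * (t * b) by field; rewrite gt_eqF.
    by rewrite ler_wnM2l //; [lra|rewrite expr2 ler_pM2l].
  rewrite ler_pdivrMr //; apply: (le_trans k2); rewrite fF.
  rewrite -mulrA ler_wnM2l //; first by lra.
  have k3 : t ^+ 2 * expR (- (2 * h)) <= b ^+ 2.
    have -> : - (2 * h) = - h + - h by lra.
    rewrite expRD -expr2 -exprMn lerXn2r ?nnegrE ?mulr_ge0 ?expR_ge0 ?(ltW t0) ?(ltW b0) //.
    rewrite expRN ler_pdivrMr ?expR_gt0 //; exact: ltW.
  apply: le_trans k3; rewrite mulrC ler_pM2l //.
  by have := expR_ge1Dx (- (2 * h)); lra.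
have int : (@lebesgue_measure R).-integrable `[b, b'[ (EFin \o (fun t => fcut g t / t ^+ 2)).
  apply: (integrableS _ _ _ (integrable_fcut C0_ge0 hg)) => //; try exact: measurable_itv.
  by move=> t /=; rewrite !in_itv /= andbT => /andP[bt _]; lra.
have up : \int[lebesgue_measure]_(t in `[b, b'[) (fcut g t / t ^+ 2) <= - F * (1 - 2 * h) * (b' - b).
  by apply: Rintegral_itv_le => // t /=; rewrite in_itv /= => /pt /andP[].
have lo : - F * (b' - b) <= \int[lebesgue_measure]_(t in `[b, b'[) (fcut g t / t ^+ 2).
  by apply: Rintegral_itv_ge => // t /=; rewrite in_itv /= => /pt /andP[].
move: up lo; set I := \int[_]_(_ in _) _ => up lo.
have e1 : - f / b = F * b by rewrite /F; field; rewrite gt_eqF.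
have e2 : f / b = - (F * b) by rewrite -e1 mulNr opprK.
rewrite e1 e2.
have len : b' - b = b * (expR h - 1) by rewrite /b'; ring.
have Fb : 0 <= F * b by rewrite mulr_ge0 // ltW.
rewrite len in up lo.
have m1 : F * b * h <= F * b * (expR h - 1) by rewrite ler_wpM2l.
have m2 : F * b * (expR h - 1) <= F * b * (h + 2 * h ^+ 2) by rewrite ler_wpM2l.
have m3 : 2 * h * (F * b * (expR h - 1)) <= 2 * h * (F * b * (4 * h)).
  by rewrite ler_wpM2l ?ler_wpM2l //; lra.
have m4 : 0 <= F * b * h ^+ 2 by rewrite mulr_ge0 // exprn_ge0 // ltW.
by rewrite ler_norml; apply/andP; split; lra.
Qed.

End EtaCells.

Lemma cell_sum (R : realType) (F : nat -> R) (a b : nat) (f e : R) : (a <= b)%N ->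
  (forall n, (a <= n < b)%N -> `|F n - f| <= e) ->
  `|\sum_(n < b) F n - \sum_(n < a) F n - f * (b%:R - a%:R)| <= e * (b%:R - a%:R).
Proof.
move=> ab h.
rewrite -!(big_mkord xpredT F) (big_cat_nat (leq0n a) ab) /= [X in X - _ - _]addrC addrK.
have ba : b%:R - a%:R = \sum_(a <= n < b) 1 :> R.
  by rewrite big_const_nat iter_addr_0 -natrB.
rewrite ba !mulr_sumr -sumrB; apply: le_trans (ler_norm_sum _ _ _) _.
rewrite big_nat_cond [leRHS]big_nat_cond; apply: ler_sum => n /andP[hn _].
by rewrite !mulr1; apply: h.
Qed.

Lemma grid_telescoping (R : realType) (T P : R -> R) (h : R) (J : nat) :
  (forall j, (j < J)%N -> `|T (j.+1%:R * h) - T (j%:R * h)| <= P (j.+1%:R * h) - P (j%:R * h)) ->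
  `|T (J%:R * h) - T 0| <= P (J%:R * h) - P 0.
Proof.
elim: J => [_|J IH H]; first by rewrite mul0r !subrr normr0.
have := IH (fun j jJ => H j (ltnW jJ)); have := H J (ltnSn J).
move: (T _) (T (J%:R * h)) (P _) (P (J%:R * h)) => x y z t h1 h2.
have -> : x - T 0 = (x - y) + (y - T 0) by ring.
by apply: le_trans (ler_normD _ _) _; lra.
Qed.

(* [N v] counts the q_n up to beta e^v; [Psi] is the expansion of H there. *)
Record regular_count (R : realType) (alpha beta A B : R) (q : nat -> R)
    (N : R -> nat) (Psi : R -> R) (V1 Cc Ch : R) : Prop := RegularCount {
  rc_q_ge1 : forall n, 1 <= q n;
  rc_countE : forall v n, V1 / 2 <= v -> (n < N v)%N = (q n <= beta * expR v);
  rc_cell : forall w x h : R, V1 <= w -> - (w / 2) <= x -> 0 < h <= 1 ->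
    `|(N (w + x + h))%:R - (N (w + x))%:R
      - alpha * beta * (expR (w + x) * w `^ (A - 1) * h)|
     <= Cc * (expR (w + x) * w `^ (A - 1) * expR (Num.max x 0 / 4)
         * (h ^+ 2 + h * `|x| / w + (w `^ B)^-1));
  rc_harmonic : forall v, V1 / 2 <= v ->
    `|\sum_(n < N v) (q n)^-1 - Psi v| <= Ch * v `^ (A - B);
  rc_index : forall w, V1 <= w -> expR (w / 4) <= (N (w / 2))%:R }.

(** A primitive of alpha y^(A-1); at v = ln (y / beta) it is the term that [is_constA] subtracts
    from H. *)
Definition main_term (R : realType) (alpha A v : R) : R :=
  if A == 0 then alpha * ln v else alpha / A * v `^ A.

Lemma sum_ordB (V : zmodType) (F : nat -> V) (a b : nat) : (a <= b)%N ->
  \sum_(n < b) F n - \sum_(n < a) F n = \sum_(a <= n < b) F n.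
Proof.
move=> ab; rewrite -!(big_mkord xpredT F) (big_cat_nat (leq0n a) ab) /=.
by rewrite [X in X - _]addrC addrK.
Qed.

Section RegularCount.
Context {R : realType}.

Lemma main_term_cell (alpha A v v' lo hi : R) : 0 < alpha -> 0 < v -> v <= v' ->
  (forall y, v <= y <= v' -> lo <= y `^ (A - 1) <= hi) ->
  alpha * (v' - v) * lo <= main_term alpha A v' - main_term alpha A v
    <= alpha * (v' - v) * hi.
Proof.
move=> a0 v0 vv' hy.
suff [y /hy /andP[y1 y2] ->] : exists2 y, v <= y <= v' &
    main_term alpha A v' - main_term alpha A v = alpha * (v' - v) * y `^ (A - 1).
  have d0 : 0 <= alpha * (v' - v) by rewrite mulr_ge0 ?subr_ge0 // ltW.
  by rewrite !ler_wpM2l.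
rewrite /main_term; case: eqVneq => [A0|A0].
  have [||y yv e] := @MVT_segment R (@ln R) (fun x => x^-1) v v' vv'.
  - move=> x; rewrite in_itv /= => /andP[vx _]; apply: is_derive1_ln; lra.
  - apply: continuous_in_subspaceT => x; rewrite inE /= in_itv /= => /andP[vx _].
    by apply: continuous_ln; lra.
  exists y; first by move: yv; rewrite in_itv.
  have y0 : 0 < y by move: yv; rewrite in_itv /= => /andP[vy _]; lra.
  by rewrite -mulrBr e A0 sub0r powR_inv1 ?(ltW y0) //; ring.
have [||y yv e] := @MVT_segment R (fun x => x `^ A) (fun x => A * x `^ (A - 1)) v v' vv'.
- move=> x; rewrite in_itv /= => /andP[vx _]; apply: is_derive1_powR; lra.
- apply: continuous_in_subspaceT => x; rewrite inE /= in_itv /= => /andP[vx _].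
  have x0 : 0 < x by lra.
  have [d _] := is_derive1_powR A x0.
  by move: d => /derivable1_diffP/differentiable_continuous.
exists y; first by move: yv; rewrite in_itv.
by rewrite -mulrBr e; field.
Qed.

Lemma regular_count_exists (alpha beta A B : R) (q : nat -> R) (CA : R) :
  0 < alpha -> 0 < beta -> 0 <= A -> Num.max A 1 < B ->
  is_sequenceA alpha beta A B q -> is_constA alpha beta A q CA ->
  exists V1 Cc Ch : R, [/\ 2 <= V1, 0 < Cc, 0 < Ch &
   (forall y, beta * expR (V1 / 2) <= y -> upto q y = `I_(qcount q y)) /\
   regular_count alpha beta A B q (fun v => qcount q (beta * expR v))
     (fun v => CA + main_term alpha A v) V1 Cc Ch].
Proof.
move=> a0 b0 A0 AB1 qs cA.
have [AB B1] : A < B /\ 1 < B by move: AB1; rewrite gt_max => /andP.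
pose v0 := ln (2 * (2 + beta) ^+ 2 / beta).
pose V0 := 2 * Num.max v0 1.
have V02 : 2 <= V0 by rewrite /V0 -[leLHS]mulr1 ler_pM2l // le_max lexx orbT.
have V0v : v0 <= V0.
  have h1 : v0 <= Num.max v0 1 by rewrite le_max lexx.
  have h2 : 1 <= Num.max v0 1 by rewrite le_max lexx orbT.
  by rewrite /V0; lra.
pose N v := qcount q (beta * expR v).
pose n v : R := (N v)%:R.
pose G := @gcount R alpha beta A.
have [C1 C10 nG] := ncount_gcount a0 b0 A0 AB1 qs.
have nG' v : V0 <= v -> `|n v - G v| <= C1 * expR v * v `^ (A - 1 - B) by exact: nG.
have Gc v v' lo hi : V0 <= v -> v <= v' ->
    (forall y, v <= y <= v' -> lo <= y `^ (A - 1) <= hi) ->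
    alpha * beta * (expR v' - expR v) * lo <= G v' - G v
      <= alpha * beta * (expR v' - expR v) * hi.
  by move=> hv; apply: gcount_cell => //; apply: le_trans hv.
have V01 : 1 <= V0 by lra.
have upE y : beta * expR V0 <= y -> upto q y = `I_(qcount q y).
  move=> hy; apply: upto_qcount; first exact: (seqA_nondecreasing qs).
  apply: (upto_finite qs); apply: le_trans hy.
  rewrite [leRHS]mulrC -ler_pdivrMr //.
  have z0 : 0 < 2 * (2 + beta) ^+ 2 / beta by rewrite divr_gt0 // mulr_gt0 // exprn_gt0; lra.
  by rewrite -(lnK z0) ler_expR.
have NE v k : V0 <= v -> (k < N v)%N = (q k <= beta * expR v).
  move=> hv; have hy : beta * expR V0 <= beta * expR v by rewrite ler_pM2l // ler_expR.
  have e := upE _ hy.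
  apply/idP/idP => [kN|qk].
    by have : upto q (beta * expR v) k by rewrite e.
  by have : upto q (beta * expR v) k by []; rewrite e.
have Nnd v v' : V0 <= v -> v <= v' -> (N v <= N v')%N.
  move=> hv vv'; rewrite leqNgt; apply/negP => h.
  move: h; rewrite NE // => h; have : (N v' < N v')%N.
    by rewrite NE; [apply: le_trans h _; rewrite ler_pM2l // ler_expR|lra].
  by rewrite ltnn.
pose H v := \sum_(k < N v) (q k)^-1.
have q0 k : 0 < q k by apply: lt_le_trans (seqA_ge1 qs k).
have Hc v v' : V0 <= v -> v <= v' ->
    (n v' - n v) / (beta * expR v') <= H v' - H v <= (n v' - n v) / (beta * expR v).
  move=> hv vv'; have hv' : V0 <= v' by lra.
  have nn := Nnd v v' hv vv'.
  rewrite /H (sum_ordB (fun k => (q k)^-1) nn).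
  have ba : n v' - n v = \sum_(N v <= k < N v') 1.
    by rewrite big_const_nat iter_addr_0 -natrB.
  rewrite ba !mulr_suml.
  have bv x : 0 < beta * expR x by rewrite mulr_gt0 ?expR_gt0.
  apply/andP; split; rewrite big_nat_cond [leRHS]big_nat_cond; apply: ler_sum => k;
    rewrite andbT => /andP[k1 k2]; rewrite mul1r lef_pV2 ?posrE //.
    by rewrite -NE.
  by rewrite leNgt; apply/negP => h; move: k1; rewrite leqNgt NE // (ltW h).
have Mc v v' lo hi : V0 <= v -> v <= v' ->
    (forall y, v <= y <= v' -> lo <= y `^ (A - 1) <= hi) ->
    alpha * (v' - v) * lo <= main_term alpha A v' - main_term alpha A v
      <= alpha * (v' - v) * hi.
  by move=> hv; apply: main_term_cell => //; lra.
have [Cc Cc0 [w1 w11 cell]] := count_cell a0 b0 V01 C10 Gc nG'.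
have nnd v v' : V0 <= v -> v <= v' -> n v <= n v' by move=> *; rewrite ler_nat Nnd.
have [Ch Ch0 hinc] := harmonic_increment a0 b0 AB V01 C10 Gc nG' nnd Hc Mc.
(* [is_constA] only provides a limit. Applying [harmonic_increment] between v and a far point v',
   where H - M is within e of [CA], transfers the rate to the comparison with [CA] itself. *)
have Hlim v : V0 <= v -> `|H v - (CA + main_term alpha A v)| <= Ch * v `^ (A - B).
  move=> hv; apply/ler_addgt0Pr => e e0.
  have [Y [_ hY]] := (cvgrPdist_le _ _).1 cA e e0.
  pose v' := Num.max v (ln (Num.max ((Y + 1) / beta) 1)).
  have vv' : v <= v' by rewrite /v' le_max lexx.
  have Yv : Y < beta * expR v'.
    have h1 : ln (Num.max ((Y + 1) / beta) 1) <= v' by rewrite /v' le_max lexx orbT.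
    have m0 : 0 < Num.max ((Y + 1) / beta) 1 by rewrite lt_max ltr01 orbT.
    have h2 : Num.max ((Y + 1) / beta) 1 <= expR v' by rewrite -(lnK m0) ler_expR.
    have h3 : (Y + 1) / beta <= expR v' by apply: le_trans h2; rewrite le_max lexx.
    by move: h3; rewrite ler_pdivrMr // mulrC; lra.
  have {hY} := hY _ Yv.
  have -> : Hsum q (beta * expR v') = H v'.
    rewrite /Hsum upE; last by rewrite ler_pM2l // ler_expR; lra.
    by rewrite -(fsbig_ord _ _ (fun k => (q k)^-1)).
  have -> : beta * expR v' / beta = expR v' by rewrite mulrAC divff ?mul1r // gt_eqF.
  rewrite expRK -/(main_term alpha A v') => h1.
  have h2 := hinc v v' hv vv'.
  have -> : H v - (CA + main_term alpha A v) =
    - (CA - (H v' - main_term alpha A v')) -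
     ((H v' - main_term alpha A v') - (H v - main_term alpha A v)) by ring.
  apply: le_trans (ler_normB _ _) _; rewrite normrN; lra.
have Cc4 : 0 < alpha * beta / (4 * Cc) by rewrite divr_gt0 ?mulr_gt0.
(* For [rc_index] a single cell of fixed width [h0] ending at w/2 already holds e^(w/4) terms; [h0]
   is small enough for the h^2 error to take at most a quarter of the main term. *)
pose h0 := Num.min 1 (alpha * beta / (4 * Cc)).
have h00 : 0 < h0 by rewrite lt_min ltr01.
have h01 : h0 <= 1 by rewrite ge_min lexx.
have h0C : Cc * h0 <= alpha * beta / 4.
  have : h0 <= alpha * beta / (4 * Cc) by rewrite ge_min lexx orbT.
  by rewrite invfM mulrA ler_pdivlMr // mulrC.
have [Ca Ca0 hCa] : exists2 C : R, 0 < C & forall v, 0 < v -> v `^ `|A - 1| <= C * expR (4^-1 * v).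
  by apply: powR_le_expR => //; rewrite invr_gt0.
pose kap := alpha * beta * h0 / (2 * Ca).
have kap0 : 0 < kap by rewrite divr_gt0 ?mulr_gt0.
have dl0 : 0 < alpha * beta * h0 / (4 * Cc) by rewrite divr_gt0 ?mulr_gt0.
(* Beyond [dl] the error v^(-B) takes at most another quarter. The constant [kap] collects what is
   left after v^(A-1) is bounded below by a multiple of e^(-v/4). *)
pose dl := (alpha * beta * h0 / (4 * Cc))^-1.
have dl1 : 0 < dl by rewrite invr_gt0.
pose V1 := 2 * V0 + 2 * w1 + 2 * dl + 2 * (2 + 4 * `|ln kap|) + 2.
have ak := normr_ge0 (ln kap).
have V1V0 : V0 <= V1 / 2 by rewrite /V1; clear -w11 ak dl1; lra.
exists V1, Cc, Ch; split => //; first by rewrite /V1; clear -w11 V01 ak dl1; lra.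
split=> [y hy|].
  by apply: upE; apply: le_trans hy; rewrite ler_pM2l // ler_expR.
split.
- exact: (seqA_ge1 qs).
- by move=> v k hv; apply: NE; exact: le_trans hv.
- by move=> w x h hw; apply: cell; rewrite /V1 in hw; clear -hw w11 V01 ak dl1; lra.
- by move=> v hv; apply: Hlim; exact: le_trans hv.
move=> w hw; rewrite /V1 in hw.
pose v := w / 2 - h0.
have hv1 : w1 <= v by rewrite /v; clear -hw w11 V01 ak dl1 h01; lra.
have v1 : 1 <= v by exact: le_trans hv1.
have v_gt0 : 0 < v by exact: lt_le_trans v1.
have hv2 : dl <= v by rewrite /v; clear -hw w11 V01 ak dl1 h01; lra.
have hv3 : 2 + 4 * `|ln kap| <= v by rewrite /v; clear -hw w11 V01 ak dl1 h01; lra.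
have hvx : - (v / 2) <= 0 by clear -v_gt0; lra.
have := cell v 0 h0 hv1 hvx; rewrite h00 h01 => /(_ isT).
rewrite addr0 normr0 mulr0 mul0r addr0 maxxx mul0r expR0 mulr1.
have -> : v + h0 = w / 2 by rewrite /v subrK.
move=> c1.
have vB : (v `^ B)^-1 <= alpha * beta * h0 / (4 * Cc).
  rewrite -[leRHS]invrK lef_pV2 ?posrE ?powR_gt0 // -/dl; apply: le_trans hv2 _.
  by apply: le1r_powR => //; exact: ltW.
have vB' : Cc * (v `^ B)^-1 <= alpha * beta * h0 / 4.
  have := ler_wpM2l (ltW Cc0) vB.
  have -> // : Cc * (alpha * beta * h0 / (4 * Cc)) = alpha * beta * h0 / 4.
  by field; rewrite gt_eqF.
have hh : Cc * h0 ^+ 2 <= alpha * beta * h0 / 4.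
  have := ler_wpM2r (ltW h00) h0C; rewrite expr2 mulrA => h; apply: le_trans h _.
  by rewrite le_eqVlt; apply/orP; left; apply/eqP; ring.
set E := expR v * v `^ (A - 1) in c1.
have E0 : 0 < E by rewrite mulr_gt0 ?expR_gt0 ?powR_gt0.
have c2 : E * (alpha * beta * h0 / 2) <= n (w / 2).
  have n0 : 0 <= n v by rewrite ler0n.
  have k1 : E * (Cc * (h0 ^+ 2 + (v `^ B)^-1)) <= E * (alpha * beta * h0 / 2).
    by rewrite ler_pM2l //; clear -hh vB'; lra.
  move: c1; rewrite -/(n v) -/(n (w / 2)) ler_distl => /andP[c1 _]; clear -c1 k1 n0; lra.
apply: le_trans c2.
have Ea : (Ca * expR (4^-1 * v))^-1 <= v `^ (A - 1).
  rewrite -[leRHS]invrK lef_pV2 ?posrE ?invr_gt0 ?powR_gt0 ?mulr_gt0 ?expR_gt0 //.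
  rewrite -powRN; apply: le_trans (hCa v v_gt0); apply: ler_powR => //.
  by rewrite -normrN ler_norm.
have -> : w / 4 = v / 2 + h0 / 2 by rewrite /v; clear; lra.
apply: (@le_trans _ _ (expR v * (Ca * expR (4^-1 * v))^-1 * (alpha * beta * h0 / 2))); last first.
  by rewrite ler_pM2r ?divr_gt0 ?mulr_gt0 // ler_pM2l ?expR_gt0.
have -> : expR v * (Ca * expR (4^-1 * v))^-1 * (alpha * beta * h0 / 2) =
   kap * (expR v / expR (4^-1 * v)).
  by rewrite /kap; field; rewrite !gt_eqF // expR_gt0.
rewrite -expRB -(lnK kap0) -expRD ler_expR.
have lkap : - `|ln kap| <= ln kap by rewrite lerNl -normrN ler_norm.
clear -lkap hv3 h01; lra.
Qed.

End RegularCount.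

(** * The log-moment generating function of the sum *)

(** All that the estimate of L(s) uses about the random variables. With [C0] and [K] as parameters,
    constants chosen before the family are uniform over all laws satisfying CRVH. *)
Record coupled_family (R : realType) (C0 K : R) (Lam : nat -> R -> R) (g : R -> R)
    : Prop := CoupledFamily {
  cf_family : forall n, logmgf_like C0 (Lam n);
  cf_limit : logmgf_like C0 g;
  cf_coupling : forall n (u : R), (0 < n)%N -> 0 <= u ->
    `|Lam n u - g u| <= u * (K / ln n.+1%:R ^+ 2) }.

Lemma normrB_le (R : realDomainType) (x y z : R) : 0 <= x <= z -> 0 <= y <= z -> `|x - y| <= z.
Proof. by move=> /andP[? ?] /andP[? ?]; rewrite ler_norml; apply/andP; split; lra. Qed.

Section Cells.
Context {R : realType}.
Variables (alpha beta A B : R) (q : nat -> R) (N : R -> nat) (Psi : R -> R).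
Variables (V1 Cc Ch C0 K : R).
Hypotheses (beta_gt0 : 0 < beta) (B_gt1 : 1 < B) (V1_ge2 : 2 <= V1) (K_ge0 : 0 <= K).
Hypothesis rc : regular_count alpha beta A B q N Psi V1 Cc Ch.

Lemma count_nd v v' : V1 / 2 <= v -> v <= v' -> (N v <= N v')%N.
Proof.
move=> hv vv'; rewrite leqNgt; apply/negP => h.
have hv' : V1 / 2 <= v' by lra.
have : (N v' < N v')%N.
  rewrite (rc_countE rc) //; move: h; rewrite (rc_countE rc) // => h.
  by apply: le_trans h _; rewrite ler_pM2l // ler_expR.
by rewrite ltnn.
Qed.

(** Here [rc_index] is used: n >= N(w/2) >= e^(w/4) forces ln(n+1) >= w/4, so the coupling error
    falls to O(u/w^2). *)
Lemma coupling_bound Lam g w n (u : R) : coupled_family C0 K Lam g ->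
  V1 <= w -> (N (w / 2) <= n)%N -> 0 <= u ->
  `|Lam n u - g u| <= u * (16 * K / w ^+ 2).
Proof.
have V2 := V1_ge2; have K0 := K_ge0.
move=> cf hw hn u0; have w0 : 0 < w by lra.
have h1 := rc_index rc hw.
have n0 : (0 < n)%N.
  apply: leq_trans hn; rewrite -(ltr0n R); apply: lt_le_trans h1; exact: expR_gt0.
apply: le_trans (cf_coupling cf n0 u0) _; rewrite ler_wpM2l //.
have h2 : w / 4 <= ln n.+1%:R.
  rewrite -[leLHS]expRK ler_ln ?posrE ?expR_gt0 //.
  by apply: le_trans h1 _; rewrite ler_nat (leq_trans hn).
have -> : 16 * K / w ^+ 2 = K / (w / 4) ^+ 2 by field; rewrite gt_eqF.
have w40 : 0 < w / 4 by rewrite divr_gt0.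
rewrite ler_wpM2l // lef_pV2 ?posrE ?exprn_gt0 //; last exact: lt_le_trans h2.
by rewrite lerXn2r ?nnegrE ?(ltW w40) // (le_trans (ltW w40)).
Qed.

Lemma powR_1B_bounds w : 1 <= w -> 0 < w `^ (1 - B) <= 1.
Proof.
move=> w1; rewrite powR_gt0 /=; last by lra.
have B1 := B_gt1.
by rewrite -[leRHS](powRr0 w); apply: ler_powR => //; lra.
Qed.

(** A step of exact order 1/w: the upper bound keeps the Riemann sum error at 1/w, the lower bound
    turns the counting error w^(-B) of a cell into the relative error w^(1-B). *)
Lemma step_bounds w h : 1 <= w -> (4 * w)^-1 <= h -> h <= w^-1 ->
  [/\ 0 < h, h <= 1, h * w <= 1, w^-1 <= 4 * h &
      (w `^ B)^-1 <= 4 * h * w `^ (1 - B)].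
Proof.
move=> w1 h1 h2; have w0 : 0 < w by lra.
have wi0 : 0 < w^-1 by rewrite invr_gt0.
have wi1 : w^-1 <= 1 by rewrite invf_le1.
have h4 : w^-1 <= 4 * h by rewrite invfM in h1; lra.
split => //; try lra.
  by rewrite -(ler_pM2r w0) mulVf ?gt_eqF // in h2.
rewrite (powRB (r := 1)) ?powRr1 ?(ltW w0) //; last by apply/implyP => _; rewrite gt_eqF.
have p0 : 0 < (w `^ B)^-1 by rewrite invr_gt0 powR_gt0.
rewrite mulrA ler_peMl ?(ltW p0) //.
by have := ler_wpM2r (ltW w0) h4; rewrite mulVf ?gt_eqF.
Qed.

End Cells.

Lemma right_cell (R : realType) (alpha beta A B : R) (q : nat -> R) (N : R -> nat) (Psi : R -> R)
    (V1 Cc Ch C0 K : R) :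
  0 < alpha -> 0 < beta -> 1 < B -> 2 <= V1 -> 0 < Cc -> 0 <= C0 -> 0 <= K ->
  regular_count alpha beta A B q N Psi V1 Cc Ch ->
  exists2 Cr : R, 0 < Cr &
  forall (Lam : nat -> R -> R) (g : R -> R) (F : nat -> R) (w h x : R), coupled_family C0 K Lam g -> V1 <= w ->
  (4 * w)^-1 <= h -> h <= w^-1 -> 0 <= x ->
  (forall n, (N w <= n)%N -> F n = Lam n (beta * expR w / q n)) ->
  `|\sum_(n < N (w + x + h)) F n - \sum_(n < N (w + x)) F n -
    alpha * beta * (expR w * w `^ (A - 1)) *
      (eta_tail g (expR (- x) * expR (- h)) - eta_tail g (expR (- x)))|
  <= Cr * (expR w * w `^ (A - 1)) * (h * (w^-1 + w `^ (1 - B)) * expR (- (x / 8))).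
Proof.
move=> a0 b0 B1 V2 Cc0 C00 K0 rc.
have ab0 : 0 < alpha * beta by rewrite mulr_gt0.
pose Cn := alpha * beta + 64 * Cc.
have Cn0 : 0 < Cn by rewrite /Cn; lra.
exists ((10 + 16 * K) * Cn + 64 * Cc + 68 * (alpha * beta)).
  have : 0 <= (10 + 16 * K) * Cn by rewrite mulr_ge0 //; lra.
  lra.
move=> Lam g F w h x cf hw h1 h2 x0 hF.
have w1 : 1 <= w by lra.
have w0 : 0 < w by lra.
have [h0 h_le1 hw1 wh wB] := step_bounds B w1 h1 h2.
have wx : V1 / 2 <= w + x by lra.
have wxh : V1 / 2 <= w + x + h by lra.
have Nw1 : (N w <= N (w + x)%R)%N by apply: (count_nd b0 rc); clear -V2 hw x0 w1 h0; lra.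
have Nw2 : (N (w / 2)%R <= N w)%N by apply: (count_nd b0 rc); clear -V2 hw x0 w1 h0; lra.
have nn : (N (w + x)%R <= N (w + x + h)%R)%N by apply: (count_nd b0 rc); clear -V2 hw x0 w1 h0; lra.
have /andP[p0 p1] := powR_1B_bounds B1 w1.
have wi0 : 0 < w^-1 by rewrite invr_gt0.
have wi1 : w^-1 <= 1 by rewrite invf_le1.
set rho := w^-1 + w `^ (1 - B).
have rho0 : 0 < rho by rewrite addr_gt0.
have rho2 : rho <= 2 by rewrite /rho; clear -wi1 p1; lra.
have rhow : w^-1 <= rho by rewrite lerDl ltW.
set E1 := expR w * w `^ (A - 1).
have E10 : 0 < E1 by rewrite mulr_gt0 ?expR_gt0 ?powR_gt0.
(* Exponentials of x are written as integer powers of D and of d = 1/D. The cell count is O(D^11):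
   D^8 from e^x, D^2 from e^(x/4), and D from 1 + x. Every value it multiplies carries at least
   d^12, which leaves the decay d. *)
set D := expR (x / 8); set d := expR (- (x / 8)).
have Dd : D * d = 1 by rewrite /D /d expRxMexpNx_1.
have D0 : 0 < D by exact: expR_gt0.
have d0 : 0 < d by exact: expR_gt0.
have d1 : d <= 1 by rewrite expR_le1; clear -x0; lra.
have D8 : D ^+ 8 = expR x by rewrite /D -expRM_natr; congr expR; field.
have D2 : D ^+ 2 = expR (x / 4) by rewrite /D -expRM_natr; congr expR; field.
have d8 : d ^+ 8 = expR (- x) by rewrite /d -expRM_natr; congr expR; field.
have xD : 1 + x <= 8 * D by have := expR_ge1Dx (x / 8); rewrite -/D; clear; lra.
have Ddn k : D ^+ k * d ^+ k = 1 by rewrite -exprMn Dd expr1n.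
set nj := (N (w + x + h))%:R - (N (w + x))%:R : R.
have c1 : `|nj - alpha * beta * (E1 * (D ^+ 8 * h))| <= 32 * Cc * (E1 * (h * rho * D ^+ 11)).
  have hx : - (w / 2) <= x by clear -x0 w0; lra.
  have := rc_cell rc hw hx; rewrite -/nj => /(_ h); rewrite h0 h_le1 => /(_ isT).
  rewrite expRD max_l // -D8 -D2 (ger0_norm x0).
  have -> : alpha * beta * (expR w * D ^+ 8 * w `^ (A - 1) * h) =
    alpha * beta * (E1 * (D ^+ 8 * h)) by rewrite /E1; ring.
  move=> c; apply: (le_trans c).
  have k1 : h ^+ 2 + h * x / w + (w `^ B)^-1 <= 4 * h * rho * (8 * D).
    have u1 : h ^+ 2 <= h * w^-1 by rewrite expr2 ler_pM2l.
    have u2 : 0 <= h * w^-1 * x by rewrite !mulr_ge0 ?(ltW h0) ?(ltW wi0).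
    have u3 : 0 <= h * w `^ (1 - B) * x by rewrite !mulr_ge0 ?(ltW h0) ?(ltW p0).
    have u4 : 0 <= h * w^-1 by rewrite mulr_ge0 ?(ltW h0) ?(ltW wi0).
    have u5 : 4 * h * rho * (1 + x) <= 4 * h * rho * (8 * D).
      by rewrite ler_wpM2l // !mulr_ge0 ?(ltW h0) ?(ltW rho0).
    apply: le_trans u5; rewrite /rho.
    have -> : h * x / w = h * w^-1 * x by ring.
    clear -u1 u2 u3 u4 wB; lra.
  have -> : 32 * Cc * (E1 * (h * rho * D ^+ 11)) =
    Cc * (expR w * D ^+ 8 * w `^ (A - 1) * D ^+ 2 * (4 * h * rho * (8 * D))).
    by rewrite /E1; ring.
  rewrite ler_pM2l // ler_wpM2l //.
  by rewrite mulr_ge0 ?exprn_ge0 ?(ltW D0) // mulr_ge0 ?powR_ge0 // mulr_ge0 ?expR_ge0 ?exprn_ge0 ?(ltW D0).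
have nj0 : 0 <= nj by rewrite subr_ge0 ler_nat.
have c2 : nj <= Cn * (E1 * (h * D ^+ 11)).
  have Dge1 : 1 <= D by rewrite -expR0 ler_expR divr_ge0.
  have D11 : D ^+ 8 <= D ^+ 11 by rewrite ler_weXn2l.
  have k1 : alpha * beta * (E1 * (D ^+ 8 * h)) <= alpha * beta * (E1 * (h * D ^+ 11)).
    by rewrite !ler_pM2l // [leLHS]mulrC ler_pM2l.
  have k2 : 32 * Cc * (E1 * (h * rho * D ^+ 11)) <= 32 * Cc * (E1 * (h * 2 * D ^+ 11)).
    rewrite ler_pM2l; last by rewrite mulr_gt0.
    by rewrite ler_pM2l // ler_pM2r ?exprn_gt0 // ler_pM2l.
  move: c1; rewrite ler_distl => /andP[_ c1]; rewrite /Cn; clear -c1 k1 k2; lra.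
set b := expR (- x); have b_0 : 0 < b by exact: expR_gt0.
have b1 : b <= 1 by rewrite expR_le1 oppr_le0.
have b01 : 0 < b <= 1 by rewrite b_0.
have f0 : 0 <= g b by rewrite (logmgf_ge0 (cf_limit cf)) // ltW.
have f2 : g b <= 2 * d ^+ 16.
  have -> : d ^+ 16 = b ^+ 2 by rewrite /b -d8 -exprM.
  by rewrite (logmgf_le_sqr (cf_limit cf)) // ltW.
set err := (10 + 16 * K) * (d ^+ 12 * w^-1).
have cellF n : (N (w + x)%R <= n < N (w + x + h)%R)%N -> `|F n - g b| <= err.
  move=> /andP[n1 n2].
  have nw : (N w <= n)%N by apply: leq_trans n1; exact: Nw1.
  have nw2 : (N (w / 2)%R <= n)%N by exact: leq_trans Nw2 nw.
  rewrite hF //.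
  have q1 : beta * expR (w + x) < q n by move: n1; rewrite leqNgt (rc_countE rc) // -ltNge.
  have q2 : q n <= beta * expR (w + x + h) by rewrite -(rc_countE rc).
  have qn0 : 0 < q n by exact: lt_le_trans (rc_q_ge1 rc n).
  set u := beta * expR w / q n.
  have u0 : 0 < u by rewrite divr_gt0 ?mulr_gt0 ?expR_gt0.
  have ub : u <= b.
    rewrite /u ler_pdivrMr //.
    have -> : beta * expR w = b * (beta * expR (w + x)).
      by rewrite /b mulrCA -expRD; congr (_ * expR _); ring.
    by rewrite ler_pM2l //; exact: ltW q1.
  have bu : b - u <= b * h.
    have k1 : b * expR (- h) <= u.
      rewrite ler_pdivlMr // /b -expRD.
      have -> : beta * expR w = expR (- x + - h) * (beta * expR (w + x + h)).
        by rewrite mulrCA -expRD; congr (_ * expR _); ring.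
      by rewrite ler_pM2l ?expR_gt0.
    have k2 : b * (1 - h) <= b * expR (- h).
      by rewrite ler_pM2l //; have := expR_ge1Dx (- h); clear; lra.
    by clear -k1 k2; lra.
  have u1 : u <= 1 by exact: le_trans ub b1.
  have t1 : `|g u - g b| <= 8 * (d ^+ 12 * w^-1).
    have lip : g b <= g u + 8 * b * (b - u) by apply: (logmgf_lip (cf_limit cf)); rewrite ?ub ?(ltW u0).
    have mono : g u <= g b.
      have l1 : 1 <= b / u by rewrite ler_pdivlMr // mul1r.
      have := logmgf_scale (cf_limit cf) l1 (ltW u0); rewrite divfK ?gt_eqF // => k.
      by apply: le_trans k; rewrite ler_peMl // (logmgf_ge0 (cf_limit cf)) // ltW.
    rewrite ler0_norm; last by rewrite subr_le0.
    have k1 : 8 * b * (b - u) <= 8 * b * (b * h) by rewrite ler_pM2l // mulr_gt0.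
    have k2 : b * b = d ^+ 12 * d ^+ 4 by rewrite /b -d8 -!exprD.
    have k3 : b * (b * h) <= d ^+ 12 * w^-1.
      rewrite mulrA k2; apply: ler_pM => //; rewrite ?mulr_ge0 ?exprn_ge0 ?(ltW d0) ?(ltW h0) //.
      by rewrite ler_piMr ?exprn_ge0 ?(ltW d0) // exprn_ile1 // ltW.
    by clear -k1 k3 lip; lra.
  have t2 : `|Lam n u - g u| <= (2 + 16 * K) * (d ^+ 12 * w^-1).
    have ud : u <= d ^+ 8 by rewrite d8.
    have k1 := coupling_bound V2 K0 rc cf hw nw2 (ltW u0).
    have d40 : 0 <= d ^+ 4 by rewrite exprn_ge0 // ltW.
    have d80 : 0 <= d ^+ 8 by rewrite exprn_ge0 // ltW.
    have d12 : d ^+ 12 = d ^+ 8 * d ^+ 4 by rewrite -exprD.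
    have T0 : 0 <= d ^+ 12 * w^-1 by rewrite mulr_ge0 ?exprn_ge0 ?(ltW d0) ?(ltW wi0).
    have KT : 0 <= K * (d ^+ 12 * w^-1) by rewrite mulr_ge0.
    (* The target is d^12/w. The coupling gives d^8/w^2, enough when 1/w < d^4; otherwise both
       functions are at most 2 u^2 <= 2 d^16, enough because d^4 <= 1/w. *)
    have [dw|dw] := leP (d ^+ 4) w^-1.
      have u01 : 0 <= u <= 1 by rewrite (ltW u0).
      have k2 : `|Lam n u - g u| <= 2 * u ^+ 2.
        have := logmgf_ge0 (cf_limit cf) (ltW u0); have := logmgf_le_sqr (cf_limit cf) u01.
        have := logmgf_ge0 (cf_family cf n) (ltW u0); have := logmgf_le_sqr (cf_family cf n) u01.
        by move=> *; apply: normrB_le; apply/andP.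
      have k3 : u ^+ 2 <= d ^+ 12 * w^-1.
        apply: (@le_trans _ _ (d ^+ 8 * d ^+ 8)); first by rewrite expr2; apply: ler_pM => //; exact: ltW.
        rewrite d12 -mulrA ler_wpM2l //.
        have -> : d ^+ 8 = d ^+ 4 * d ^+ 4 by rewrite -exprD.
        by rewrite ler_wpM2l.
      by clear -k2 k3 KT; lra.
    apply: (le_trans k1).
    have k3 : u * w^-1 ^+ 2 <= d ^+ 12 * w^-1.
      rewrite d12 expr2 mulrA -[leRHS]mulrA [X in _ <= _ * X]mulrC.
      have -> : d ^+ 8 * (w^-1 * d ^+ 4) = d ^+ 8 * d ^+ 4 * w^-1 by ring.
      rewrite ler_pM2r //; apply: ler_pM => //; exact: ltW.
    have -> : u * (16 * K / w ^+ 2) = 16 * K * (u * w^-1 ^+ 2) by rewrite exprVn; ring.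
    have := ler_wpM2l (_ : 0 <= 16 * K) k3; rewrite mulr_ge0 // => /(_ isT); clear -T0; lra.
  have -> : Lam n u - g b = (Lam n u - g u) + (g u - g b) by ring.
  by apply: le_trans (ler_normD _ _) _; rewrite /err; clear -t1 t2; lra.
have S1 := cell_sum nn cellF; rewrite -/nj in S1.
have h01 : 0 < h <= 1 by rewrite h0.
have I1 := eta_cell_right C00 (cf_limit cf) b01 h01.
have gbD : g b / b = g b * D ^+ 8.
  by rewrite /b expRN invrK D8.
rewrite gbD in I1.
move: S1 I1; set S := (X in `|X - g b * nj|); set I := (X in `|X - h * _|) => S1 I1.
have r1 : err * nj <= (10 + 16 * K) * Cn * (E1 * (h * rho * d)).
  apply: (@le_trans _ _ (err * (Cn * (E1 * (h * D ^+ 11))))).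
    rewrite ler_wpM2l // mulr_ge0 //; first by clear -K0; lra.
    by rewrite mulr_ge0 ?exprn_ge0 ?(ltW d0) ?(ltW wi0).
  have -> : err * (Cn * (E1 * (h * D ^+ 11))) =
    (10 + 16 * K) * Cn * (E1 * (h * w^-1 * d)) * (D ^+ 11 * d ^+ 11) by rewrite /err; ring.
  rewrite Ddn mulr1; apply: ler_wpM2l; first by rewrite mulr_ge0 ?(ltW Cn0) //; clear -K0; lra.
  by rewrite ler_pM2l // ler_pM2r // ler_pM2l.
have T0 : 0 <= E1 * (h * rho * d) by rewrite ltW // mulr_gt0 // mulr_gt0 // mulr_gt0.
have r2 : `|g b * (nj - alpha * beta * (E1 * (D ^+ 8 * h)))| <= 64 * Cc * (E1 * (h * rho * d)).
  rewrite normrM (ger0_norm f0).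
  apply: (@le_trans _ _ (2 * d ^+ 16 * (32 * Cc * (E1 * (h * rho * D ^+ 11))))).
    by apply: ler_pM.
  have -> : 2 * d ^+ 16 * (32 * Cc * (E1 * (h * rho * D ^+ 11))) =
    64 * Cc * (E1 * (h * rho * d)) * (D ^+ 11 * d ^+ 11) * d ^+ 4 by ring.
  rewrite Ddn mulr1 ler_piMr ?exprn_ile1 ?(ltW d0) //.
  by rewrite mulr_ge0 // mulr_ge0 // ltW.
have r3 : `|alpha * beta * E1 * (h * (g b * D ^+ 8) - I)| <= 68 * (alpha * beta) * (E1 * (h * rho * d)).
  rewrite normrM (gtr0_norm (mulr_gt0 ab0 E10)) -/S distrC.
  apply: (@le_trans _ _ (alpha * beta * E1 * (68 * h ^+ 2 * b))).
    by rewrite ler_pM2l // mulr_gt0.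
  have -> : 68 * (alpha * beta) * (E1 * (h * rho * d)) = alpha * beta * E1 * (68 * h * (rho * d)) by ring.
  have -> : 68 * h ^+ 2 * b = 68 * h * (h * b) by ring.
  rewrite ler_pM2l; last by rewrite mulr_gt0.
  rewrite ler_pM2l; last by rewrite mulr_gt0.
  apply: ler_pM; rewrite ?(ltW h0) ?(ltW b_0) ?(le_trans h2 rhow) //.
  by rewrite /b /d ler_expR; clear -x0; lra.
have -> : S - alpha * beta * E1 * I = (S - g b * nj) +
   g b * (nj - alpha * beta * (E1 * (D ^+ 8 * h))) +
   alpha * beta * E1 * (h * (g b * D ^+ 8) - I) by ring.
apply: le_trans (ler_normD _ _) _; apply: le_trans (lerD (ler_normD _ _) (lexx _)) _.
have -> : ((10 + 16 * K) * Cn + 64 * Cc + 68 * (alpha * beta)) * E1 * (h * rho * d) =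
  (10 + 16 * K) * Cn * (E1 * (h * rho * d)) + 64 * Cc * (E1 * (h * rho * d)) +
  68 * (alpha * beta) * (E1 * (h * rho * d)) by ring.
by apply: lerD => //; apply: lerD => //; exact: le_trans S1 r1.
Qed.

(** The weight (1 + x)^(-2) is the tail bound for g(b) - b at b = e^x. The coupling contributes
    w^(-2), and w^(-1) (1 + x)^(-1) is that weight times the counting error (1 + x)/w; summed over x
    <= w/2 the latter becomes ln w / w. *)
Lemma left_cell (R : realType) (alpha beta A B : R) (q : nat -> R) (N : R -> nat) (Psi : R -> R)
    (V1 Cc Ch C0 K : R) :
  0 < alpha -> 0 < beta -> 1 < B -> 2 <= V1 -> 0 < Cc -> 0 <= C0 -> 0 <= K ->
  regular_count alpha beta A B q N Psi V1 Cc Ch ->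
  exists2 Cl : R, 0 < Cl &
  forall (Lam : nat -> R -> R) (g : R -> R) (F : nat -> R) (w h x : R),
  coupled_family C0 K Lam g -> V1 <= w ->
  (4 * w)^-1 <= h -> h <= w^-1 -> 0 <= x -> x + h <= w / 2 ->
  (forall n, (N (w / 2)%R <= n < N w)%N ->
    F n = Lam n (beta * expR w / q n) - beta * expR w / q n) ->
  `|\sum_(n < N (w - x)) F n - \sum_(n < N (w - x - h)) F n -
    alpha * beta * (expR w * w `^ (A - 1)) *
      (eta_tail g (expR x) - eta_tail g (expR x * expR h))|
  <= Cl * (expR w * w `^ (A - 1)) *
     (h * ((w^-1 + w `^ (1 - B)) * (1 + x)^-1 ^+ 2 + w^-1 ^+ 2 + w^-1 * (1 + x)^-1)).
Proof.
move=> a0 b0 B1 V2 Cc0 C00 K0 rc.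
have ab0 : 0 < alpha * beta by rewrite mulr_gt0.
pose Cn := alpha * beta + 4 * Cc.
have Cn0 : 0 < Cn by rewrite /Cn; lra.
pose Cm := alpha * beta + 3 * Cn.
have Cm0 : 0 < Cm by rewrite /Cm; lra.
exists (64 * K * Cm + 4 * C0 * Cm + 10 * (alpha * beta) * C0 + C0 * Cn + 1).
  by rewrite ltr_wpDl // !addr_ge0 ?mulr_ge0 ?(ltW a0) ?(ltW b0) ?(ltW Cm0) ?(ltW Cn0).
move=> Lam g F w h x cf hw h1 h2 x0 xhw hF.
have w1 : 1 <= w by lra.
have w0 : 0 < w by lra.
have [h0 h_le1 hw1 wh wB] := step_bounds B w1 h1 h2.
have wx : V1 / 2 <= w - x by lra.
have wxh : V1 / 2 <= w - x - h by lra.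
have Nw1 : (N (w - x)%R <= N w)%N by apply: (count_nd b0 rc); clear -V2 hw xhw x0 h0; lra.
have Nw2 : (N (w / 2)%R <= N (w - x - h)%R)%N by apply: (count_nd b0 rc); clear -V2 hw xhw x0 h0; lra.
have nn : (N (w - x - h)%R <= N (w - x)%R)%N by apply: (count_nd b0 rc); clear -V2 hw xhw x0 h0; lra.
have /andP[p0 p1] := powR_1B_bounds B1 w1.
have wi0 : 0 < w^-1 by rewrite invr_gt0.
have wi1 : w^-1 <= 1 by rewrite invf_le1.
have gc := cf_limit cf.
have x1 : 0 < 1 + x by rewrite ltr_pwDl.
pose r := (1 + x)^-1; have r0 : 0 < r by rewrite invr_gt0.
have rx : (1 + x) * r = 1 by rewrite mulfV // gt_eqF.
have r1 : r <= 1 by rewrite invf_le1 // lerDl.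
have [E1 E1E E10] : exists2 E1, E1 = expR w * w `^ (A - 1) & 0 < E1.
  by exists (expR w * w `^ (A - 1)) => //; rewrite mulr_gt0 ?expR_gt0 ?powR_gt0.
pose b := expR x; have bb0 : 0 < b by exact: expR_gt0.
have b1 : 1 <= b by rewrite -expR0 ler_expR.
pose bi := expR (- x); have bi0 : 0 < bi by exact: expR_gt0.
have bbi : b * bi = 1 by rewrite /b /bi expRxMexpNx_1.
have bVi : b^-1 = bi by rewrite /bi expRN.
pose f := g b - b.
have fle0 : f <= 0 by rewrite /f subr_le0 (logmgf_le gc) // ltW.
have fn : `|f| <= C0 * (b * r ^+ 2).
  have := normr_fcut_le gc b1; rewrite /fcut ltNge b1 /= expRK => h3.
  by apply: (le_trans h3); rewrite /r exprVn mulrA.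
pose nj := (N (w - x))%:R - (N (w - x - h))%:R : R.
(* Relative counting error of the cell at distance x from w; at most 3 because x <= w/2. *)
pose tau := (1 + x) * w^-1 + w `^ (1 - B).
have tau0 : 0 < tau by rewrite /tau addr_gt0 // mulr_gt0.
have tau3 : tau <= 3.
  have k1 : (1 + x) * w^-1 <= 2 by rewrite ler_pdivrMr //; clear -xhw h0 hw V2; lra.
  by rewrite /tau; clear -k1 p1; lra.
have c1 : `|nj - alpha * beta * (E1 * (h * bi))| <= Cn * (E1 * (h * bi * tau)).
  have hx : - (w / 2) <= - (x + h) by clear -xhw; lra.
  have h01 : 0 < h <= 1 by rewrite h0.
  have := rc_cell rc hw hx h01.
  have -> : w - (x + h) + h = w - x by ring.
  have -> : w - (x + h) = w - x - h by ring.
  have m0 : Num.max (- (x + h)) 0 = 0 by rewrite max_r //; clear -x0 h0; lra.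
  have nx : `|- (x + h)| = x + h by rewrite normrN ger0_norm //; clear -x0 h0; lra.
  rewrite m0 nx mul0r expR0 mulr1.
  rewrite -/nj => c.
  pose e := expR (- h).
  have ee : expR (w - x - h) = expR w * bi * e by rewrite !expRD.
  have e0 : 0 < e by exact: expR_gt0.
  have e1 : e <= 1 by rewrite expR_le1; clear -h0; lra.
  have e2 : 1 - h <= e by have := expR_ge1Dx (- h); rewrite /e; clear; lra.
  have t1 : `|alpha * beta * (expR (w - x - h) * w `^ (A - 1) * h) - alpha * beta * (E1 * (h * bi))|
      <= alpha * beta * (E1 * (h * bi * w^-1)).
    have -> : alpha * beta * (expR (w - x - h) * w `^ (A - 1) * h) - alpha * beta * (E1 * (h * bi))
        = alpha * beta * (E1 * (h * bi)) * (e - 1) by rewrite ee E1E; ring.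
    have ? : 0 < alpha * beta * (E1 * (h * bi)) by rewrite !mulr_gt0.
    rewrite normrM gtr0_norm // [leRHS](_ : _ = alpha * beta * (E1 * (h * bi)) * w^-1); last by ring.
    rewrite ler_pM2l // ler0_norm; clear -e1 e2 h2; lra.
  have t2 : Cc * (expR (w - x - h) * w `^ (A - 1) * (h ^+ 2 + h * (x + h) / w + (w `^ B)^-1))
      <= 4 * Cc * (E1 * (h * bi * tau)).
    have -> : 4 * Cc * (E1 * (h * bi * tau)) = Cc * (expR w * bi * w `^ (A - 1) * (4 * h * tau)).
      by rewrite E1E; ring.
    rewrite ler_pM2l //; apply: ler_pM.
    - by rewrite mulr_ge0 ?expR_ge0 ?powR_ge0.
    - rewrite !addr_ge0 ?exprn_ge0 ?invr_ge0 ?powR_ge0 ?(ltW h0) //.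
      by rewrite !mulr_ge0 ?(ltW h0) ?(ltW wi0) // addr_ge0 // ltW.
    - rewrite ee ler_pM2r ?powR_gt0 // ler_piMr // mulr_ge0 ?expR_ge0 //.
    - have u1 : h ^+ 2 <= h * w^-1 by rewrite expr2 ler_pM2l.
      have u2 : h * (x + h) / w <= h * w^-1 * (x + 1).
        rewrite (_ : h * (x + h) / w = h * w^-1 * (x + h)); last by ring.
        by rewrite ler_pM2l ?mulr_gt0 // lerD2l.
      have u3 : 0 <= h * w^-1 * x by rewrite !mulr_ge0 ?(ltW h0) ?(ltW wi0).
      have u4 : 0 <= h * w^-1 by rewrite mulr_ge0 ?(ltW h0) ?(ltW wi0).
      rewrite /tau; clear -u1 u2 u3 u4 wB; lra.
  rewrite (_ : nj - _ = (nj - alpha * beta * (expR (w - x - h) * w `^ (A - 1) * h)) +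
    (alpha * beta * (expR (w - x - h) * w `^ (A - 1) * h) - alpha * beta * (E1 * (h * bi)))); last by ring.
  apply: le_trans (ler_normD _ _) _.
  have t3 : alpha * beta * (E1 * (h * bi * w^-1)) <= alpha * beta * (E1 * (h * bi * tau)).
    rewrite !ler_pM2l ?mulr_gt0 // /tau.
    have xw : 0 <= x * w^-1 by rewrite mulr_ge0 // ltW.
    by clear -p0 xw; lra.
  have t4 := le_trans c t2; have t5 := le_trans t1 t3.
  by rewrite /Cn mulrDl addrC; exact: lerD.
have nj0 : 0 <= nj by rewrite subr_ge0 ler_nat.
have c2 : nj <= Cm * (E1 * (h * bi)).
  have k : Cn * (E1 * (h * bi * tau)) <= 3 * Cn * (E1 * (h * bi)).
    rewrite (_ : 3 * Cn * _ = Cn * (E1 * (h * bi * 3))); last by ring.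
    by rewrite !ler_pM2l ?mulr_gt0.
  move: c1; rewrite ler_distl => /andP[_ c1]; rewrite /Cm; clear -c1 k; lra.
pose err := 64 * K * (b * w^-1 ^+ 2) + 4 * h * (C0 * (b * r ^+ 2)).
have eh3 : expR h - 1 <= 3 * h.
  by have := expR_leDxsqr h_le1; have : h ^+ 2 <= h by [rewrite expr2 ler_piMr // ltW]; clear -h0; lra.
have eh4 : expR h - 1 <= 4 * h by clear -eh3 h0; lra.
have eh0 : 0 <= expR h - 1 by have := expR_ge1Dx h; clear -h0; lra.
have cellF n : (N (w - x - h)%R <= n < N (w - x)%R)%N -> `|F n - f| <= err.
  move=> /andP[n1 n2].
  have nw2 : (N (w / 2)%R <= n)%N by exact: leq_trans Nw2 n1.
  rewrite hF; last by rewrite nw2 (leq_trans n2).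
  have q1 : beta * expR (w - x - h) < q n by move: n1; rewrite leqNgt (rc_countE rc) // -ltNge.
  have q2 : q n <= beta * expR (w - x) by rewrite -(rc_countE rc).
  have qn0 : 0 < q n by exact: lt_le_trans (rc_q_ge1 rc n).
  set u := beta * expR w / q n.
  have ub : b <= u.
    rewrite ler_pdivlMr // -ler_pdivlMl // /b -expRN mulrCA -expRD.
    by rewrite [X in expR X]addrC.
  have bu : u <= b * expR h.
    rewrite /u ler_pdivrMr // (_ : beta * expR w = b * expR h * (beta * expR (w - x - h))).
      by rewrite ler_pM2l ?mulr_gt0 ?expR_gt0 // ltW.
    by rewrite mulrCA /b -!expRD; congr (_ * expR _); ring.
  have u0 : 0 < u by exact: lt_le_trans ub.
  have /andP[l1 l2] := fcut_le_of_ge gc b1 ub; rewrite -/f in l1 l2.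
  have t1 : `|g u - u - f| <= 4 * h * (C0 * (b * r ^+ 2)).
    have ubh : u / b - 1 <= 4 * h.
      apply: le_trans eh4; rewrite lerD2r ler_pdivrMr // mulrC //.
    have ub1 : 0 <= u / b - 1 by rewrite subr_ge0 ler_pdivlMr // mul1r.
    rewrite ler0_norm; last by rewrite subr_le0.
    apply: (@le_trans _ _ ((u / b - 1) * `|f|)).
      by rewrite ler0_norm //; clear -l1; lra.
    by apply: ler_pM.
  have t2 := coupling_bound V2 K0 rc cf hw nw2 (ltW u0).
  have t3 : u * (16 * K / w ^+ 2) <= 64 * K * (b * w^-1 ^+ 2).
    rewrite (_ : 64 * K * _ = b * 4 * (16 * K / w ^+ 2)); last by rewrite exprVn; ring.
    rewrite ler_wpM2r //; first by rewrite mulr_ge0 ?mulr_ge0 // invr_ge0 exprn_ge0 // ltW.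
    by apply: (le_trans bu); rewrite ler_pM2l //; clear -eh3 h_le1; lra.
  rewrite (_ : Lam n u - u - f = (Lam n u - g u) + (g u - u - f)); last by ring.
  apply: le_trans (ler_normD _ _) _; apply: lerD => //; exact: le_trans t2 t3.
have := cell_sum nn cellF; rewrite -/nj.
set S := (X in `|X - f * nj|) => S1.
have h01 : 0 < h <= 1 by rewrite h0.
have := eta_cell_left C00 gc b1 h01.
rewrite bVi -/f; set I := (X in `|X - h * _|) => I1.
rewrite -E1E -/S -/b -/I.
rewrite -/r; pose G := h * ((w^-1 + w `^ (1 - B)) * r ^+ 2 + w^-1 ^+ 2 + w^-1 * r).
rewrite -/G.
have G1 : h * w^-1 ^+ 2 <= G.
  rewrite /G ler_pM2l //.
  have k1 : 0 <= (w^-1 + w `^ (1 - B)) * r ^+ 2 by rewrite mulr_ge0 ?exprn_ge0 ?addr_ge0 // ltW.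
  have k2 : 0 <= w^-1 * r by rewrite mulr_ge0 // ltW.
  by clear -k1 k2; lra.
have G2 : h * (w^-1 * r ^+ 2) <= G.
  rewrite /G ler_pM2l //.
  have k1 : 0 <= w `^ (1 - B) * r ^+ 2 by rewrite mulr_ge0 ?exprn_ge0 // ltW.
  have k2 : 0 <= w^-1 * r by rewrite mulr_ge0 // ltW.
  have k3 : 0 <= w^-1 ^+ 2 by rewrite exprn_ge0 // ltW.
  by rewrite mulrDl; clear -k1 k2 k3; lra.
have G3 : h * (tau * r ^+ 2) <= G.
  rewrite /G ler_pM2l //.
  have k1 : 0 <= w^-1 * r ^+ 2 by rewrite mulr_ge0 ?exprn_ge0 // ltW.
  have k3 : 0 <= w^-1 ^+ 2 by rewrite exprn_ge0 // ltW.
  have -> : tau * r ^+ 2 = w^-1 * r * ((1 + x) * r) + w `^ (1 - B) * r ^+ 2 by rewrite /tau; ring.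
  by rewrite rx mulr1 mulrDl; clear -k1 k3; lra.
have G0 : 0 <= G by apply: le_trans G1; rewrite mulr_ge0 ?exprn_ge0 // ltW.
move: G G1 G2 G3 G0 => G G1 G2 G3 G0.
have e0 : 0 <= E1 * G by rewrite mulr_ge0 // ltW.
have s1 : err * nj <= (64 * K * Cm + 4 * C0 * Cm) * (E1 * G).
  apply: (@le_trans _ _ (err * (Cm * (E1 * (h * bi))))).
    rewrite ler_wpM2l // /err addr_ge0 //.
      by rewrite !mulr_ge0 ?exprn_ge0 // ltW.
    by rewrite !mulr_ge0 ?exprn_ge0 // ltW.
  have -> : err * (Cm * (E1 * (h * bi))) =
    64 * K * Cm * (E1 * (h * w^-1 ^+ 2)) * (b * bi) + 4 * C0 * Cm * (E1 * (h * (h * r ^+ 2))) * (b * bi).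
    by rewrite /err; ring.
  rewrite bbi !mulr1 [leRHS]mulrDl; apply: lerD.
    by rewrite ler_wpM2l ?ler_pM2l // !mulr_ge0 // ltW.
  rewrite ler_wpM2l //; first by rewrite !mulr_ge0 // ltW.
  rewrite ler_pM2l //; apply: le_trans G2; rewrite ler_pM2l // ler_pM2r // exprn_gt0 //.
have s2 : `|f * (nj - alpha * beta * (E1 * (h * bi)))| <= C0 * Cn * (E1 * G).
  rewrite normrM.
  apply: (@le_trans _ _ (C0 * (b * r ^+ 2) * (Cn * (E1 * (h * bi * tau))))); first exact: ler_pM.
  have -> : C0 * (b * r ^+ 2) * (Cn * (E1 * (h * bi * tau))) =
    C0 * Cn * (E1 * (h * (tau * r ^+ 2))) * (b * bi) by ring.
  rewrite bbi mulr1 ler_wpM2l ?ler_pM2l //.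
  by rewrite mulr_ge0 // ltW.
have s3 : `|alpha * beta * E1 * (h * (f * bi) - I)| <= 10 * (alpha * beta) * C0 * (E1 * G).
  rewrite normrM (gtr0_norm (mulr_gt0 ab0 E10)) distrC.
  apply: (@le_trans _ _ (alpha * beta * E1 * (10 * h ^+ 2 * (C0 * (b * r ^+ 2) * bi)))).
    rewrite ler_pM2l; last by rewrite mulr_gt0.
    apply: (le_trans I1); rewrite ler_wpM2l ?mulr_ge0 ?exprn_ge0 ?(ltW h0) //.
    by rewrite ler_pM2r.
  have -> : alpha * beta * E1 * (10 * h ^+ 2 * (C0 * (b * r ^+ 2) * bi)) =
    10 * (alpha * beta) * C0 * (E1 * (h * (h * r ^+ 2))) * (b * bi) by ring.
  rewrite bbi mulr1; apply: ler_wpM2l; first by rewrite !mulr_ge0 // ltW.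
  rewrite ler_pM2l //; apply: le_trans G2; rewrite ler_pM2l // ler_pM2r // exprn_gt0 //.
rewrite (_ : S - alpha * beta * E1 * I = (S - f * nj) +
   f * (nj - alpha * beta * (E1 * (h * bi))) +
   alpha * beta * E1 * (h * (f * bi) - I)); last by ring.
apply: le_trans (ler_normD _ _) _; apply: le_trans (lerD (ler_normD _ _) (lexx _)) _.
have s4 := le_trans S1 s1.
rewrite [leRHS](_ : _ = (64 * K * Cm + 4 * C0 * Cm) * (E1 * G) + C0 * Cn * (E1 * G) +
  10 * (alpha * beta) * C0 * (E1 * G) + E1 * G); last by ring.
by rewrite -[leLHS]addr0; apply: lerD => //; apply: lerD => //; exact: lerD.
Qed.

(** With the next two lemmas, the discrete primitives that turn cell errors into the increments
    asked for by [grid_telescoping]. *)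
Lemma inv_increment (R : realFieldType) (x h : R) : 0 <= x -> 0 < h <= 1 ->
  h * (1 + x)^-1 ^+ 2 <= 2 * ((1 + x)^-1 - (1 + x + h)^-1).
Proof.
move=> x0 /andP[h0 h1].
have y0 : 0 < 1 + x by lra.
have yh0 : 0 < 1 + x + h by lra.
have -> : 2 * ((1 + x)^-1 - (1 + x + h)^-1) = h * ((1 + x)^-1 * (2 / (1 + x + h))).
  by field; rewrite !gt_eqF.
rewrite ler_pM2l // expr2 ler_pM2l ?invr_gt0 // ler_pdivlMr // ler_pdivrMl //.
by lra.
Qed.

Lemma ln_increment (R : realType) (x h : R) : 0 <= x -> 0 < h <= 1 ->
  h * (1 + x)^-1 <= 2 * (ln (1 + x + h) - ln (1 + x)).
Proof.
move=> x0 /andP[h0 h1].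
have y0 : 0 < 1 + x by lra.
have yh0 : 0 < 1 + x + h by lra.
have := @ln_le_subr1 R ((1 + x) / (1 + x + h)) (divr_gt0 y0 yh0).
rewrite lnM ?posrE ?invr_gt0 // lnV ?posrE // => k.
have k2 : h * (1 + x)^-1 <= 2 * (1 - (1 + x) / (1 + x + h)).
  have -> : 2 * (1 - (1 + x) / (1 + x + h)) = h * (2 / (1 + x + h)) by field; rewrite gt_eqF.
  by rewrite ler_pM2l // ler_pdivlMr // ler_pdivrMl //; lra.
lra.
Qed.

Lemma expRN_increment (R : realType) (x h : R) : 0 < h <= 1 ->
  h * expR (- (x / 8)) <= 16 * (expR (- (x / 8)) - expR (- ((x + h) / 8))).
Proof.
move=> /andP[h0 h1].
rewrite (_ : - ((x + h) / 8) = - (x / 8) + - (h / 8)); last by field.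
rewrite expRD -[X in X - _]mulr1 -mulrBr mulrCA mulrC ler_wpM2l ?expR_ge0 //.
have := @expR_leDxsqr _ (- (h / 8)); rewrite sqrrN => k.
have k1 : expR (- (h / 8)) <= 1 - h / 8 + 2 * (h / 8) ^+ 2 by apply: k; lra.
have k2 : h ^+ 2 <= h by rewrite expr2 ler_piMr // ltW.
rewrite exprMn in k1; lra.
Qed.

Lemma grid_step (R : realType) (w : R) : 1 <= w ->
  exists (J : nat) (h : R), [/\ J%:R * h = w / 2, (4 * w)^-1 <= h & h <= w^-1].
Proof.
move=> w1; have w0 : 0 < w by lra.
(* About w^2 steps cover [0, w/2] exactly: w^2 < J <= 2 w^2 puts h = w/(2J) between 1/(4w) and
   1/w. *)
pose J := (Num.truncn (w ^+ 2)).+1.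
have /andP[J1 J2] : (Num.truncn (w ^+ 2))%:R <= w ^+ 2 < J%:R by rewrite /J truncn_itv // exprn_ge0 // ltW.
have J0 : 0 < J%:R :> R by rewrite ltr0n.
have J3 : J%:R <= 2 * w ^+ 2.
  rewrite /J -natr1; have : 1 <= w ^+ 2 by rewrite exprn_ege1.
  by clear -J1; lra.
exists J, (w / (2 * J%:R)); split.
- by field; rewrite gt_eqF.
- rewrite ler_pdivlMr ?mulr_gt0 // ler_pdivrMl ?mulr_gt0 //.
  by move: J3; rewrite expr2; clear; lra.
- rewrite ler_pdivrMr ?mulr_gt0 // ler_pdivlMl //.
  by clear -J2 J0; move: J2; rewrite expr2; lra.
Qed.

Lemma left_sum (R : realType) (alpha beta A B : R) (q : nat -> R) (N : R -> nat) (Psi : R -> R)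
    (V1 Cc Ch C0 K Cp : R) :
  0 < alpha -> 0 < beta -> 0 <= A -> A < B -> 1 < B -> 2 <= V1 -> 0 < Cc -> 0 < Ch ->
  0 <= C0 -> 0 <= K -> 0 <= Cp ->
  regular_count alpha beta A B q N Psi V1 Cc Ch ->
  (forall w, V1 <= w -> Psi (w / 2) <= Cp * (w `^ A * ln w)) ->
  exists2 C : R, 0 < C &
  forall (Lam : nat -> R -> R) (g : R -> R) (w : R),
  coupled_family C0 K Lam g -> V1 <= w -> 4 <= w ->
  `|\sum_(n < N w) (Lam n (beta * expR w / q n) - beta * expR w / q n) -
     alpha * beta * (expR w * w `^ (A - 1)) * eta_tail g 1|
  <= C * (expR w * w `^ (A - 1)) * (ln w / w + w `^ (1 - B)).
Proof.
move=> a0 b0 A0 AB B1 V2 Cc0 Ch0 C00 K0 Cp0 rc Psi_le.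
have [Cl Cl0 hl] := left_cell a0 b0 B1 V2 Cc0 C00 K0 rc.
have ab0 : 0 < alpha * beta by rewrite mulr_gt0.
pose Cs := 4 * C0 * beta * (Cp + Ch).
have Cs0 : 0 <= Cs by rewrite /Cs !mulr_ge0 ?addr_ge0 // ltW.
pose Ct := alpha * beta * (32 + 16 * C0).
have Ct0 : 0 < Ct by rewrite /Ct mulr_gt0 //; lra.
exists (5 * Cl + Cs + Ct); first by rewrite addr_gt0 // ltr_wpDr // mulr_gt0.
move=> Lam g w cf hw w4.
have gc := cf_limit cf.
have w0 : 0 < w by lra.
have w1 : 1 <= w by lra.
have wi0 : 0 < w^-1 by rewrite invr_gt0.
have lnw1 : 1 <= ln w.
  rewrite -[leLHS](expRK 1) ler_ln ?posrE ?expR_gt0 //; apply: le_trans w4.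
  exact: expR1_le4.
have /andP[p0 p1] := powR_1B_bounds B1 w1.
have [E1 E1E E10] : exists2 E1, E1 = expR w * w `^ (A - 1) & 0 < E1.
  by exists (expR w * w `^ (A - 1)) => //; rewrite mulr_gt0 ?expR_gt0 ?powR_gt0.
rewrite -E1E.
pose Ew := ln w / w + w `^ (1 - B).
have wE : w^-1 <= ln w / w by rewrite ler_peMl // ltW.
have wE' : w^-1 <= Ew by rewrite /Ew; clear -wE p0; lra.
have lE' : ln w / w <= Ew by rewrite /Ew; clear -p0; lra.
have pE' : w `^ (1 - B) <= Ew by rewrite /Ew; clear -wE wi0; lra.
have Ew0 : 0 < Ew by apply: lt_le_trans wE'.
set u := fun n => beta * expR w / q n.
pose F n := Lam n (u n) - u n.
have q0 n : 0 < q n by exact: lt_le_trans (rc_q_ge1 rc n).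
have u0 n : 0 < u n by rewrite divr_gt0 ?mulr_gt0 ?expR_gt0.
have [J [h [hJ h1 h2]]] := grid_step w1.
have [h0 h_le1 _ _ _] := step_bounds B w1 h1 h2.
have h01 : 0 < h <= 1 by rewrite h0.
pose kap := alpha * beta * E1.
have kap0 : 0 < kap by rewrite mulr_gt0.
pose Tl x := kap * eta_tail g (expR x) - \sum_(n < N (w - x)) F n.
pose rho := w^-1 + w `^ (1 - B).
have rhoE : rho <= Ew by rewrite /rho /Ew; clear -wE; lra.
have rho0 : 0 < rho by rewrite addr_gt0.
(* Primitive of the three error terms of [left_cell]. Over [0, w/2] its increase is O(ln w / w +
   w^(1-B)). *)
pose Q x := - (2 * rho * (1 + x)^-1) + x * w^-1 ^+ 2 + 2 * w^-1 * ln (1 + x).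
pose Pl x := Cl * E1 * Q x.
have step j : (j < J)%N -> `|Tl (j.+1%:R * h) - Tl (j%:R * h)| <= Pl (j.+1%:R * h) - Pl (j%:R * h).
  move=> jJ; pose x := j%:R * h.
  have x0 : 0 <= x by rewrite mulr_ge0 // ltW.
  have xh : j.+1%:R * h = x + h by rewrite /x -natr1 mulrDl mul1r.
  have xhw : x + h <= w / 2 by rewrite -xh -hJ ler_pM2r // ler_nat.
  rewrite xh -/x.
  have -> : Tl (x + h) - Tl x = \sum_(n < N (w - x)) F n - \sum_(n < N (w - x - h)) F n -
      kap * (eta_tail g (expR x) - eta_tail g (expR x * expR h)).
    by rewrite /Tl expRD opprD addrA; ring.
  have := hl Lam g F w h x cf hw h1 h2 x0 xhw (fun _ _ => erefl).
  rewrite -E1E -/kap => k; apply: (le_trans k); rewrite /Pl -mulrBr ler_pM2l ?mulr_gt0 //.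
  rewrite /Q -/rho.
  have k1 := inv_increment x0 h01; have k2 := ln_increment x0 h01.
  have k3 := ler_wpM2l (ltW rho0) k1; have k4 := ler_wpM2l (ltW wi0) k2.
  rewrite addrA.
  have -> : h * (rho * (1 + x)^-1 ^+ 2 + w^-1 ^+ 2 + w^-1 / (1 + x)) =
    rho * (h * (1 + x)^-1 ^+ 2) + h * w^-1 ^+ 2 + w^-1 * (h / (1 + x)) by ring.
  by clear -k3 k4; lra.
have := grid_telescoping step; rewrite hJ => tele.
have Tw : Tl (w / 2) - Tl 0 = (\sum_(n < N w) F n - kap * eta_tail g 1) -
    (\sum_(n < N (w / 2)) F n - kap * eta_tail g (expR (w / 2))).
  rewrite /Tl expR0 subr0 (_ : w - w / 2 = w / 2); last by field.
  by ring.
have Pw : Pl (w / 2) - Pl 0 <= 5 * Cl * (E1 * Ew).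
  rewrite /Pl -mulrBr (_ : 5 * Cl * (E1 * Ew) = Cl * E1 * (5 * Ew)); last by ring.
  rewrite ler_pM2l ?mulr_gt0 // /Q addr0 ln1 invr1 !mulr1 !mul0r mulr0 !addr0.
  have k1 : 0 <= 2 * rho * (1 + w / 2)^-1 by rewrite !mulr_ge0 ?(ltW rho0) // invr_ge0; clear -w0; lra.
  have k2 : w / 2 * w^-1 ^+ 2 = w^-1 / 2 by field; rewrite gt_eqF.
  have k3 : ln (1 + w / 2) <= ln w by rewrite ler_ln ?posrE //; clear -w4 w0; lra.
  have k4 : 2 * w^-1 * ln (1 + w / 2) <= 2 * (ln w / w).
    by rewrite -mulrA [_^-1 * _]mulrC ler_pM2l // ler_pM2r.
  by rewrite k2; clear -k1 k4 rhoE lE' wE' wi0; lra.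
(* For q_n <= beta e^(w/2) neither cells nor coupling are used: u >= e^(w/2), so the tail bound
   gives 4 C0 u/w^2 for each term, and the sum of the 1/q_n is O(w^A ln w) by the assumption on
   [Psi (w / 2)]. *)
have small : `|\sum_(n < N (w / 2)) F n| <= Cs * (E1 * Ew).
  have w2 : 1 <= w / 2 by clear -w4; lra.
  have w20 : 0 < w / 2 by clear -w0; lra.
  have wh : V1 / 2 <= w / 2 by rewrite ler_pM2r.
  have sumq : \sum_(n < N (w / 2)) (q n)^-1 <= (Cp + Ch) * (w `^ A * ln w).
    have := rc_harmonic rc wh; rewrite ler_distl => /andP[_ k].
    apply: (le_trans k); rewrite mulrDl; apply: lerD; first exact: Psi_le.
    rewrite ler_pM2l //; apply: (@le_trans _ _ 1).
      by rewrite -[leRHS](powRr0 (w / 2)); apply: ler_powR => //; clear -AB; lra.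
    rewrite -[leLHS]mulr1; apply: ler_pM => //.
    by rewrite -[leLHS](powRr0 w); exact: ler_powR.
  apply: le_trans (ler_norm_sum _ _ _) _.
  apply: (@le_trans _ _ (\sum_(n < N (w / 2)) (4 * C0 * w^-1 ^+ 2 * (beta * expR w) * (q n)^-1))).
    apply: ler_sum => n _.
    have qn : q n <= beta * expR (w / 2) by rewrite -(rc_countE rc).
    have uw : expR (w / 2) <= u n.
      rewrite /u ler_pdivlMr //; apply: (@le_trans _ _ (expR (w / 2) * (beta * expR (w / 2)))).
        by rewrite ler_pM2l ?expR_gt0.
      by rewrite mulrCA -expRD (_ : w / 2 + w / 2 = w) //; field.
    have u1 : 1 <= u n by apply: le_trans uw; rewrite -[leLHS](@expR0 R) ler_expR ltW.
    have lu : w / 2 <= ln (u n) by rewrite -[leLHS]expRK ler_ln ?posrE ?expR_gt0.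
    have k1 := logmgf_tail (cf_family cf n) u1.
    have k2 := logmgf_le (cf_family cf n) (ltW (u0 n)).
    rewrite ler0_norm ?subr_le0 // opprB.
    apply: (@le_trans _ _ (C0 * u n / (1 + ln (u n)) ^+ 2)); first by clear -k1; lra.
    have -> : 4 * C0 * w^-1 ^+ 2 * (beta * expR w) * (q n)^-1 = C0 * u n * (w / 2)^-1 ^+ 2.
      by rewrite /u; field; rewrite !gt_eqF.
    have Cu : 0 <= C0 * u n by rewrite mulr_ge0 // ltW.
    have l0 : 0 < 1 + ln (u n) by clear -lu w20; lra.
    have lw : w / 2 <= 1 + ln (u n) by clear -lu; lra.
    rewrite exprVn ler_wpM2l // lef_pV2 ?posrE ?exprn_gt0 //.
    by rewrite lerXn2r ?nnegrE ?(ltW l0) ?(ltW w20).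
  rewrite -mulr_sumr.
  apply: (@le_trans _ _ (4 * C0 * w^-1 ^+ 2 * (beta * expR w) * ((Cp + Ch) * (w `^ A * ln w)))).
    by rewrite ler_wpM2l // !mulr_ge0 ?exprn_ge0 ?expR_ge0 // ltW.
  have -> : 4 * C0 * w^-1 ^+ 2 * (beta * expR w) * ((Cp + Ch) * (w `^ A * ln w)) = Cs * (E1 * (ln w / w)).
    rewrite E1E /Cs (_ : w `^ A = w `^ (A - 1) * w).
      by field; rewrite gt_eqF.
    rewrite -[X in _ * X](@powRr1 _ w (ltW w0)) -powRD ?subrK //.
    by apply/implyP => _; rewrite gt_eqF.
  by rewrite ler_wpM2l // ler_pM2l.
(* The part of the integral beyond e^(w/2), matched by no cell, is O(1/w) since the tail of eta at X
   is O(1/ln X). *)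
have tailI : kap * `|eta_tail g (expR (w / 2))| <= Ct * (E1 * Ew).
  have l1 : w / 2 <= ln (1 + expR (w / 2)).
    by rewrite -[leLHS]expRK ler_ln ?posrE ?expR_gt0 ?addr_gt0 ?expR_gt0 // lerDr.
  have k := eta_tail_le C00 gc (expR_ge0 (w / 2)).
  have C8 : 0 <= 16 + 8 * C0 by clear -C00; lra.
  have k2 : (16 + 8 * C0) / (1 + ln (1 + expR (w / 2))) <= (32 + 16 * C0) * w^-1.
    have -> : (32 + 16 * C0) * w^-1 = (16 + 8 * C0) / (w / 2) by field; rewrite gt_eqF.
    by rewrite ler_wpM2l // lef_pV2 ?posrE //; clear -l1 w0; lra.
  rewrite /Ct /kap (_ : _ * (E1 * Ew) = alpha * beta * E1 * ((32 + 16 * C0) * Ew)); last by ring.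
  rewrite ler_pM2l //; apply: (le_trans k); apply: (le_trans k2).
  by rewrite ler_wpM2l //; clear -C00; lra.
rewrite (_ : \sum_(n < N w) _ = \sum_(n < N w) F n) // -/kap.
rewrite (_ : _ - _ = (Tl (w / 2) - Tl 0) + \sum_(n < N (w / 2)) F n - kap * eta_tail g (expR (w / 2))); last first.
  by rewrite Tw; ring.
apply: le_trans (ler_normB _ _) _; rewrite normrM (gtr0_norm kap0).
apply: le_trans (lerD (ler_normD _ _) (lexx _)) _.
have t1 := le_trans tele Pw.
rewrite [leRHS](_ : _ = 5 * Cl * (E1 * Ew) + Cs * (E1 * Ew) + Ct * (E1 * Ew)); last by rewrite /Ew; ring.
by apply: lerD => //; apply: lerD.
Qed.

Lemma right_sum (R : realType) (alpha beta A B : R) (q : nat -> R) (N : R -> nat) (Psi : R -> R)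
    (V1 Cc Ch C0 K Cz : R) :
  0 < alpha -> 0 < beta -> 1 < B -> 2 <= V1 -> 0 < Cc ->
  0 <= C0 -> 0 <= K -> 0 <= Cz ->
  regular_count alpha beta A B q N Psi V1 Cc Ch ->
  exists2 C : R, 0 < C &
  forall (Lam : nat -> R -> R) (g : R -> R) (w z : R),
  coupled_family C0 K Lam g -> V1 <= w -> 4 <= w -> Cz <= w ->
  expR w * w <= Cz * expR z ->
  `|\sum_(n < N z) Lam n (beta * expR w / q n) - \sum_(n < N w) Lam n (beta * expR w / q n) -
     alpha * beta * (expR w * w `^ (A - 1)) * (eta_tail g 0 - eta_tail g 1)|
  <= C * (expR w * w `^ (A - 1)) * (ln w / w + w `^ (1 - B)).
Proof.
move=> a0 b0 B1 V2 Cc0 C00 K0 Cz0 rc.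
have [Cr Cr0 hr] := right_cell a0 b0 B1 V2 Cc0 C00 K0 rc.
have ab0 : 0 < alpha * beta by rewrite mulr_gt0.
exists (16 * Cr + 8 * (alpha * beta) * Cz).
  by rewrite ltr_wpDr ?mulr_gt0 // !mulr_ge0 // ltW.
move=> Lam g w z cf hw w4 Czw hz.
have gc := cf_limit cf.
have w0 : 0 < w by lra.
have w1 : 1 <= w by lra.
have wi0 : 0 < w^-1 by rewrite invr_gt0.
have lnw1 : 1 <= ln w.
  rewrite -[leLHS](expRK 1) ler_ln ?posrE ?expR_gt0 //; apply: le_trans w4.
  exact: expR1_le4.
have /andP[p0 p1] := powR_1B_bounds B1 w1.
have [E1 E1E E10] : exists2 E1, E1 = expR w * w `^ (A - 1) & 0 < E1.
  by exists (expR w * w `^ (A - 1)) => //; rewrite mulr_gt0 ?expR_gt0 ?powR_gt0.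
rewrite -E1E.
have [Ew EwE] : exists Ew, Ew = ln w / w + w `^ (1 - B) by eexists.
rewrite -EwE.
have wE : w^-1 <= ln w / w by rewrite ler_peMl // ltW.
have wE' : w^-1 <= Ew by rewrite EwE; clear -wE p0; lra.
pose rho := w^-1 + w `^ (1 - B).
have rhoE : rho <= Ew by rewrite /rho EwE; clear -wE; lra.
have rho0 : 0 < rho by rewrite addr_gt0.
have wz : w <= z.
  rewrite -ler_expR -(ler_pM2r w0); apply: (le_trans hz).
  by rewrite mulrC ler_wpM2l ?expR_ge0.
set F := fun n => Lam n (beta * expR w / q n).
have q0 n : 0 < q n by exact: lt_le_trans (rc_q_ge1 rc n).
have F0 n : 0 <= F n.
  by rewrite (logmgf_ge0 (cf_family cf n)) // divr_ge0 ?mulr_ge0 ?expR_ge0 // ltW.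
have [_ [h [_ h1 h2]]] := grid_step w1.
have [h0 h_le1 hw1 _ _] := step_bounds B w1 h1 h2.
have h01 : 0 < h <= 1 by rewrite h0.
(* On this side z is given and need not lie on the grid: J h <= z - w < (J+1) h. *)
pose J := Num.truncn ((z - w) / h).
have /andP[J1 J2] : J%:R <= (z - w) / h < J.+1%:R.
  by rewrite /J truncn_itv // divr_ge0 ?subr_ge0 // ltW.
rewrite ler_pdivlMr // in J1; rewrite ltr_pdivrMr // in J2.
pose kap := alpha * beta * E1.
have kap0 : 0 < kap by rewrite mulr_gt0.
pose Tr x := \sum_(n < N (w + x)) F n - kap * eta_tail g (expR (- x)).
pose Pr x := - (16 * Cr * E1 * rho * expR (- (x / 8))).
have step j : `|Tr (j.+1%:R * h) - Tr (j%:R * h)| <= Pr (j.+1%:R * h) - Pr (j%:R * h).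
  pose x := j%:R * h.
  have x0 : 0 <= x by rewrite mulr_ge0 // ltW.
  have xh : j.+1%:R * h = x + h by rewrite /x -natr1 mulrDl mul1r.
  rewrite xh -/x.
  have -> : Tr (x + h) - Tr x = \sum_(n < N (w + x + h)) F n - \sum_(n < N (w + x)) F n -
      kap * (eta_tail g (expR (- x) * expR (- h)) - eta_tail g (expR (- x))).
    by rewrite /Tr opprD expRD addrA; ring.
  have := hr Lam g F w h x cf hw h1 h2 x0 (fun _ _ => erefl).
  rewrite -E1E -/kap -/rho => k; apply: (le_trans k).
  have k1 := expRN_increment x h01.
  rewrite /Pr (_ : Cr * E1 * _ = Cr * E1 * rho * (h * expR (- (x / 8)))); last by ring.
  rewrite [leRHS](_ : _ = Cr * E1 * rho * (16 * (expR (- (x / 8)) - expR (- ((x + h) / 8))))); last by ring.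
  by rewrite ler_pM2l // !mulr_gt0.
have tele j : `|Tr (j%:R * h) - Tr 0| <= 16 * Cr * (E1 * Ew).
  apply: le_trans (grid_telescoping (fun j _ => step j)) _.
  rewrite /Pr mul0r oppr0 expR0 mulr1 opprK.
  apply: (@le_trans _ _ (16 * Cr * E1 * rho)).
    by rewrite gerDr oppr_le0 mulr_ge0 ?expR_ge0 // ltW // !mulr_gt0.
  rewrite [leRHS]mulrA ler_pM2l // !mulr_gt0 //.
(* Cost of stopping at z: the missing part of eta lies over [0, e^(-jh)], where the integrand is at
   most 2, and e^(-jh) is O(e^(w-z)) = O(1/w) by the assumption relating w and z. *)
have near j : z - w - h <= j%:R * h -> kap * `|eta_tail g 0 - eta_tail g (expR (- (j%:R * h)))|
    <= 8 * (alpha * beta) * Cz * (E1 * Ew).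
  move=> hj; have e1 : 0 <= expR (- (j%:R * h)) <= 1.
    by rewrite expR_ge0 expR_le1 oppr_le0 mulr_ge0 // ltW.
  have k := eta_tail0B C00 gc e1.
  have k2 : expR (- (j%:R * h)) <= 4 * (Cz * Ew).
    apply: (@le_trans _ _ (expR 1 * (expR w / expR z))).
      rewrite -expRN -!expRD ler_expR; clear -hj h_le1; lra.
    apply: ler_pM; rewrite ?expR1_le4 ?expR_ge0 ?divr_ge0 ?expR_ge0 //.
    apply: (@le_trans _ _ (Cz * w^-1)); last by rewrite ler_wpM2l.
    by rewrite ler_pdivrMr ?expR_gt0 // mulrAC ler_pdivlMr.
  rewrite /kap (_ : 8 * _ * _ * _ = alpha * beta * E1 * (2 * (4 * (Cz * Ew)))); last by ring.
  by rewrite ler_pM2l // (le_trans k) // ler_pM2l.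
(* As F >= 0, the sum up to z lies between the sums at the two neighbouring grid points, both of
   which satisfy the estimate. *)
have Fmono v v' : w <= v -> v <= v' -> \sum_(n < N v) F n <= \sum_(n < N v') F n.
  move=> wv vv'; have nn : (N v <= N v')%N by apply: (count_nd b0 rc) => //; clear -wv w0 hw; lra.
  rewrite -subr_ge0 (sum_ordB F nn) sumr_ge0 //.
have JX0 : 0 <= J%:R * h by rewrite mulr_ge0 // ltW.
have S1 : \sum_(n < N (w + J%:R * h)) F n <= \sum_(n < N z) F n.
  by apply: Fmono; clear -JX0 J1; lra.
have S2 : \sum_(n < N z) F n <= \sum_(n < N (w + J.+1%:R * h)) F n.
  by apply: Fmono => //; clear -J2; lra.
have TE j : Tr (j%:R * h) - Tr 0 = \sum_(n < N (w + j%:R * h)) F n - \sum_(n < N w) F n -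
    kap * (eta_tail g 0 - eta_tail g 1) + kap * (eta_tail g 0 - eta_tail g (expR (- (j%:R * h)))).
  by rewrite /Tr addr0 oppr0 expR0; ring.
have bnd j : z - w - h <= j%:R * h ->
   `|\sum_(n < N (w + j%:R * h)) F n - \sum_(n < N w) F n - kap * (eta_tail g 0 - eta_tail g 1)|
   <= (16 * Cr + 8 * (alpha * beta) * Cz) * (E1 * Ew).
  move=> hj; have := TE j.
  move/eqP; rewrite -subr_eq eq_sym => /eqP ->.
  apply: le_trans (ler_normB _ _) _; rewrite [leRHS]mulrDl normrM (gtr0_norm kap0).
  by apply: lerD; [exact: tele|exact: near].
rewrite -[leRHS]mulrA; have := bnd J; have := bnd J.+1.
rewrite !ler_distl.
have j1 : z - w - h <= J%:R * h by move: J2; rewrite -natr1 mulrDl mul1r; clear; lra.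
have j2 : z - w - h <= J.+1%:R * h by clear -J2 h0; lra.
move=> /(_ j2) /andP[_ u2] /(_ j1) /andP[l1 _].
by apply/andP; split; [apply: le_trans l1 _|apply: le_trans u2]; rewrite lerD2r.
Qed.

Lemma log_mgf_sum (R : realType) (alpha beta A B : R) (q : nat -> R) (N : R -> nat) (Psi : R -> R)
    (V1 Cc Ch C0 K Cp Cz : R) :
  0 < alpha -> 0 < beta -> 0 <= A -> A < B -> 1 < B -> 2 <= V1 -> 0 < Cc -> 0 < Ch ->
  0 <= C0 -> 0 <= K -> 0 <= Cp -> 0 <= Cz ->
  regular_count alpha beta A B q N Psi V1 Cc Ch ->
  (forall w, V1 <= w -> Psi (w / 2) <= Cp * (w `^ A * ln w)) ->
  exists2 C : R, 0 < C &
  forall (Lam : nat -> R -> R) (g : R -> R) (w z : R),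
  coupled_family C0 K Lam g -> V1 <= w -> 4 <= w -> Cz <= w ->
  expR w * w <= Cz * expR z ->
  `|\sum_(n < N z) Lam n (beta * expR w / q n)
    - beta * expR w * (Psi w + alpha * w `^ (A - 1) * eta_tail g 0)|
  <= C * (expR w * w `^ (A - 1)) * (ln w / w + w `^ (1 - B)).
Proof.
move=> a0 b0 A0 AB B1 V2 Cc0 Ch0 C00 K0 Cp0 Cz0 rc hPsi.
have [Cl Cl0 hl] := left_sum a0 b0 A0 AB B1 V2 Cc0 Ch0 C00 K0 Cp0 rc hPsi.
have [Cr Cr0 hr] := right_sum a0 b0 B1 V2 Cc0 C00 K0 Cz0 rc.
exists (Cr + Cl + beta * Ch); first by rewrite !addr_gt0 ?mulr_gt0.
move=> Lam g w z cf hw w4 Czw hz.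
have w0 : 0 < w by lra.
have wh : V1 / 2 <= w by lra.
have t1 := hr Lam g w z cf hw w4 Czw hz; have t2 := hl Lam g w cf hw w4.
have t3 := rc_harmonic rc wh.
have ww : w `^ (A - B) = w `^ (A - 1) * w `^ (1 - B).
  rewrite -powRD; last by apply/implyP => _; rewrite gt_eqF.
  by congr powR; ring.
have Ew : w `^ (1 - B) <= ln w / w + w `^ (1 - B).
  by rewrite lerDr divr_ge0 ?ln_ge0 ?(ltW w0) //; clear -w4; lra.
have lin : \sum_(n < N w) (Lam n (beta * expR w / q n) - beta * expR w / q n) =
  \sum_(n < N w) Lam n (beta * expR w / q n) - beta * expR w * \sum_(n < N w) (q n)^-1.
  by rewrite sumrB mulr_sumr.
rewrite lin in t2.
rewrite (_ : _ - _ = (\sum_(n < N z) Lam n (beta * expR w / q n) - \sum_(n < N w) Lam n (beta * expR w / q n) -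
     alpha * beta * (expR w * w `^ (A - 1)) * (eta_tail g 0 - eta_tail g 1)) +
   (\sum_(n < N w) Lam n (beta * expR w / q n) - beta * expR w * \sum_(n < N w) (q n)^-1 -
     alpha * beta * (expR w * w `^ (A - 1)) * eta_tail g 1) +
   beta * expR w * (\sum_(n < N w) (q n)^-1 - Psi w)); last by ring.
apply: le_trans (ler_normD _ _) _; apply: le_trans (lerD (ler_normD _ _) (lexx _)) _.
rewrite [leRHS](_ : _ = Cr * (expR w * w `^ (A - 1)) * (ln w / w + w `^ (1 - B)) +
  Cl * (expR w * w `^ (A - 1)) * (ln w / w + w `^ (1 - B)) +
  beta * Ch * (expR w * w `^ (A - 1)) * (ln w / w + w `^ (1 - B))); last by ring.
apply: lerD; first exact: lerD.
have be0 : 0 < beta * expR w by rewrite mulr_gt0 ?expR_gt0.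
rewrite normrM (gtr0_norm be0).
apply: (@le_trans _ _ (beta * expR w * (Ch * (w `^ (A - 1) * w `^ (1 - B))))).
  by rewrite ler_pM2l // -ww.
rewrite (_ : _ * (Ch * _) = beta * Ch * (expR w * w `^ (A - 1)) * w `^ (1 - B)); last by ring.
by rewrite ler_wpM2l // !mulr_ge0 ?expR_ge0 ?powR_ge0 // ltW.
Qed.

Lemma window_bounds (R : realType) (alpha A B D : R) : 0 < alpha -> 1 < B -> 1 <= D ->
  exists C w1 : R, [/\ 0 < C, 4 <= w1 & forall W w : R, w1 <= W -> `|w - W| <= D ->
  [/\ W / 2 <= w <= 2 * W,
      w `^ (A - 1) <= C * W `^ (A - 1),
      `|w `^ (A - 1) - W `^ (A - 1)| <= C * (W `^ (A - 1) * W^-1),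
      `|main_term alpha A w - main_term alpha A W - alpha * W `^ (A - 1) * (w - W)|
        <= C * (W `^ (A - 1) * W^-1) &
      ln w / w + w `^ (1 - B) <= C * (ln W / W + W `^ (1 - B))]].
Proof.
move=> a0 B1 D1.
have [Ca Ca0 ha] := @powR_ratio_bounds R (A - 1).
have [Cb Cb0 hb] := @powR_ratio_bounds R (1 - B).
have D0 : 0 < D by lra.
pose eD := expR (D / 4); have eD0 : 0 < eD by exact: expR_gt0.
pose c1 := Ca * D * eD; have c10 : 0 < c1 by rewrite !mulr_gt0.
exists (Ca * eD + Cb * eD + c1 + alpha * D * c1 + 4), (4 + 2 * D + 4 * `|A - 1| + 4 * `|1 - B|).
have t0 : 0 < alpha * D * c1 by rewrite !mulr_gt0.
have t1 : 0 < Ca * eD by rewrite mulr_gt0.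
have t2 : 0 < Cb * eD by rewrite mulr_gt0.
have na := normr_ge0 (A - 1); have nb := normr_ge0 (1 - B).
split; [by rewrite !addr_gt0|by lra|] => W w hW hw.
have W0 : 0 < W by lra.
have W1 : 1 <= W by lra.
have WD : 2 * D <= W by lra.
have WA : 4 * `|A - 1| <= W by lra.
have WB : 4 * `|1 - B| <= W by lra.
have W4 : 4 <= W by lra.
have Wi0 : 0 < W^-1 by rewrite invr_gt0.
clear hW na nb.
have /andP[w1 w2] : W / 2 <= w <= 2 * W.
  by move: hw; rewrite ler_norml => /andP[? ?]; apply/andP; split; lra.
have w0 : 0 < w by clear -w1 W0; lra.
have mD : Num.max D 0 = D by rewrite max_l // ltW.
have P0 : 0 < W `^ (A - 1) by rewrite powR_gt0.
have pw y : `|y - W| <= D -> y `^ (A - 1) <= Ca * eD * W `^ (A - 1) /\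
    `|y `^ (A - 1) - W `^ (A - 1)| <= c1 * (W `^ (A - 1) * W^-1).
  move=> hy; have [y1 y2] : - (W / 2) <= y - W /\ y - W <= D + 1.
    by move: hy; rewrite ler_norml => /andP[z1 z2]; clear -z1 z2 WD D0; split; lra.
  have [k1 k2] := ha W D (y - W) W1 WA y1 y2.
  rewrite (_ : W + (y - W) = y) in k1 k2; last by ring.
  rewrite mD -/eD in k1 k2; split; first by rewrite mulrAC.
  apply: (le_trans k2); rewrite (_ : c1 * _ = Ca * W `^ (A - 1) * (D / W) * eD); last by rewrite /c1; ring.
  by rewrite ler_pM2r // ler_pM2l ?mulr_gt0 // ler_pM2r.
have [p1 p2] := pw w hw.
have PW0 : 0 <= W `^ (A - 1) * W^-1 by rewrite mulr_ge0 // ltW.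
have l0 : 0 < ln W by apply: ln_gt0; clear -W4; lra.
have E0 : 0 <= ln W / W + W `^ (1 - B) by rewrite addr_ge0 ?powR_ge0 // divr_ge0 // ltW.
split.
- by rewrite w1.
- by apply: (le_trans p1); rewrite ler_pM2r //; clear -t0 t2 c10; lra.
- by apply: (le_trans p2); rewrite ler_wpM2r //; clear -t0 t1 t2; lra.
- have cw : `|main_term alpha A w - main_term alpha A W - alpha * W `^ (A - 1) * (w - W)|
      <= alpha * `|w - W| * (c1 * (W `^ (A - 1) * W^-1)).
    have sq y : `|y - W| <= D -> W `^ (A - 1) - c1 * (W `^ (A - 1) * W^-1) <= y `^ (A - 1)
        <= W `^ (A - 1) + c1 * (W `^ (A - 1) * W^-1).
      by move=> /pw[_]; rewrite ler_distl.
    have [Ww|wW] := leP W w.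
      have hy y : W <= y <= w -> W `^ (A - 1) - c1 * (W `^ (A - 1) * W^-1) <= y `^ (A - 1)
        <= W `^ (A - 1) + c1 * (W `^ (A - 1) * W^-1).
        move=> /andP[? ?]; apply: sq; rewrite ger0_norm ?subr_ge0 //.
        by move: hw; rewrite ger0_norm ?subr_ge0 //; apply: le_trans; rewrite lerD2r.
      have /andP[m1 m2] := main_term_cell a0 W0 Ww hy.
      rewrite (@ger0_norm _ (w - W)) ?subr_ge0 // ler_distl; apply/andP; split.
        by apply: le_trans m1; rewrite le_eqVlt; apply/orP; left; apply/eqP; ring.
      by apply: (le_trans m2); rewrite le_eqVlt; apply/orP; left; apply/eqP; ring.
    have hy y : w <= y <= W -> W `^ (A - 1) - c1 * (W `^ (A - 1) * W^-1) <= y `^ (A - 1)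
      <= W `^ (A - 1) + c1 * (W `^ (A - 1) * W^-1).
      move=> /andP[? ?]; apply: sq; rewrite ler0_norm ?subr_le0 //.
      by move: hw; rewrite ltr0_norm ?subr_lt0 //; apply: le_trans; rewrite lerN2 lerD2r.
    have /andP[m1 m2] := main_term_cell a0 w0 (ltW wW) hy.
    rewrite (@ltr0_norm _ (w - W)) ?subr_lt0 // ler_distl; apply/andP; split.
      rewrite -[leRHS]opprB lerNr; apply: (le_trans m2).
      by rewrite le_eqVlt; apply/orP; left; apply/eqP; ring.
    rewrite -[leLHS]opprB lerNl; apply: le_trans m1.
    by rewrite le_eqVlt; apply/orP; left; apply/eqP; ring.
  apply: (le_trans cw); apply: (@le_trans _ _ (alpha * D * (c1 * (W `^ (A - 1) * W^-1)))).
    by rewrite ler_wpM2r ?(mulr_ge0 (ltW c10)) // ler_pM2l.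
  by rewrite mulrA ler_wpM2r //; clear -t0 t1 t2 c10; lra.
- have y1 : - (W / 2) <= w - W by clear -w1; lra.
  have y2 : w - W <= D + 1 by move: hw; rewrite ler_norml => /andP[_ k]; clear -k; lra.
  have [k1 _] := hb W D (w - W) W1 WB y1 y2.
  rewrite (_ : W + (w - W) = w) in k1; last by ring.
  rewrite mD -/eD mulrAC in k1.
  have l2 : ln w <= 2 * ln W.
    rewrite -[2]/(1 + 1) mulrDl mul1r -lnM ?posrE // ler_ln ?posrE ?mulr_gt0 //.
    by apply: (le_trans w2); rewrite ler_pM2r //; clear -W4; lra.
  have l3 : ln w / w <= 4 * (ln W / W).
    rewrite (_ : 4 * _ = 2 * ln W * (W / 2)^-1); last by field; rewrite gt_eqF.
    apply: ler_pM => //.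
    - by apply: ln_ge0; clear -W4 w1; lra.
    - by rewrite invr_ge0 ltW.
    - by rewrite lef_pV2 ?posrE //; clear -W0; lra.
  apply: le_trans (lerD l3 k1) _.
  have e1 : 0 < ln W / W by rewrite divr_gt0.
  have e2 : 0 < W `^ (1 - B) by rewrite powR_gt0.
  rewrite mulrDr; apply: lerD.
    by rewrite ler_pM2r //; clear -t0 t1 t2 c10; lra.
  by rewrite ler_pM2r //; clear -t0 t1 c10; lra.
Qed.

(** The factor ln w is forced by A = 0, where w^A = 1 and [main_term] is logarithmic. Dividing by ln
    2 lets it absorb the constant terms too. *)
Lemma main_term_half_le (R : realType) (alpha A CA : R) : 0 < alpha -> 0 <= A ->
  exists2 C : R, 0 <= C &
  forall w : R, 2 <= w -> CA + main_term alpha A (w / 2) <= C * (w `^ A * ln w).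
Proof.
move=> a0 A0.
have l20 : 0 < ln (2 : R) by apply: ln_gt0; lra.
have c1 : 0 <= (`|CA| + alpha / A) / ln 2 by rewrite divr_ge0 ?addr_ge0 ?divr_ge0 // ltW.
exists ((`|CA| + alpha / A) / ln 2 + alpha); first by rewrite addr_ge0 // ltW.
move=> w w2; have w0 : 0 < w by lra.
have lw : ln 2 <= ln w by rewrite ler_ln ?posrE.
have wA1 : 1 <= w `^ A by rewrite -[leLHS](powRr0 w); apply: ler_powR => //; lra.
have wA0 : 0 < w `^ A by rewrite powR_gt0.
have k1 (x : R) : 0 <= x -> x * w `^ A <= x / ln 2 * (w `^ A * ln w).
  move=> x0; have -> : x / ln 2 * (w `^ A * ln w) = x * w `^ A * (ln w / ln 2) by ring.
  by rewrite ler_peMr ?mulr_ge0 ?(ltW wA0) // ler_pdivlMr // mul1r.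
have k2 : CA <= `|CA| / ln 2 * (w `^ A * ln w).
  apply: (le_trans (ler_norm CA)); apply: le_trans (k1 _ (normr_ge0 CA)).
  by rewrite ler_peMr.
have p0 : 0 <= w `^ A * ln w by rewrite mulr_ge0 // ltW // (lt_le_trans l20).
rewrite !mulrDl.
suff : main_term alpha A (w / 2) <= alpha / A / ln 2 * (w `^ A * ln w) + alpha * (w `^ A * ln w).
  by move=> k; rewrite -addrA; apply: lerD.
rewrite /main_term; case: eqVneq => [->|A1].
  rewrite invr0 mulr0 mul0r mul0r add0r powRr0 mul1r ler_pM2l // ler_ln ?posrE ?divr_gt0 //; lra.
apply: ler_wpDr; first by rewrite mulr_ge0 // ltW.
have aA : 0 <= alpha / A by rewrite divr_ge0 // ltW.
apply: le_trans (k1 _ aA); rewrite ler_wpM2l //.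
by rewrite ge0_ler_powR ?nnegrE //; lra.
Qed.

Definition tail_rate (R : realType) (alpha beta A eta W : R) : R :=
  alpha * beta * expR (- eta - 1) * W `^ (A - 1) * expR W.

Lemma tilted_estimate (R : realType) (alpha beta A B CA : R) (q : nat -> R) (N : R -> nat)
    (V1 Cc Ch C0 K Cq : R) :
  0 < alpha -> 0 < beta -> 0 <= A -> A < B -> 1 < B -> 2 <= V1 -> 0 < Cc -> 0 < Ch ->
  0 <= C0 -> 0 <= K -> 0 <= Cq ->
  regular_count alpha beta A B q N (fun v => CA + main_term alpha A v) V1 Cc Ch ->
  exists C w2 : R, [/\ 0 < C, 4 <= w2 &
  forall (Lam : nat -> R -> R) (g : R -> R) (W z y : R),
  coupled_family C0 K Lam g -> w2 <= W -> `|y| <= 3 -> expR W * W <= Cq * expR z ->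
  `|\sum_(n < N z) Lam n (beta * expR (W - 1 - eta_tail g 0 + y) / q n)
    - beta * expR (W - 1 - eta_tail g 0 + y) * (CA + main_term alpha A W)
    + tail_rate alpha beta A (eta_tail g 0) W * (expR y * (1 - y))|
  <= C * (tail_rate alpha beta A (eta_tail g 0) W * (ln W / W + W `^ (1 - B)))].
Proof.
move=> a0 b0 A0 AB B1 V2 Cc0 Ch0 C00 K0 Cq0 rc.
have [Cp Cp0 hCp] := main_term_half_le CA a0 A0.
have hPsi w : V1 <= w -> CA + main_term alpha A (w / 2) <= Cp * (w `^ A * ln w).
  by move=> hw; apply: hCp; lra.
(* [H] is the value at 0 of the bound [eta_tail_le], hence bounds |eta| for every law; [D] adds 1
   and the bound 3 on |y|. *)
pose H := 16 + 8 * C0; pose D := H + 4.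
have H0 : 0 < H by rewrite /H; lra.
have D1 : 1 <= D by rewrite /D; lra.
pose Cz := 2 * (expR D * Cq).
have Cz0 : 0 <= Cz by rewrite !mulr_ge0 ?expR_ge0.
have [C1 C10 h1] := log_mgf_sum a0 b0 A0 AB B1 V2 Cc0 Ch0 C00 K0 Cp0 Cz0 rc hPsi.
have [C2 [w1 [C20 w14 h2]]] := window_bounds A a0 B1 D1.
have ab0 : 0 < alpha * beta by rewrite mulr_gt0.
pose Cs := C1 * C2 ^+ 2 + beta * C2 + alpha * beta * H * C2.
have Cs0 : 0 < Cs by rewrite !addr_gt0 ?mulr_gt0 ?exprn_gt0.
exists (Cs * (expR 3 / (alpha * beta))), (w1 + 2 * V1 + 8 + 2 * Cz); split.
- by rewrite mulr_gt0 // divr_gt0 ?expR_gt0.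
- by lra.
move=> Lam g W z y cf hW y3 hz.
set eta := eta_tail g 0; set s := beta * expR (W - 1 - eta + y).
set M := tail_rate _ _ _ _ _.
have gc := cf_limit cf.
have [W1 WV W8 WC] : [/\ w1 <= W, V1 <= W / 2, 4 <= W / 2 & Cz <= W / 2].
  by clear -hW w14 V2 Cz0; split; lra.
clear hW.
have W0 : 0 < W by clear -W8; lra.
have etaH : `|eta| <= H.
  have := eta_tail_le C00 gc (lexx 0); by rewrite addr0 ln1 addr0 divr1.
pose w := W - 1 - eta + y.
have wW : `|w - W| <= D.
  rewrite (_ : w - W = y - (1 + eta)); last by rewrite /w; ring.
  apply: le_trans (ler_normB _ _) _; apply: le_trans (lerD (lexx _) (ler_normD _ _)) _.
  by rewrite normr1 /D; clear -y3 etaH; lra.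
have [/andP[u1 u2] p1 p2 p3 p4] := h2 W w W1 wW.
have V1w := le_trans WV u1; have w4 := le_trans W8 u1; have Czw := le_trans WC u1.
have w0 : 0 < w by clear -w4; lra.
have hzw : expR w * w <= Cz * expR z.
  apply: (@le_trans _ _ ((expR D * expR W) * (2 * W))).
    apply: ler_pM; rewrite ?expR_ge0 ?(ltW w0) // -expRD ler_expR.
    by move: wW; rewrite ler_norml => /andP[_ k]; clear -k; lra.
  rewrite (_ : _ * (2 * W) = 2 * expR D * (expR W * W)); last by ring.
  rewrite /Cz (_ : _ * expR z = 2 * expR D * (Cq * expR z)); last by ring.
  by rewrite ler_wpM2l // mulr_ge0 ?expR_ge0.
have t1 := h1 Lam g w z cf V1w w4 Czw hzw.
pose Ew := ln W / W + W `^ (1 - B).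
have l1 : 1 <= ln W.
  rewrite -[leLHS](expRK 1) ler_ln ?posrE ?expR_gt0 //; apply: le_trans (@expR1_le4 R) _.
  by clear -W8; lra.
have e1 : W^-1 <= Ew.
  rewrite /Ew ler_wpDr ?powR_ge0 // ler_peMl // invr_ge0 ltW //.
have Wi0 : 0 < W^-1 by rewrite invr_gt0.
have E0 : 0 < Ew by apply: lt_le_trans e1.
have [P PE P0] : exists2 P, P = W `^ (A - 1) & 0 < P by exists (W `^ (A - 1)) => //; rewrite powR_gt0.
rewrite -PE in p1 p2 p3.
pose G := expR w * P.
have G0 : 0 < G by rewrite mulr_gt0 ?expR_gt0.
have MG : M * expR y = alpha * beta * G.
  rewrite /M /tail_rate /G -PE (_ : w = - eta - 1 + W + y); last by rewrite /w; ring.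
  by rewrite !expRD; ring.
have M0 : 0 < M by rewrite /M /tail_rate -PE !mulr_gt0 ?expR_gt0.
have GM : G <= M * (expR 3 / (alpha * beta)).
  rewrite mulrA ler_pdivlMr // [leLHS]mulrC -MG ler_pM2l // ler_expR.
  by move: y3; rewrite ler_norml => /andP[].
have k1 : C1 * (expR w * w `^ (A - 1)) * (ln w / w + w `^ (1 - B)) <= C1 * C2 ^+ 2 * (G * Ew).
  rewrite (_ : C1 * C2 ^+ 2 * _ = C1 * (expR w * (C2 * P)) * (C2 * Ew)); last by rewrite /G; ring.
  apply: ler_pM => //.
  - by rewrite !mulr_ge0 ?expR_ge0 ?powR_ge0 // ltW.
  - by rewrite addr_ge0 ?powR_ge0 // divr_ge0 ?ln_ge0 ?(ltW w0) //; clear -w4; lra.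
  - by rewrite ler_pM2l // ler_pM2l ?expR_gt0.
have k2 : `|beta * expR w * (main_term alpha A w - main_term alpha A W - alpha * P * (w - W))|
    <= beta * C2 * (G * Ew).
  rewrite normrM (gtr0_norm (mulr_gt0 b0 (expR_gt0 _))).
  rewrite (_ : beta * C2 * _ = beta * expR w * (C2 * (P * Ew))); last by rewrite /G; ring.
  rewrite ler_pM2l ?mulr_gt0 ?expR_gt0 //; apply: (le_trans p3).
  by rewrite ler_pM2l // ler_pM2l.
have k3 : `|alpha * beta * eta * expR w * (w `^ (A - 1) - P)| <= alpha * beta * H * C2 * (G * Ew).
  rewrite !normrM (gtr0_norm a0) (gtr0_norm b0) (gtr0_norm (expR_gt0 _)).
  rewrite (_ : alpha * beta * H * C2 * _ = alpha * beta * H * expR w * (C2 * (P * Ew))); last by rewrite /G; ring.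
  apply: ler_pM => //.
  - by rewrite !mulr_ge0 ?expR_ge0 // ltW.
  - by rewrite ler_pM2r ?expR_gt0 // ler_pM2l.
  - by apply: (le_trans p2); rewrite ler_pM2l // ler_pM2l.
(* The main terms combine exactly: beta e^w alpha P ((w - W) + eta) with w - W = y - 1 - eta equals
   -M e^y (1 - y). The choice of -1 - eta makes y = 0 the critical point. *)
have -> : \sum_(n < N z) Lam n (s / q n) - s * (CA + main_term alpha A W) + M * (expR y * (1 - y)) =
  (\sum_(n < N z) Lam n (beta * expR w / q n)
    - beta * expR w * (CA + main_term alpha A w + alpha * w `^ (A - 1) * eta)) +
  beta * expR w * (main_term alpha A w - main_term alpha A W - alpha * P * (w - W)) +
  alpha * beta * eta * expR w * (w `^ (A - 1) - P).
  rewrite mulrA MG /G /s -/w (_ : w - W = y - 1 - eta); last by rewrite /w; ring.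
  by ring.
apply: le_trans (ler_normD _ _) _; apply: le_trans (lerD (ler_normD _ _) (lexx _)) _.
apply: (@le_trans _ _ (Cs * (G * Ew))).
  rewrite /Cs !mulrDl; apply: lerD => //; apply: lerD => //; exact: le_trans t1 k1.
rewrite -/Ew (_ : Cs * (expR 3 / _) * _ = Cs * (M * (expR 3 / (alpha * beta)) * Ew)); last by ring.
by rewrite ler_pM2l // ler_pM2r.
Qed.

(** * The saddle point *)

(** Quantifies the strict maximum of e^y (1 - y) at y = 0, which separates neighbouring tilts.
    Completing the square of e^(t/2) (1 - t/2) <= 1 produces the quadratic gain; the next lemma does
    the same for negative y. *)
Lemma expR_mul1B_le (R : realType) (t : R) : 0 <= t <= 1 -> expR t * (1 - t) <= 1 - t ^+ 2 / 4.
Proof.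
move=> /andP[t0 t1].
have h : expR (t / 2) * (1 - t / 2) <= 1.
  by rewrite mulrC -ler_pdivlMr ?expR_gt0 // mul1r -expRN; have := expR_ge1Dx (- (t / 2)); lra.
have h0 : 0 <= expR (t / 2) * (1 - t / 2) by rewrite mulr_ge0 ?expR_ge0 //; lra.
have h2 : (expR (t / 2) * (1 - t / 2)) ^+ 2 <= 1 by rewrite expr_le1.
have e1 : 1 <= expR t by rewrite -[leLHS](@expR0 R) ler_expR.
have -> : expR t * (1 - t) = (expR (t / 2) * (1 - t / 2)) ^+ 2 - expR t * (t ^+ 2 / 4).
  have -> : expR t = expR (t / 2) ^+ 2 by rewrite -expRM_natr; congr expR; field.
  by field.
have k : t ^+ 2 / 4 <= expR t * (t ^+ 2 / 4) by rewrite ler_peMl // divr_ge0 ?exprn_ge0.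
lra.
Qed.

Lemma expRN_mul1D_le (R : realType) (t : R) : 0 <= t <= 1 -> expR (- t) * (1 + t) <= 1 - t ^+ 2 / 16.
Proof.
move=> /andP[t0 t1].
have h : expR (- (t / 2)) * (1 + t / 2) <= 1.
  by rewrite mulrC -ler_pdivlMr ?expR_gt0 // mul1r -expRN opprK; exact: expR_ge1Dx.
have h0 : 0 <= expR (- (t / 2)) * (1 + t / 2) by rewrite mulr_ge0 ?expR_ge0 //; lra.
have h2 : (expR (- (t / 2)) * (1 + t / 2)) ^+ 2 <= 1 by rewrite expr_le1.
have e1 : 4^-1 <= expR (- t).
  rewrite expRN lef_pV2 ?posrE ?expR_gt0 //; apply: le_trans (@expR1_le4 R); by rewrite ler_expR.
have -> : expR (- t) * (1 + t) = (expR (- (t / 2)) * (1 + t / 2)) ^+ 2 - expR (- t) * (t ^+ 2 / 4).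
  have -> : expR (- t) = expR (- (t / 2)) ^+ 2 by rewrite -expRM_natr; congr expR; field.
  by field.
have k : 4^-1 * (t ^+ 2 / 4) <= expR (- t) * (t ^+ 2 / 4) by rewrite ler_wpM2r // divr_ge0 ?exprn_ge0.
lra.
Qed.

(** With eps^2 = 48 delta the drops eps^2/4 and eps^2/16 are 12 delta and 3 delta. Even the smaller
    exceeds the two errors delta by delta, and M' delta >= 2 makes each outer part at most e^(-2) <=
    1/4 of the tilted mass. Half remains for V < H <= V'. *)
Lemma saddle_point_bounds (d : measure_display) (T : measurableType d) (R : realType)
    (P : probability T R) (H : T -> R) (L : R -> R) (s0 s s2 V V' M M' delta eps : R) :
  measurable_fun setT H ->
  (forall u : R, (\int[P]_w (expR (u * H w))%:E = (expR (L u))%:E)%E) ->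
  0 <= s0 -> s0 <= s <= s2 -> 0 <= M -> 0 <= M' -> 0 <= eps <= 1 -> eps ^+ 2 = 48 * delta ->
  2 <= M * delta -> 2 <= M' * delta ->
  L s0 <= s0 * V - M + M * delta ->
  s * V - M * (expR eps * (1 - eps)) - M * delta <= L s ->
  L s2 <= s2 * V' - M' + M' * delta ->
  s * V' - M' * (expR (- eps) * (1 + eps)) - M' * delta <= L s ->
  expR (- (M' * (1 + 2 * delta))) <= fine (P [set w | V < H w]) <= expR (- (M * (1 - delta))).
Proof.
move=> mH mgfH s00 /andP[s0s ss2] M0 M'0 eps01 ed Md M'd e1 e2 e3 e4.
have s_ge0 : 0 <= s by lra.
apply/andP; split; last first.
  by apply: (le_trans (tail_upper_bound mH mgfH V s00)); rewrite ler_expR mulrBr mulr1; clear -e1; lra.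
have ss : s0 <= s <= s2 by rewrite s0s.
have low := tail_lower_bound mH mgfH V V' s_ge0 ss.
set p := fine _ in low *.
have g1 := ler_wpM2l M0 (expR_mul1B_le eps01).
have g2 := ler_wpM2l M'0 (expRN_mul1D_le eps01).
rewrite ed in g1 g2.
have e2' : expR (- 2) <= 4^-1 :> R.
  rewrite expRN lef_pV2 ?posrE ?expR_gt0 // (_ : 2 = 1 + 1) // expRD.
  have := expR_ge1Dx (1 : R) => k.
  have : 2 * 2 <= expR 1 * expR 1 :> R by apply: ler_pM; lra.
  lra.
have q1 : expR ((s - s0) * V + L s0) <= 4^-1 * expR (L s).
  apply: (@le_trans _ _ (expR (- 2) * expR (L s))); last by rewrite ler_wpM2r ?expR_ge0.
  by rewrite -expRD ler_expR; clear -e1 e2 g1 Md; lra.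
have q2 : expR (L s2 - (s2 - s) * V') <= 4^-1 * expR (L s).
  apply: (@le_trans _ _ (expR (- 2) * expR (L s))); last by rewrite ler_wpM2r ?expR_ge0.
  by rewrite -expRD ler_expR; clear -e3 e4 g2 M'd; lra.
have q3 : 2^-1 * expR (L s - s * V') <= p.
  rewrite expRD expRN mulrA ler_pdivrMr ?expR_gt0 // [leRHS]mulrC.
  by clear -low q1 q2; lra.
apply: le_trans q3.
have e1' : expR (- 1) <= 2^-1 :> R.
  by rewrite expRN lef_pV2 ?posrE ?expR_gt0 //; have := expR_ge1Dx (1 : R); lra.
apply: (@le_trans _ _ (expR (- 1) * expR (L s - s * V'))); last by rewrite ler_wpM2r ?expR_ge0.
rewrite -expRD ler_expR.
have d0 : 0 <= M' * (48 * delta / 16) by clear -M'd; lra.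
by clear -e4 g2 M'd d0; lra.
Qed.

Lemma saddle_error_small (R : realType) (B k : R) : 1 < B -> 0 < k ->
  exists2 w3 : R, 4 <= w3 & forall W, w3 <= W -> ln W / W + W `^ (1 - B) <= k.
Proof.
move=> B1 k0; have B0 : 0 < B - 1 by lra.
pose a := Num.max 1 (2 / k) `^ (B - 1)^-1.
have m0 : 0 < Num.max 1 (2 / k) by rewrite lt_max ltr01.
exists (4 + 16 / k ^+ 2 + a).
  have : 0 <= 16 / k ^+ 2 by rewrite divr_ge0 ?exprn_ge0 // ltW.
  have : 0 <= a by rewrite powR_ge0.
  lra.
move=> W hW.
have a0 : 0 < a by rewrite powR_gt0.
have k16 : 0 < 16 / k ^+ 2 by rewrite divr_gt0 ?exprn_gt0.
have Wa : a <= W by lra.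
have Wk : 16 / k ^+ 2 <= W by lra.
have W0 : 0 < W by lra.
have l1 : ln W / W <= k / 2.
  pose r := Num.sqrt W; have r0 : 0 < r by rewrite sqrtr_gt0.
  have WE : W = r * r by rewrite -expr2 sqr_sqrtr // ltW.
  have lr : ln W <= 2 * r.
    by rewrite WE lnM ?posrE //; have := ln_le_subr1 r0; lra.
  have kr : 4 / k <= r.
    rewrite -(ler_pXn2r (n := 2)) ?nnegrE ?divr_ge0 ?(ltW r0) ?(ltW k0) //.
    by rewrite [leRHS]expr2 -WE expr_div_n; apply: le_trans Wk; rewrite ler_pM2r ?invr_gt0 ?exprn_gt0 // expr2; lra.
  rewrite ler_pdivrMr //; apply: (le_trans lr); rewrite [in leRHS]WE mulrA ler_pM2r //.
  by move: kr; rewrite ler_pdivrMr //; lra.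
have l2 : W `^ (1 - B) <= k / 2.
  have h : Num.max 1 (2 / k) <= W `^ (B - 1).
    have -> : Num.max 1 (2 / k) = a `^ (B - 1).
      by rewrite /a -powRrM mulVf ?gt_eqF // powRr1 // ltW.
    by rewrite ge0_ler_powR ?nnegrE // ltW.
  rewrite (_ : 1 - B = - (B - 1)); last by ring.
  rewrite powRN -[leRHS]invrK lef_pV2 ?posrE ?powR_gt0 ?invr_gt0 ?divr_gt0 //.
  by apply: le_trans h; rewrite invf_div le_max lexx orbT.
lra.
Qed.

(** Supplies M delta >= 2 in [saddle_point_bounds], since delta will be at least 1/W. The threshold
    depends on eta only through its bound. *)
Lemma tail_rate_large (R : realType) (alpha beta A H : R) : 0 < alpha -> 0 < beta -> 0 <= A ->
  exists2 w3 : R, 4 <= w3 &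
  forall eta W : R, `|eta| <= H -> w3 <= W -> 2 <= tail_rate alpha beta A eta W * W^-1.
Proof.
move=> a0 b0 A0.
pose c := alpha * beta * expR (- H - 1); have c0 : 0 < c by rewrite !mulr_gt0 ?expR_gt0.
exists (4 + 54 / c); first by rewrite lerDl divr_ge0 // ltW.
move=> eta W He hW.
have c54 : 0 < 54 / c by rewrite divr_gt0.
have W0 : 0 < W by lra.
have W1 : 1 <= W by lra.
have Wc : 54 / c <= W by lra.
rewrite /tail_rate.
have k1 : c <= alpha * beta * expR (- eta - 1).
  by rewrite /c ler_pM2l ?mulr_gt0 // ler_expR; move: He; rewrite ler_norml => /andP[_ h]; clear -h; lra.
have k2 : W^-1 <= W `^ (A - 1).
  by rewrite -powR_inv1 ?(ltW W0) //; apply: ler_powR => //; clear -A0; lra.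
have k3 : W ^+ 3 / 27 <= expR W.
  have -> : W ^+ 3 / 27 = (W / 3) ^+ 3 by field.
  have -> : expR W = expR (W / 3) ^+ 3 by rewrite -expRM_natr; congr expR; field.
  rewrite lerXn2r ?nnegrE ?expR_ge0 ?divr_ge0 ?(ltW W0) //.
  by have := expR_ge1Dx (W / 3); clear; lra.
have Wi0 : 0 < W^-1 by rewrite invr_gt0.
apply: (@le_trans _ _ (c * W^-1 * (W ^+ 3 / 27) * W^-1)).
  have -> : c * W^-1 * (W ^+ 3 / 27) * W^-1 = c * W / 27 by field; rewrite gt_eqF.
  by move: Wc; rewrite ler_pdivrMr // [X in _ <= X -> _]mulrC; clear; lra.
rewrite ler_pM2r //; apply: ler_pM => //.
- by rewrite mulr_ge0 // ltW.
- by rewrite divr_ge0 // exprn_ge0 // ltW.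
- by apply: ler_pM => //; rewrite ltW.
Qed.

(** The lower bound for the probability has the rate of W + 2e; returning to W costs a relative
    O(e). Expanding the product and using e^2, e^3 <= e gives 98 = 34 + 64 and 99 = 1 + 34 + 64. *)
Lemma tail_rate_window (R : realType) (alpha beta A eta W e c : R) : 0 < alpha -> 0 < beta ->
  0 < W -> 0 <= e <= 1 -> 0 <= c -> (W + 2 * e) `^ (A - 1) <= W `^ (A - 1) * (1 + c * e) ->
  tail_rate alpha beta A eta (W + 2 * e) * (1 + 2 * e)
    <= tail_rate alpha beta A eta W * (1 + (98 + 99 * c) * e).
Proof.
move=> a0 b0 W0 /andP[e0 e1] c0 hW; rewrite /tail_rate.
set k := alpha * beta * expR (- eta - 1).
have k0 : 0 < k by rewrite !mulr_gt0 ?expR_gt0.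
have P0 : 0 < W `^ (A - 1) by rewrite powR_gt0.
have ee : expR (2 * e) <= 1 + 32 * e.
  have h1 := expR_sub1_le (2 * e).
  have h2 : expR (2 * e) <= 16.
    have h : expR (2 * e) <= expR (1 + 1) by rewrite ler_expR; lra.
    apply: (le_trans h); rewrite expRD; have := @expR1_le4 R; have := expR_ge0 (1 : R) => u v.
    by apply: le_trans (_ : 4 * 4 <= _); [apply: ler_pM|lra].
  have h3 : 2 * e * expR (2 * e) <= 2 * e * 16 by rewrite ler_wpM2l // mulr_ge0.
  lra.
apply: (@le_trans _ _ (k * (W `^ (A - 1) * (1 + c * e)) * (expR W * (1 + 32 * e)) * (1 + 2 * e))).
  rewrite ler_wpM2r ?addr_ge0 ?mulr_ge0 //; apply: ler_pM.
  - by rewrite mulr_ge0 ?powR_ge0 // ltW.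
  - exact: expR_ge0.
  - by rewrite ler_pM2l.
  - by rewrite expRD ler_pM2l ?expR_gt0.
rewrite (_ : _ * (1 + 2 * e) = k * W `^ (A - 1) * expR W * ((1 + c * e) * (1 + 32 * e) * (1 + 2 * e))); last by ring.
rewrite ler_pM2l ?mulr_gt0 ?expR_gt0 //.
have t1 : e ^+ 2 <= e by rewrite expr2 ler_piMr.
have t2 : e ^+ 3 <= e by rewrite exprS ler_piMr // exprn_ile1.
have t3 : c * e ^+ 2 <= c * e by rewrite ler_wpM2l.
have t4 : c * e ^+ 3 <= c * e by rewrite ler_wpM2l.
rewrite (_ : _ * (1 + 2 * e) = 1 + 34 * e + 64 * e ^+ 2 + c * e + 34 * (c * e ^+ 2) + 64 * (c * e ^+ 3)); last by ring.
lra.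
Qed.

Lemma tail_estimate (R : realType) (alpha beta A B CA : R) (q : nat -> R) (N : R -> nat)
    (V1 Cc Ch C0 K Cq : R) :
  0 < alpha -> 0 < beta -> 0 <= A -> A < B -> 1 < B -> 2 <= V1 -> 0 < Cc -> 0 < Ch ->
  0 <= C0 -> 0 <= K -> 0 <= Cq ->
  regular_count alpha beta A B q N (fun v => CA + main_term alpha A v) V1 Cc Ch ->
  exists C w0 : R, [/\ 0 < C, 4 <= w0 &
  forall (d : measure_display) (T : measurableType d) (P : probability T R) (H : T -> R)
    (Lam : nat -> R -> R) (g : R -> R) (W z : R),
  measurable_fun setT H -> coupled_family C0 K Lam g ->
  (forall u : R, (\int[P]_w (expR (u * H w))%:E = (expR (\sum_(n < N z) Lam n (u / q n)))%:E)%E) ->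
  w0 <= W -> expR W * W <= Cq * expR z ->
  exists2 delta : R, `|delta| <= C * Num.sqrt (ln W / W + W `^ (1 - B)) &
    fine (P [set w | CA + main_term alpha A W < H w])
      = expR (- (tail_rate alpha beta A (eta_tail g 0) W * (1 + delta)))].
Proof.
move=> a0 b0 A0 AB B1 V2 Cc0 Ch0 C00 K0 Cq0 rc.
(* Allows the size condition at W' <= W + 2 as well: e^W' <= e^2 e^W and W' <= 3 W. *)
pose Cq' := 3 * (expR 2 * Cq).
have Cq'0 : 0 <= Cq' by rewrite !mulr_ge0 ?expR_ge0.
have [C1 [w1 [C10 w14 h1]]] := tilted_estimate a0 b0 A0 AB B1 V2 Cc0 Ch0 C00 K0 Cq'0 rc.
have D2 : 1 <= 2 :> R by lra.
have [C2 [w2 [C20 w24 h2]]] := window_bounds A a0 B1 D2.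
pose Hb := 16 + 8 * C0.
have [w3 w34 h3] := tail_rate_large Hb a0 b0 A0.
(* Makes the single delta = Cd E(W) dominate both E and C1 E, at W and at W', where E(W') <= C2
   E(W). The bound (48 Cd)^(-1) on E(W) below then ensures e <= 1. *)
pose Cd := (C1 + 1) * (C2 + 1).
have Cd1 : 1 <= Cd.
  have : 0 < C1 * C2 by rewrite mulr_gt0.
  by rewrite /Cd; lra.
have Cd0 : 0 < Cd by lra.
have k0 : 0 < (48 * Cd)^-1 by rewrite invr_gt0 mulr_gt0.
have [w5 w54 h5] := saddle_error_small B1 k0.
pose C3 := 98 + 99 * C2.
have C30 : 0 < C3 by rewrite /C3; lra.
exists (C3 * Num.sqrt (48 * Cd)), (w1 + w2 + w3 + w5); split.
- by rewrite mulr_gt0 // sqrtr_gt0 mulr_gt0.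
- by lra.
move=> d T P H Lam g W z mH cf mgfH hW hz.
have gc := cf_limit cf.
have W1 : w1 <= W by lra.
have W2 : w2 <= W by lra.
have W3 : w3 <= W by lra.
have W5 : w5 <= W by lra.
have W4 : 4 <= W by lra.
clear hW.
have W0 : 0 < W by clear -W4; lra.
set eta := eta_tail g 0.
have etaH : `|eta| <= Hb.
  have := eta_tail_le C00 gc (lexx 0); by rewrite addr0 ln1 addr0 divr1.
pose E x := ln x / x + x `^ (1 - B).
have Einv x : 4 <= x -> x^-1 <= E x.
  move=> x4; rewrite /E ler_wpDr ?powR_ge0 // ler_peMl ?invr_ge0 //; first by clear -x4; lra.
  rewrite -[leLHS](expRK 1) ler_ln ?posrE ?expR_gt0 //; last by clear -x4; lra.
  exact: le_trans (@expR1_le4 R) x4.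
have EW := Einv W W4.
have E0 : 0 < E W by apply: lt_le_trans EW; rewrite invr_gt0.
pose de := Cd * E W; pose e := Num.sqrt (48 * de).
have de0 : 0 < de by rewrite mulr_gt0.
have e2 : e ^+ 2 = 48 * de by rewrite sqr_sqrtr // mulr_ge0 // ltW.
have e0 : 0 < e by rewrite sqrtr_gt0 mulr_gt0.
have e1 : e <= 1.
  have k48 : 0 < 48 * Cd by rewrite mulr_gt0.
  rewrite -sqrtr1 ler_wsqrtr // /de mulrA; have := h5 W W5.
  by rewrite -(ler_pM2l k48) mulfV // gt_eqF.
have e01 : 0 <= e <= 1 by rewrite (ltW e0).
have ee : 48 * de <= e by rewrite -e2 expr2 ler_piMr // ltW.
pose W' := W + 2 * e.
have WW' : W <= W' by rewrite /W'; clear -e0; lra.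
have dW : `|W' - W| <= 2 by rewrite /W' addrAC subrr add0r ger0_norm; clear -e0 e1; lra.
have [_ _ p2 _ p4] := h2 W W' W2 dW.
have W'4 := le_trans W4 WW'.
have EW' : W'^-1 <= E W' := Einv W' W'4.
pose M := tail_rate alpha beta A eta W; pose M' := tail_rate alpha beta A eta W'.
have M0 : 0 < M by rewrite /M /tail_rate !mulr_gt0 ?expR_gt0 ?powR_gt0.
have M'0 : 0 < M'.
  by rewrite /M' /tail_rate !mulr_gt0 ?expR_gt0 ?powR_gt0 //; clear -W'4; lra.
have dE : C1 * E W <= de by rewrite /de ler_pM2r // /Cd; have := mulr_gt0 C10 C20; clear -C20 C10; lra.
have E'E : E W' <= C2 * E W by exact: p4.
have dE'' : (C1 + 1) * E W' <= de.
  apply: (@le_trans _ _ ((C1 + 1) * (C2 * E W))); first by rewrite ler_wpM2l //; clear -C10; lra.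
  rewrite /de /Cd -mulrA ler_wpM2l //; first by clear -C10; lra.
  by rewrite ler_pM2r //; clear; lra.
have E'0 : 0 < E W' by apply: lt_le_trans EW'; rewrite invr_gt0; clear -W'4; lra.
have dE' : C1 * E W' <= de by clear -dE'' E'0; lra.
have dE1 : E W' <= de by have := mulr_gt0 C10 E'0; clear -dE''; lra.
have dE0 : E W <= de by rewrite /de ler_peMl // ltW.
have hzW : expR W * W <= Cq' * expR z.
  apply: (le_trans hz); rewrite ler_wpM2r ?expR_ge0 // /Cq' mulrA ler_peMl //.
  by have := expR_ge1Dx (2 : R); clear; lra.
have hzW' : expR W' * W' <= Cq' * expR z.
  apply: (@le_trans _ _ (expR 2 * expR W * (3 * W))).
    apply: ler_pM; rewrite ?expR_ge0 //.
    - by clear -W'4; lra.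
    - by rewrite -expRD ler_expR /W'; clear -e1; lra.
    - by rewrite /W'; clear -e1 W4; lra.
  rewrite (_ : _ * (3 * W) = 3 * expR 2 * (expR W * W)); last by ring.
  rewrite (_ : Cq' * _ = 3 * expR 2 * (Cq * expR z)); last by rewrite /Cq'; ring.
  by rewrite ler_wpM2l // mulr_ge0 ?expR_ge0.
have W'1 := le_trans W1 WW'; have W'3 := le_trans W3 WW'.
have n0 : `|0 : R| <= 3 by rewrite normr0.
have ne : `|e| <= 3 by rewrite ger0_norm ?(ltW e0) //; clear -e1; lra.
have nne : `|- e| <= 3 by rewrite normrN.
have t1 := h1 Lam g W z 0 cf W1 n0 hzW.
have t2 := h1 Lam g W z e cf W1 ne hzW.
have t3 := h1 Lam g W' z 0 cf W'1 n0 hzW'.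
have t4 := h1 Lam g W' z (- e) cf W'1 nne hzW'.
rewrite -/eta -/M -/M' -/(E W) -/(E W') in t1 t2 t3 t4.
have up x : 0 < x -> forall y m, y <= C1 * (m * x) -> 0 < m -> C1 * x <= de -> y <= m * de.
  move=> x0 y m hy m0 hx; apply: (le_trans hy).
  by rewrite mulrCA ler_pM2l.
move: t1 t2 t3 t4 => /(up _ E0)/(_ M0 dE) t1 /(up _ E0)/(_ M0 dE) t2
  /(up _ E'0)/(_ M'0 dE') t3 /(up _ E'0)/(_ M'0 dE') t4.
rewrite expR0 mul1r subr0 mulr1 !addr0 in t1 t3.
set s0 := beta * expR (W - 1 - eta) in t1.
set s := beta * expR (W - 1 - eta + e) in t2.
set s2 := beta * expR (W' - 1 - eta) in t3.
(* Reason for the shift 2e: the same s lies e above the saddle point of W and e below that of W', so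
   [tilted_estimate] expands L(s) around both. *)
have sE : beta * expR (W' - 1 - eta + - e) = s.
  by rewrite /s /W'; congr (_ * expR _); ring.
rewrite sE opprK in t4.
pose L u := \sum_(n < N z) Lam n (u / q n).
have s00 : 0 <= s0 by rewrite mulr_ge0 ?expR_ge0 // ltW.
have sss : s0 <= s <= s2.
  by rewrite !ler_pM2l // !ler_expR /W'; apply/andP; split; clear -e0; lra.
have Md : 2 <= M * de.
  by apply: le_trans (h3 eta W etaH W3) _; rewrite ler_pM2l // (le_trans EW).
have M'd : 2 <= M' * de.
  by apply: le_trans (h3 eta W' etaH W'3) _; rewrite ler_pM2l // (le_trans EW').
have v1 : L s0 <= s0 * (CA + main_term alpha A W) - M + M * de.
  by move: t1; rewrite ler_norml => /andP[_]; rewrite /L; clear; lra.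
have v2 : s * (CA + main_term alpha A W) - M * (expR e * (1 - e)) - M * de <= L s.
  by move: t2; rewrite ler_norml => /andP[+ _]; rewrite /L; clear; lra.
have v3 : L s2 <= s2 * (CA + main_term alpha A W') - M' + M' * de.
  by move: t3; rewrite ler_norml => /andP[_]; rewrite /L; clear; lra.
have v4 : s * (CA + main_term alpha A W') - M' * (expR (- e) * (1 + e)) - M' * de <= L s.
  by move: t4; rewrite ler_norml => /andP[+ _]; rewrite /L; clear; lra.
have := saddle_point_bounds mH mgfH s00 sss (ltW M0) (ltW M'0) e01 e2 Md M'd v1 v2 v3 v4.
set p := fine _ => /andP[lo hi].
have p0 : 0 < p by apply: lt_le_trans lo; exact: expR_gt0.
have lo' : - (M' * (1 + 2 * de)) <= ln p by rewrite -[leLHS]expRK ler_ln ?posrE ?expR_gt0.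
have hi' : ln p <= - (M * (1 - de)) by rewrite -[leRHS]expRK ler_ln ?posrE ?expR_gt0.
have We : W^-1 <= e by apply: (le_trans EW); apply: (le_trans dE0); clear -ee de0; lra.
have pw : W' `^ (A - 1) <= W `^ (A - 1) * (1 + C2 * e).
  rewrite mulrDr mulr1 -lerBlDl; apply: le_trans (ler_norm _) _; apply: (le_trans p2).
  by rewrite [leRHS]mulrCA ler_pM2l // ler_wpM2l // powR_ge0.
have rw := tail_rate_window eta a0 b0 W0 e01 (ltW C20) pw.
rewrite -/M -/C3 in rw.
(* The delta that makes the formula exact; it exists because the lower bound gives p > 0. *)
exists (- ln p / M - 1).
  have -> : C3 * Num.sqrt (48 * Cd) * Num.sqrt (ln W / W + W `^ (1 - B)) = C3 * e.
    have k48 : 0 <= 48 * Cd by rewrite mulr_ge0 // ltW.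
    by rewrite -mulrA /e /de [48 * (Cd * _)]mulrA (sqrtrM _ k48).
  rewrite ler_norml; apply/andP; split.
    have : 1 - de <= - ln p / M by rewrite ler_pdivlMr // mulrC; clear -hi'; lra.
    have : de <= C3 * e.
      have : e <= C3 * e by rewrite ler_peMl ?(ltW e0) // /C3; clear -C20; lra.
      by clear -ee de0; lra.
    by clear; lra.
  rewrite lerBlDr addrC ler_pdivrMr // [leRHS]mulrC; apply: le_trans rw.
  rewrite -/W' -/M'; apply: (@le_trans _ _ (M' * (1 + 2 * de))); first by clear -lo'; lra.
  by rewrite ler_pM2l //; clear -ee de0; lra.
rewrite -/M addrC subrK mulrC divfK ?gt_eqF // opprK lnK //.
Qed.

(** * From the abstract estimate to the stated range and error *)

Lemma main_term_Wfun (R : realType) (alpha A CA V : R) : 0 < alpha -> 0 <= A -> 1 + CA <= V ->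
  CA + main_term alpha A (Wfun alpha A CA V) = V.
Proof.
move=> a0 A0 hV; rewrite /main_term /Wfun; case: eqVneq => [_|A1].
  by rewrite expRK mulrC divfK ?gt_eqF // addrC subrK.
have A_gt0 : 0 < A by rewrite lt_neqAle eq_sym A1.
have x0 : 0 <= A / alpha * (V - CA) by rewrite mulr_ge0 ?divr_ge0 ?(ltW a0) //; lra.
rewrite -powRrM mulVf // powRr1 //; field.
by rewrite A1 gt_eqF.
Qed.

(** The two terms on the right square to ln W / W and W^(1-B), and the square root is
    subadditive. *)
Lemma sqrt_saddle_error (R : realType) (B W : R) : 1 <= W ->
  Num.sqrt (ln W / W + W `^ (1 - B)) <= Num.sqrt (ln W) / Num.sqrt W + (W `^ ((B - 1) / 2))^-1.
Proof.
move=> W1; have W0 : 0 < W by lra.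
have l0 : 0 <= ln W by exact: ln_ge0.
have s0 : 0 <= Num.sqrt (ln W) / Num.sqrt W by rewrite divr_ge0 ?sqrtr_ge0.
have p0 : 0 <= (W `^ ((B - 1) / 2))^-1 by rewrite invr_ge0 powR_ge0.
rewrite -[leRHS]ger0_norm ?addr_ge0 // -sqrtr_sqr ler_wsqrtr // sqrrD.
have -> : (Num.sqrt (ln W) / Num.sqrt W) ^+ 2 = ln W / W.
  by rewrite expr_div_n !sqr_sqrtr // ltW.
have -> : (W `^ ((B - 1) / 2))^-1 ^+ 2 = W `^ (1 - B).
  by rewrite -powRN -powR_mulrn ?powR_ge0 // -powRrM; congr powR; field.
have : 0 <= Num.sqrt (ln W) / Num.sqrt W * (W `^ ((B - 1) / 2))^-1 by rewrite mulr_ge0.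
by rewrite mulr2n; lra.
Qed.

(** The bound gives e^W <= Q / ln Q, and also W <= ln Q since ln (ln Q) >= 0. *)
Lemma expRM_le_of_ln_ln (R : realType) (Q W : R) : expR 1 <= Q -> 0 <= W ->
  W <= ln Q - ln (ln Q) - 1 -> expR W * W <= Q.
Proof.
move=> Q1 W0 hW.
have Q0 : 0 < Q by apply: lt_le_trans Q1; exact: expR_gt0.
have l1 : 1 <= ln Q by rewrite -[leLHS]expRK ler_ln ?posrE ?expR_gt0.
have l0 : 0 < ln Q by lra.
have ll0 : 0 <= ln (ln Q) by exact: ln_ge0.
apply: (@le_trans _ _ (expR (ln Q - ln (ln Q)) * ln Q)).
  by apply: ler_pM; rewrite ?expR_ge0 // ?ler_expR; lra.
by rewrite expRD expRN !lnK ?posrE // divfK // gt_eqF.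
Qed.

Theorem theorem1p1 (R : realType) (alpha beta A B : R) (q : nat -> R) (CA : R)
    (alpha_gt0 : 0 < alpha) (beta_gt0 : 0 < beta) (A_ge0 : 0 <= A)
    (B_gt : Num.max A 1 < B)
    (q_seq : is_sequenceA alpha beta A B q)
    (CA_const : is_constA alpha beta A q CA)
    (c0 kappa K : R) (c0_gt0 : 0 < c0) (kappa_gt0 : 0 < kappa) :
  exists Theta c : R, [/\ 0 < Theta, 1 <= c &
  exists C Q0 : R, forall Q : R, Q0 <= Q ->
  forall (d : measure_display) (T : measurableType d) (P : probability T R)
    (d' : measure_display) (T' : measurableType d') (P' : probability T' R)
    (Ys : nat -> {RV P >-> R}) (Y : {RV P' >-> R}),
  CRVH c0 kappa K Ys Y ->
  forall V : R, 1 + CA <= V ->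
  let W := Wfun alpha A CA V in
  c <= W <= ln Q - ln (ln Q) - Theta ->
  exists delta : R,
    `|delta| <= C * (Num.sqrt (ln W) / Num.sqrt W + (W `^ ((B - 1) / 2))^-1) /\
    Phi P q Q (fun n => Ys n) V =
      (expR (- (alpha * beta * expR (- etaY P' Y - 1) * W `^ (A - 1) * expR W *
                (1 + delta))))%:E].
Proof.
have [AB B1] : A < B /\ 1 < B by move: B_gt; rewrite gt_max => /andP.
have [V1 [Cc [Ch [V2 Cc0 Ch0 [upE rc]]]]] :=
  regular_count_exists alpha_gt0 beta_gt0 A_ge0 B_gt q_seq CA_const.
pose C0 := 4 + 64 * c0 + 16 * `|ln kappa|.
have C00 : 0 <= C0 by rewrite !addr_ge0 ?mulr_ge0 // ltW.
have [C [w0 [Cgt0 w04 tail]]] := tail_estimate alpha_gt0 beta_gt0 A_ge0 AB B1 V2 Cc0 Ch0 C00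
  (normr_ge0 K) (ltW beta_gt0) rc.
(* [Theta = 1] is large enough: the size condition of [tail_estimate] then holds with constant
   [beta], whose effect is absorbed into [C] and [w0]. *)
exists 1, w0; split => //; first by lra.
(* The first summand of [Q0] gives ln Q >= 1, the second makes [upto q Q] an initial segment. *)
exists C, (expR 1 + beta * expR (V1 / 2)) => Q hQ d T P d' T' P' Ys Y hY V hV W /andP[hW1 hW2].
have b0 : 0 < beta * expR (V1 / 2) by rewrite mulr_gt0 ?expR_gt0.
have e0 := expR_gt0 (1 : R).
have Q1 : expR 1 <= Q by lra.
have QV : beta * expR (V1 / 2) <= Q by lra.
have Q0 : 0 < Q by lra.
have W1 : 1 <= W by lra.
have [z Qz] : exists z, Q = beta * expR z.
  by exists (ln (Q / beta)); rewrite lnK ?posrE ?divr_gt0 // mulrC divfK ?gt_eqF.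
have hz : expR W * W <= beta * expR z.
  by rewrite -Qz; apply: expRM_le_of_ln_ln => //; lra.
have cf : coupled_family C0 `|K| (fun n => lmgf P (Ys n)) (lmgf P' Y).
  split; first exact: (CRVH_logmgf_like c0_gt0 kappa_gt0 hY).
    exact: (CRVH_limit_logmgf_like c0_gt0 kappa_gt0 hY).
  exact: (CRVH_lmgf_coupling hY).
pose H w := \sum_(n < qcount q (beta * expR z)) (Ys n w / q n).
have mH : measurable_fun setT H.
  by apply: measurable_sum => n; apply: measurable_funM.
have Yb n : {ae P, forall w, `|Ys n w| <= 1}.
  by apply: filterS (CRVH_support hY n) => w; rewrite ler_norml.
have [delta hd Pd] := tail d T P H _ _ W z mH cf
  (mgf_independent_sum (CRVH_independent hY) Yb q _) hW1 hz.
exists delta; split.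
  by apply: (le_trans hd); rewrite ler_pM2l // sqrt_saddle_error.
have HE : Hrandom q (fun n => Ys n) Q = H.
  apply/funext => w; rewrite /Hrandom upE // Qz.
  by rewrite -(fsbig_ord _ _ (fun n => Ys n w / q n)).
rewrite /Phi HE -(main_term_Wfun alpha_gt0 A_ge0 hV) -/W -[LHS]fineK ?fin_num_measure //; last first.
  rewrite (_ : [set w | _] = H @^-1` `]CA + main_term alpha A W, +oo[%classic).
    by rewrite -[X in measurable X]setTI; exact: mH.
  by apply/seteqP; split => w /=; rewrite in_itv /= andbT.
(* What remains holds by conversion: [eta_tail (lmgf P' Y) 0] unfolds to [etaY P' Y]. *)
by rewrite Pd.
Qed.
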